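(* Let $\eta\in\{0,1\}$ and let $P,Q$ be image-finite processes in which only output-controlled names occur. If $P\simeq_\eta Q$ (sequential barbed equivalence at $\eta$), then $P\approx_s^\eta Q$ (sequential bisimilarity at $\eta$).
   Context: Asynchronous $\pi$-calculus: processes $P ::= a\langle\tilde b\rangle \mid\ !a(\tilde b).P \mid P|Q \mid (\nu a)P \mid G$, with $G ::= \mathbf 0 \mid a(\tilde b).P \mid \tau.P \mid [a=b]G \mid G+G'$, well-sorted under a fixed sorting. $P\xrightarrow{\mu}P'$ is the standard early LTS of the asynchronous $\pi$-calculus, actions $\mu ::= \tau \mid a(\tilde b) \mid (\nu\tilde c)a\langle\tilde b\rangle$ with subject $a$. $\Longrightarrow$ is the reflexive–transitive closure of $\xrightarrow{\tau}$; $\stackrel{\hat\mu}{\Longrightarrow}$ is $\Longrightarrow$ if $\mu=\tau$ and $\Longrightarrow\xrightarrow{\mu}\Longrightarrow$ otherwise; $P\longrightarrow P'$ means $P\xrightarrow{\tau}P'$. A static context is $E=(\nu\tilde a)(R\mid[\cdot])$. The class of image-finite processes is the largest set $\mathcal I$ of processes closed under transitions such that for all $P\in\mathcal I$ and all $\mu$, the set $\{P' : P\stackrel{\mu}{\Longrightarrow}P'\}$ is finite up to alpha-conversion. Sequentiality: names are partitioned into output-controlled ($x,y,z$) and input-controlled ($u,v,w$). Judgements $\vdash_\eta P$, $\eta\in\{0,1\}$: $\vdash_1 u(\tilde a).P$ if $\vdash_1P$; $\vdash_0 x(\tilde a).P$, $\vdash_0 !x(\tilde a).P$ if $\vdash_1P$;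 $\vdash_1x\langle\tilde a\rangle$; $\vdash_0u\langle\tilde a\rangle$; $\vdash_\eta(\nu a)P$ if $\vdash_\eta P$; $\vdash_0\mathbf0$; $\vdash_{\eta_1+\eta_2}P|Q$ if $\vdash_{\eta_1}P$, $\vdash_{\eta_2}Q$, $\eta_1+\eta_2\le1$; $\vdash_\eta G_1+G_2$ if $\vdash_\eta G_1,G_2$; $\vdash_\eta\tau.P$ if $\vdash_\eta P$; $\vdash_0[a=b]G$ if $\vdash_0G$. Type-allowed transition $\eta\vdash P\xrightarrow{\mu}P'$: $\vdash_\eta P$, $P\xrightarrow{\mu}P'$, and $\eta=0$, or $\mu=\tau$, or $\eta=1$ and $\mu$ is an input at an input-controlled name or an output at an output-controlled name. $\langle\eta;P\rangle\xrightarrow{\mu}\langle\eta';P'\rangle$ if $\eta\vdash P\xrightarrow{\mu}P'$ and $\eta'=1$ if $\mu$ is an input at an output-controlled name, $\eta'=0$ if $\mu$ is an output at an output-controlled name, $\eta'=\eta$ otherwise. $\eta\vdash P\stackrel{\mu}{\Longrightarrow}P'$ if $P\Longrightarrow P_0$, $\eta\vdash P_0\xrightarrow{\mu}P_1$, $P_1\Longrightarrow P'$. Sequential bisimulation: set $\mathcal R$ of triples $(\eta,P,Q)$ with $\vdash_\eta P,Q$ such that whenever $(\eta,P,Q)\in\mathcal R$ and $\langle\eta;P\rangle\xrightarrow{\mu}\langle\eta';P'\rangle$, either $Q\stackrel{\hat\mu}{\Longrightarrow}Q'$ with $(\eta',P',Q')\in\mathcal R$, or $\mu=a(\tilde b)$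 and $Q|a\langle\tilde b\rangle\Longrightarrow Q'$ with $(\eta',P',Q')\in\mathcal R$; and symmetrically. $P\approx_s^\eta Q$ if $(\eta,P,Q)$ is in some sequential bisimulation. $\eta\vdash P\Downarrow_a$ if there is an output action $\mu$ with subject $a$ and $P'$ with $\eta\vdash P\stackrel{\mu}{\Longrightarrow}P'$. $\dot\approx_\eta$ is the largest symmetric relation on processes typed $\vdash_\eta$ such that $P\dot\approx_\eta Q$ implies: $P\longrightarrow P'$ gives $Q\Longrightarrow Q'$ with $P'\dot\approx_\eta Q'$; and $\eta\vdash P\Downarrow_a$ iff $\eta\vdash Q\Downarrow_a$ for all $a$. $P\simeq_\eta Q$ if $\vdash_\eta P,Q$ and $E[P]\dot\approx_{\eta'}E[Q]$ for every $\eta'$ and every static context $E$ typable as $\vdash_{\eta'}E$ when the hole has type $\vdash_\eta[\cdot]$. *)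

(* Defs.v *)
From Stdlib Require Import Relation_Operators.
From Stdlib Require List.
From mathcomp Require Import all_boot finmap.

Set Implicit Arguments.
Unset Strict Implicit.
Unset Printing Implicit Defensive.

Local Open Scope fset_scope.

(* [obj s] lists the sorts of the objects carried by a name of sort [s].  The
   partition of names into output- and input-controlled ones is a partition of
   sorts, so that it is stable under well-sorted instantiation of parameters. *)
Record sorting := Sorting {
  srt : choiceType;
  obj : srt -> seq srt;
  outc : pred srt
}.

(* Infinitely many names of each sort. *)
Definition name (S : sorting) := (srt S * nat)%type.

Section Calculus.
Variable S : sorting.

Definition nsort (a : name S) : srt S := a.1.
Definition out_ctl (a : name S) : bool := outc (nsort a).

(* Locally nameless syntax, so that alpha-equivalence is equality.  [Bound d p]
   is the [p]-th parameter of the [d]-th enclosing binder, counting outwards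
   from 0; a restriction is a binder with one parameter. *)
Inductive ref := Free of name S | Bound of nat & nat.

(* The sequence of sorts in an input prefix and the sort in a restriction are
   the sorts of the names being bound. *)
Inductive proc :=
  | POut of ref & seq ref
  | PRep of ref & seq (srt S) & proc
  | PPar of proc & proc
  | PRes of srt S & proc
  | PGuard of guard
with guard :=
  | GNil
  | GIn of ref & seq (srt S) & proc
  | GTau of proc
  | GMatch of ref & ref & guard
  | GSum of guard & guard.

Fixpoint map_proc (f : nat -> ref -> ref) (k : nat) (P : proc) : proc :=
  match P with
  | POut a b => POut (f k a) (map (f k) b)
  | PRep a ss P => PRep (f k a) ss (map_proc f k.+1 P)
  | PPar P Q => PPar (map_proc f k P) (map_proc f k Q)
  | PRes s P => PRes s (map_proc f k.+1 P)
  | PGuard G => PGuard (map_guard f k G)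
  end
with map_guard (f : nat -> ref -> ref) (k : nat) (G : guard) : guard :=
  match G with
  | GNil => GNil
  | GIn a ss P => GIn (f k a) ss (map_proc f k.+1 P)
  | GTau P => GTau (map_proc f k P)
  | GMatch a b G => GMatch (f k a) (f k b) (map_guard f k G)
  | GSum G1 G2 => GSum (map_guard f k G1) (map_guard f k G2)
  end.

Definition open_ref (cs : seq (name S)) (k : nat) (r : ref) : ref :=
  match r with
  | Free a => Free a
  | Bound d p => if d == k then if onth cs p is Some c then Free c else r
                 else r
  end.

Definition close_ref (a : name S) (k : nat) (r : ref) : ref :=
  match r with
  | Free b => if b == a then Bound k 0 else r
  | Bound _ _ => r
  end.

(* [instantiate cs P] is the body [P] of a binder with its parameters replaced
   by [cs]; no capture can occur. *)
Definition instantiate (cs : seq (name S)) (P : proc) : proc :=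
  map_proc (open_ref cs) 0 P.

Definition nu (a : name S) (P : proc) : proc :=
  PRes (nsort a) (map_proc (close_ref a) 0 P).

Definition nus (cs : seq (name S)) (P : proc) : proc := foldr nu P cs.

Definition fn_ref (r : ref) : seq (name S) := if r is Free a then [:: a] else [::].

Fixpoint fn (P : proc) : seq (name S) :=
  match P with
  | POut a b => fn_ref a ++ flatten (map fn_ref b)
  | PRep a _ P => fn_ref a ++ fn P
  | PPar P Q => fn P ++ fn Q
  | PRes _ P => fn P
  | PGuard G => fn_guard G
  end
with fn_guard (G : guard) : seq (name S) :=
  match G with
  | GNil => [::]
  | GIn a _ P => fn_ref a ++ fn P
  | GTau P => fn P
  | GMatch a b G => fn_ref a ++ fn_ref b ++ fn_guard G
  | GSum G1 G2 => fn_guard G1 ++ fn_guard G2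
  end.

(* [Gamma] lists the parameter sorts of the enclosing binders, innermost first. *)
Definition sort_of (Gamma : seq (seq (srt S))) (r : ref) : option (srt S) :=
  match r with
  | Free a => Some (nsort a)
  | Bound d p => onth (nth [::] Gamma d) p
  end.

Fixpoint sorted_proc (Gamma : seq (seq (srt S))) (P : proc) : bool :=
  match P with
  | POut a b => if sort_of Gamma a is Some s
                then map (sort_of Gamma) b == map Some (obj s) else false
  | PRep a ss P => (omap (@obj S) (sort_of Gamma a) == Some ss)
                   && sorted_proc (ss :: Gamma) P
  | PPar P Q => sorted_proc Gamma P && sorted_proc Gamma Q
  | PRes s P => sorted_proc ([:: s] :: Gamma) P
  | PGuard G => sorted_guard Gamma G
  end
with sorted_guard (Gamma : seq (seq (srt S))) (G : guard) : bool :=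
  match G with
  | GNil => true
  | GIn a ss P => (omap (@obj S) (sort_of Gamma a) == Some ss)
                  && sorted_proc (ss :: Gamma) P
  | GTau P => sorted_proc Gamma P
  | GMatch a b G => [&& isSome (sort_of Gamma a), isSome (sort_of Gamma b)
                      & sorted_guard Gamma G]
  | GSum G1 G2 => sorted_guard Gamma G1 && sorted_guard Gamma G2
  end.

(* In particular, [P] has no dangling [Bound] reference. *)
Definition well_sorted (P : proc) : bool := sorted_proc [::] P.

Definition out_ref (r : ref) : bool := if r is Free a then out_ctl a else true.

(* Bound names count as occurring, even when the binder is vacuous. *)
Fixpoint only_out (P : proc) : bool :=
  match P with
  | POut a b => out_ref a && all out_ref b
  | PRep a ss P => [&& out_ref a, all (@outc S) ss & only_out P]
  | PPar P Q => only_out P && only_out Q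
  | PRes s P => outc s && only_out P
  | PGuard G => only_out_guard G
  end
with only_out_guard (G : guard) : bool :=
  match G with
  | GNil => true
  | GIn a ss P => [&& out_ref a, all (@outc S) ss & only_out P]
  | GTau P => only_out P
  | GMatch a b G => [&& out_ref a, out_ref b & only_out_guard G]
  | GSum G1 G2 => only_out_guard G1 && only_out_guard G2
  end.

(* [AOut C a b] is the output of [b] at [a] extruding the names in [C]; the
   order in which names are extruded is immaterial, so [C] is a set. *)
Inductive action :=
  | ATau
  | AIn of name S & seq (name S)
  | AOut of {fset name S} & name S & seq (name S).

Definition bn (mu : action) : {fset name S} :=
  if mu is AOut C _ _ then C else fset0.

Definition names_of (mu : action) : seq (name S) :=
  match mu with
  | ATau => [::]
  | AIn a b => a :: b
  | AOut C a b => a :: b ++ enum_fset C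
  end.

Definition bn_fresh (mu : action) (P : proc) : Prop :=
  forall c, c \in bn mu -> c \notin fn P.

Definition out_msg (a : name S) (b : seq (name S)) : proc :=
  POut (Free a) (map Free b).

Inductive step : proc -> action -> proc -> Prop :=
  | step_out a b :
      step (out_msg a b) (AOut fset0 a b) (PGuard GNil)
  | step_in a ss P c :
      map nsort c = ss ->
      step (PGuard (GIn (Free a) ss P)) (AIn a c) (instantiate c P)
  | step_rep a ss P c :
      map nsort c = ss ->
      step (PRep (Free a) ss P) (AIn a c)
           (PPar (instantiate c P) (PRep (Free a) ss P))
  | step_tau P :
      step (PGuard (GTau P)) ATau P
  | step_match a G mu P' :
      step (PGuard G) mu P' ->
      step (PGuard (GMatch (Free a) (Free a) G)) mu P'
  | step_sumL G1 G2 mu P' :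
      step (PGuard G1) mu P' -> step (PGuard (GSum G1 G2)) mu P'
  | step_sumR G1 G2 mu P' :
      step (PGuard G2) mu P' -> step (PGuard (GSum G1 G2)) mu P'
  | step_parL P Q mu P' :
      step P mu P' -> bn_fresh mu Q -> step (PPar P Q) mu (PPar P' Q)
  | step_parR P Q mu Q' :
      step Q mu Q' -> bn_fresh mu P -> step (PPar P Q) mu (PPar P Q')
  | step_comL P Q cs a b P' Q' :
      uniq cs -> (forall c, c \in cs -> c \notin fn Q) ->
      step P (AOut [fset c in cs] a b) P' -> step Q (AIn a b) Q' ->
      step (PPar P Q) ATau (nus cs (PPar P' Q'))
  | step_comR P Q cs a b P' Q' :
      uniq cs -> (forall c, c \in cs -> c \notin fn P) ->
      step P (AIn a b) P' -> step Q (AOut [fset c in cs] a b) Q' ->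
      step (PPar P Q) ATau (nus cs (PPar P' Q'))
  | step_res c P mu P' :
      c \notin fn P -> c \notin names_of mu ->
      step (instantiate [:: c] P) mu P' ->
      step (PRes (nsort c) P) mu (nu c P')
  | step_open c P C a b P' :
      c \notin fn P -> c \in b -> c != a -> c \notin C ->
      step (instantiate [:: c] P) (AOut C a b) P' ->
      step (PRes (nsort c) P) (AOut (c |` C) a b) P'.

Definition weak : proc -> proc -> Prop :=
  clos_refl_trans proc (fun P P' => step P ATau P').

Definition weak_step (P : proc) (mu : action) (P' : proc) : Prop :=
  exists P0 P1, [/\ weak P P0, step P0 mu P1 & weak P1 P'].

Definition weak_hat (P : proc) (mu : action) (P' : proc) : Prop :=
  if mu is ATau then weak P P' else weak_step P mu P'.

Definition image_finite (P : proc) : Prop :=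
  exists I : proc -> Prop,
    [/\ I P,
        forall Q mu Q', I Q -> step Q mu Q' -> I Q'
      & forall Q mu, I Q ->
          exists l : seq proc, forall Q', weak_step Q mu Q' -> List.In Q' l].

Definition is_out (Gamma : seq (seq (srt S))) (r : ref) : Prop :=
  exists2 s, sort_of Gamma r = Some s & outc s.

Definition is_inp (Gamma : seq (seq (srt S))) (r : ref) : Prop :=
  exists2 s, sort_of Gamma r = Some s & ~~ outc s.

(* [eta] in {0, 1} is a boolean; the equation in [ty_par] is between naturals,
   which forces the sum to be at most 1. *)
Inductive typed (Gamma : seq (seq (srt S))) : bool -> proc -> Prop :=
  | ty_in_inp u ss P :
      is_inp Gamma u -> typed (ss :: Gamma) true P ->
      typed Gamma true (PGuard (GIn u ss P))
  | ty_in_out x ss P :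
      is_out Gamma x -> typed (ss :: Gamma) true P ->
      typed Gamma false (PGuard (GIn x ss P))
  | ty_rep x ss P :
      is_out Gamma x -> typed (ss :: Gamma) true P ->
      typed Gamma false (PRep x ss P)
  | ty_out_out x b :
      is_out Gamma x -> typed Gamma true (POut x b)
  | ty_out_inp u b :
      is_inp Gamma u -> typed Gamma false (POut u b)
  | ty_res eta s P :
      typed ([:: s] :: Gamma) eta P -> typed Gamma eta (PRes s P)
  | ty_nil :
      typed Gamma false (PGuard GNil)
  | ty_par (eta eta1 eta2 : bool) P Q :
      eta = (eta1 + eta2)%N :> nat ->
      typed Gamma eta1 P -> typed Gamma eta2 Q -> typed Gamma eta (PPar P Q)
  | ty_sum eta G1 G2 :
      typed Gamma eta (PGuard G1) -> typed Gamma eta (PGuard G2) ->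
      typed Gamma eta (PGuard (GSum G1 G2))
  | ty_tau eta P :
      typed Gamma eta P -> typed Gamma eta (PGuard (GTau P))
  | ty_match a b G :
      typed Gamma false (PGuard G) -> typed Gamma false (PGuard (GMatch a b G)).

Definition seq_typed (eta : bool) (P : proc) : Prop :=
  well_sorted P /\ typed [::] eta P.

Definition allowed (eta : bool) (mu : action) : Prop :=
  eta = false \/
  match mu with
  | ATau => True
  | AIn a _ => ~~ out_ctl a
  | AOut _ a _ => out_ctl a
  end.

Definition allowed_step (eta : bool) (P : proc) (mu : action) (P' : proc) : Prop :=
  [/\ seq_typed eta P, step P mu P' & allowed eta mu].

Definition next_eta (eta : bool) (mu : action) : bool :=
  match mu with
  | ATau => eta
  | AIn a _ => if out_ctl a then true else eta
  | AOut _ a _ => if out_ctl a then false else eta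
  end.

Definition config_step (eta : bool) (P : proc) (mu : action)
    (eta' : bool) (P' : proc) : Prop :=
  allowed_step eta P mu P' /\ eta' = next_eta eta mu.

Definition allowed_weak_step (eta : bool) (P : proc) (mu : action) (P' : proc) : Prop :=
  exists P0 P1, [/\ weak P P0, allowed_step eta P0 mu P1 & weak P1 P'].

(* [bn_fresh mu Q] is the usual convention that the bound names of the
   challenge are fresh; they are fresh for [P] by the rules of [step]. *)
Definition matches (R : bool -> proc -> proc -> Prop) (eta : bool) (P Q : proc) : Prop :=
  forall mu eta' P', config_step eta P mu eta' P' -> bn_fresh mu Q ->
    (exists2 Q', weak_hat Q mu Q' & R eta' P' Q') \/
    (exists a b, mu = AIn a b /\
       exists2 Q', weak (PPar Q (out_msg a b)) Q' & R eta' P' Q').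

Definition seq_bisimulation (R : bool -> proc -> proc -> Prop) : Prop :=
  forall eta P Q, R eta P Q ->
    [/\ seq_typed eta P, seq_typed eta Q, matches R eta P Q
      & matches (fun e P1 P2 => R e P2 P1) eta Q P].

Definition seq_bisimilar (eta : bool) (P Q : proc) : Prop :=
  exists2 R, seq_bisimulation R & R eta P Q.

Definition barb (eta : bool) (P : proc) (a : name S) : Prop :=
  exists C b P', allowed_weak_step eta P (AOut C a b) P'.

Definition barbed_bisimulation (eta : bool) (R : proc -> proc -> Prop) : Prop :=
  (forall P Q, R P Q -> R Q P) /\
  forall P Q, R P Q ->
    [/\ seq_typed eta P, seq_typed eta Q,
        forall P', step P ATau P' -> exists2 Q', weak Q Q' & R P' Q'
      & forall a, barb eta P a <-> barb eta Q a].

Definition barbed_bisimilar (eta : bool) (P Q : proc) : Prop :=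
  exists2 R, barbed_bisimulation eta R & R P Q.

(* [StaticCtx ns R] is (nu ns)(R | [.]); it may bind names of the process put
   in the hole. *)
Record static_ctx := StaticCtx { ctx_nu : seq (name S); ctx_par : proc }.

Definition fill (E : static_ctx) (P : proc) : proc :=
  nus (ctx_nu E) (PPar (ctx_par E) P).

(* The typing rules for parallel composition and restriction read on contexts,
   the hole having type [eta] and the context type [eta']. *)
Definition ctx_typed (eta eta' : bool) (E : static_ctx) : Prop :=
  exists2 etaR : bool, seq_typed etaR (ctx_par E) & eta' = (etaR + eta)%N :> nat.

Definition seq_barbed_equiv (eta : bool) (P Q : proc) : Prop :=
  [/\ seq_typed eta P, seq_typed eta Q
    & forall eta' E, ctx_typed eta eta' E ->
        barbed_bisimilar eta' (fill E P) (fill E Q)].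

End Calculus.

(* Main.v *)
Require Import Defs.
From Stdlib Require Import Relation_Operators Operators_Properties Classical.
From Stdlib Require List.
From mathcomp Require Import all_boot finmap zify.

(** Suppose [P] and [Q] are barbed equivalent but not bisimilar.  By image
    finiteness they are separated at some finite stage of the approximants of
    bisimilarity.  By induction on that stage one builds a context process that
    distinguishes them, and shows more: it distinguishes [P] from every internal
    derivative of [Q], or [Q] from every internal derivative of [P].  This
    stronger form is what makes it possible to combine, by an internal choice,
    the tests obtained for the finitely many answers to one challenge.

    The test carries a pair of flags, and both are weakly observable exactly as
    long as it has not moved; so a barbed bisimulation must keep the two copies
    of the test in step.  At [eta = 1] the thread belongs to the process, and
    the flags show up only if the process can output at all.  If a challenge
    leads to a state that can never output again, no flag helps, but then
    a test that merely takes the thread away suffices.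

    An input challenge at [x] is reduced to an internal one by putting the
    message at [x] next to both processes.  For an output challenge the test
    receives the objects and checks all equations between them and with the
    known names; this determines the answer up to a renaming of the extruded
    names. *)

Set Implicit Arguments.
Unset Strict Implicit.
Unset Printing Implicit Defensive.

Local Open Scope fset_scope.

(** * Names and substitution *)

Arguments GNil {S}.
Arguments ATau {S}.
Arguments Bound {S}.

(* Hole and test have complementary types, so all configurations compared have type 1, where exactly
   the outputs at output-controlled names are observable; the flags are therefore output-controlled.
   A communication puts restrictions in front, and not the same ones on the two sides, so separation
   is stated for all lists of restrictions that spare the flags. One flag would not do: a test that
   has raised it still shows it, but a test that has raised one of two flags has lost the other.
   Tests found for different answers are chosen independently and may share flags; in a choice, each
   is put behind a stage whose fresh flags tell which branch was taken. [GNil] and matching have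
   type 0 only: at type 1 a finite sum needs another last summand, and a comparison has to park the
   thread in a message. In the approximants an input is always answered with the message put beside
   the process. As all names are output-controlled, inputs are challenges at type 0 only, and
   outputs at type 1 only. *)
Scheme proc_mut := Induction for proc Sort Prop
  with guard_mut := Induction for guard Sort Prop.
Combined Scheme proc_guard_ind from proc_mut, guard_mut.

Section Membership.
Variable T : eqType.
Implicit Types (A : seq T) (a c : T).

Lemma sub_catl A1 A2 : {subset A1 <= A1 ++ A2}.
Proof. by move=> c Hc; rewrite mem_cat Hc. Qed.

Lemma sub_catr A1 A2 : {subset A2 <= A1 ++ A2}.
Proof. by move=> c Hc; rewrite mem_cat Hc orbT. Qed.

Lemma notin_cat A1 A2 c : c \notin A1 -> c \notin A2 -> c \notin A1 ++ A2.
Proof. by rewrite mem_cat negb_or => -> ->. Qed.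

Lemma notin_cat_inv A1 A2 c : c \notin A1 ++ A2 -> c \notin A1 /\ c \notin A2.
Proof. by rewrite mem_cat negb_or => /andP[]. Qed.

Lemma notin_cons a A c : c != a -> c \notin A -> c \notin a :: A.
Proof. by rewrite inE negb_or => -> ->. Qed.

End Membership.

Section Substitution.
Variable S : sorting.
Implicit Types (P Q : proc S) (G : guard S) (r : ref S) (a b c : name S).
Implicit Types (f g : nat -> ref S -> ref S) (Gamma : seq (seq (srt S))).

Lemma eq_map_proc_guard f g : (forall k r, f k r = g k r) ->
  (forall P k, map_proc f k P = map_proc g k P) /\
  (forall G k, map_guard f k G = map_guard g k G).
Proof.
move=> fg; apply: proc_guard_ind => //=; try by move=> *; rewrite ?fg; congruence.
by move=> r b k; rewrite fg; congr POut; apply: eq_map.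
Qed.

Lemma map_proc_guard_comp f g :
  (forall P k, map_proc f k (map_proc g k P) =
               map_proc (fun k r => f k (g k r)) k P) /\
  (forall G k, map_guard f k (map_guard g k G) =
               map_guard (fun k r => f k (g k r)) k G).
Proof.
apply: proc_guard_ind => //=; try by move=> *; congruence.
by move=> r b k; rewrite -map_comp.
Qed.

Lemma eq_map_some_in Gamma (F F' : ref S -> ref S) bs ss :
  map (sort_of Gamma) bs = map Some ss ->
  (forall r s, sort_of Gamma r = Some s -> F r = F' r) -> map F bs = map F' bs.
Proof.
move=> + FF; elim: bs ss => [|r bs IH] [|s ss] //= [/FF -> /IH ->]; by [].
Qed.

(** * Maps of references that respect sorts *)

Section InContext.
Variables (f : nat -> ref S -> ref S) (Gamma0 Delta0 : seq (seq (srt S))).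

(** A well-sorted term has no dangling reference, so agreement is needed only on references that
    have a sort at their depth. *)
Lemma eq_map_sorted g :
  (forall Gamma r s, sort_of (Gamma ++ Gamma0) r = Some s ->
     f (size Gamma) r = g (size Gamma) r) ->
  (forall P Gamma, sorted_proc (Gamma ++ Gamma0) P ->
     map_proc f (size Gamma) P = map_proc g (size Gamma) P) /\
  (forall G Gamma, sorted_guard (Gamma ++ Gamma0) G ->
     map_guard f (size Gamma) G = map_guard g (size Gamma) G).
Proof.
move=> fg; apply: proc_guard_ind => //=.
- move=> r b Gamma; case E: (sort_of _ _) => [s|] // /eqP H.
  rewrite (fg _ _ _ E); congr POut; apply: eq_map_some_in H _ => r' s'; exact: fg.
- move=> r ss P IH Gamma; case E: (sort_of _ _) => [s|] // /andP[_ H].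
  by rewrite (fg _ _ _ E) (IH (ss :: Gamma)).
- by move=> P IHP Q IHQ Gamma /andP[/IHP -> /IHQ ->].
- by move=> s P IH Gamma H; rewrite (IH ([:: s] :: Gamma)).
- by move=> G IH Gamma /IH ->.
- move=> r ss P IH Gamma; case E: (sort_of _ _) => [s|] // /andP[_ H].
  by rewrite (fg _ _ _ E) (IH (ss :: Gamma)).
- by move=> P IH Gamma /IH ->.
- move=> r r' G IH Gamma; case E: (sort_of _ r) => [s|] //.
  case E': (sort_of _ r') => [s'|] //= /IH ->.
  by rewrite (fg _ _ _ E) (fg _ _ _ E').
- by move=> G1 IH1 G2 IH2 Gamma /andP[/IH1 -> /IH2 ->].
Qed.

Hypothesis fsort : forall Gamma r s,
  sort_of (Gamma ++ Gamma0) r = Some s ->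
  sort_of (Gamma ++ Delta0) (f (size Gamma) r) = Some s.

Lemma map_proc_sorted :
  (forall P Gamma, sorted_proc (Gamma ++ Gamma0) P ->
     sorted_proc (Gamma ++ Delta0) (map_proc f (size Gamma) P)) /\
  (forall G Gamma, sorted_guard (Gamma ++ Gamma0) G ->
     sorted_guard (Gamma ++ Delta0) (map_guard f (size Gamma) G)).
Proof.
apply: proc_guard_ind => //=.
- move=> r b Gamma; case E: (sort_of _ _) => [s|] // /eqP H.
  rewrite (fsort E) -map_comp -H; apply/eqP.
  elim: b (obj s) H => [|r' b IH] [|s' ss] //= [E' /IH ->].
  by rewrite E' (fsort E').
- move=> r ss P IH Gamma; case E: (sort_of _ _) => [s|] //= /andP[Hs H].
  by rewrite (fsort E) /= Hs (IH (ss :: Gamma)).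
- by move=> P IHP Q IHQ Gamma /andP[/IHP -> /IHQ ->].
- by move=> s P IH Gamma H; rewrite (IH ([:: s] :: Gamma)).
- move=> r ss P IH Gamma; case E: (sort_of _ _) => [s|] //= /andP[Hs H].
  by rewrite (fsort E) /= Hs (IH (ss :: Gamma)).
- move=> r r' G IH Gamma; case E: (sort_of _ r) => [s|] //.
  case E': (sort_of _ r') => [s'|] //= /IH ->.
  by rewrite (fsort E) (fsort E').
- by move=> G1 IH1 G2 IH2 Gamma /andP[/IH1 -> /IH2 ->].
Qed.

Lemma is_out_map Gamma r :
  is_out (Gamma ++ Gamma0) r -> is_out (Gamma ++ Delta0) (f (size Gamma) r).
Proof. by case=> s /fsort E Hs; exists s. Qed.

Lemma is_inp_map Gamma r :
  is_inp (Gamma ++ Gamma0) r -> is_inp (Gamma ++ Delta0) (f (size Gamma) r).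
Proof. by case=> s /fsort E Hs; exists s. Qed.

Lemma typed_map P eta Gamma : typed (Gamma ++ Gamma0) eta P ->
  typed (Gamma ++ Delta0) eta (map_proc f (size Gamma) P).
Proof.
move E: (Gamma ++ Gamma0) => Gamma' H; elim: H Gamma E => {Gamma' eta P}.
- move=> Gamma' r ss P Hr _ IH Gamma E; subst Gamma'.
  by apply: ty_in_inp; [exact: is_inp_map | exact: (IH (ss :: Gamma))].
- move=> Gamma' r ss P Hr _ IH Gamma E; subst Gamma'.
  by apply: ty_in_out; [exact: is_out_map | exact: (IH (ss :: Gamma))].
- move=> Gamma' r ss P Hr _ IH Gamma E; subst Gamma'.
  by apply: ty_rep; [exact: is_out_map | exact: (IH (ss :: Gamma))].
- by move=> Gamma' r b Hr Gamma E; subst Gamma'; apply: ty_out_out; exact: is_out_map.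
- by move=> Gamma' r b Hr Gamma E; subst Gamma'; apply: ty_out_inp; exact: is_inp_map.
- move=> Gamma' eta s P _ IH Gamma E; subst Gamma'.
  by apply: ty_res; exact: (IH ([:: s] :: Gamma)).
- by move=> *; apply: ty_nil.
- by move=> Gamma' eta e1 e2 P Q He _ IHP _ IHQ Gamma E; apply: (ty_par He); auto.
- by move=> Gamma' eta G1 G2 _ IH1 _ IH2 Gamma E; apply: ty_sum; [apply: IH1|apply: IH2].
- by move=> Gamma' eta P _ IH Gamma E; apply: ty_tau; apply: IH.
- by move=> Gamma' r r' G _ IH Gamma E; apply: ty_match; apply: IH.
Qed.

End InContext.

Lemma only_out_map f : (forall k r, out_ref r -> out_ref (f k r)) ->
  (forall P k, only_out P -> only_out (map_proc f k P)) /\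
  (forall G k, only_out_guard G -> only_out_guard (map_guard f k G)).
Proof.
move=> Hf; apply: proc_guard_ind => //=.
- move=> r b k /andP[/Hf -> /=]; rewrite all_map.
  by elim: b => //= r' b IH /andP[/Hf -> /IH].
- by move=> r ss P IH k /and3P[/Hf -> -> /IH ->].
- by move=> P IHP Q IHQ k /andP[/IHP -> /IHQ ->].
- by move=> s P IH k /andP[-> /IH ->].
- by move=> r ss P IH k /and3P[/Hf -> -> /IH ->].
- by move=> r r' G IH k /and3P[/Hf -> /Hf -> /IH ->].
- by move=> G1 IH1 G2 IH2 k /andP[/IH1 -> /IH2 ->].
Qed.

(** [p] bounds the names that survive the map, [q] those that it may introduce. Instantiation,
    restriction and the later abstraction of extruded names are instances. *)
Lemma fn_map_sub f (p q : pred (name S)) :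
  (forall k r c, c \in fn_ref (f k r) -> (c \in fn_ref r) && p c || q c) ->
  (forall P k c, c \in fn (map_proc f k P) -> (c \in fn P) && p c || q c) /\
  (forall G k c, c \in fn_guard (map_guard f k G) -> (c \in fn_guard G) && p c || q c).
Proof.
move=> Hf; have mono L L' c : (c \in L) && p c || q c ->
  (c \in L ++ L') && p c || q c.
  by rewrite mem_cat andb_orl => /orP[->|->]; rewrite ?orbT.
have mono' L L' c : (c \in L) && p c || q c -> (c \in L' ++ L) && p c || q c.
  by rewrite mem_cat andb_orl => /orP[->|->]; rewrite ?orbT.
apply: proc_guard_ind => //=.
- move=> r b k c; rewrite mem_cat => /orP[/Hf /mono //|H].
  apply: (mono' _ _ _); elim: b H => //= r' b IH; rewrite mem_cat => /orP[/Hf/mono //|].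
  by move/IH/mono'.
- by move=> r ss P IH k c; rewrite mem_cat => /orP[/Hf/mono //|/IH/mono'].
- by move=> P IHP Q IHQ k c; rewrite mem_cat => /orP[/IHP/mono //|/IHQ/mono'].
- by move=> s P IH k c /IH.
- by move=> r ss P IH k c; rewrite mem_cat => /orP[/Hf/mono //|/IH/mono'].
- move=> r r' G IH k c; rewrite mem_cat => /orP[/Hf/mono //|]; rewrite mem_cat.
  by case/orP=> [/Hf/mono H|/IH/mono' H]; apply: (mono' _ _ _); apply: H.
- by move=> G1 IH1 G2 IH2 k c; rewrite mem_cat => /orP[/IH1/mono //|/IH2/mono'].
Qed.

Lemma fn_map_sup f (c : name S) :
  (forall k r, c \in fn_ref r -> c \in fn_ref (f k r)) ->
  (forall P k, c \in fn P -> c \in fn (map_proc f k P)) /\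
  (forall G k, c \in fn_guard G -> c \in fn_guard (map_guard f k G)).
Proof.
move=> Hf; apply: proc_guard_ind => //=.
- move=> r b k; rewrite !mem_cat => /orP[/Hf -> //|H]; apply/orP; right.
  elim: b H => //= r' b IH; rewrite !mem_cat => /orP[/Hf -> //|/IH ->].
  by rewrite orbT.
- by move=> r ss P IH k; rewrite !mem_cat => /orP[/Hf|/IH] ->; rewrite ?orbT.
- by move=> P IHP Q IHQ k; rewrite !mem_cat => /orP[/IHP|/IHQ] ->; rewrite ?orbT.
- by move=> s P IH k /IH.
- by move=> r ss P IH k; rewrite !mem_cat => /orP[/Hf|/IH] ->; rewrite ?orbT.
- by move=> r r' G IH k; rewrite !mem_cat => /or3P[/Hf|/Hf|/IH] ->; rewrite ?orbT.
- by move=> G1 IH1 G2 IH2 k; rewrite !mem_cat => /orP[/IH1|/IH2] ->; rewrite ?orbT.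
Qed.

Lemma onth_map_some (T U : Type) (h : T -> U) (s : seq T) p x :
  onth (map h s) p = Some x -> exists2 y, onth s p = Some y & x = h y.
Proof. by rewrite onth_map; case: (onth s p) => //= y [<-]; exists y. Qed.

Lemma onth_mem (T : eqType) (s : seq T) p x : onth s p = Some x -> x \in s.
Proof. by move=> E; apply/onthP; exists p. Qed.

Lemma onth_index (T : eqType) (s : seq T) x : x \in s -> onth s (index x s) = Some x.
Proof.
elim: s => //= y s IH; rewrite inE eq_sym; case: eqP => [->|_] //=.
Qed.

Lemma fn_instantiate cs P c :
  c \in fn (instantiate cs P) -> (c \in fn P) || (c \in cs).
Proof.
have [|H _] := @fn_map_sub (open_ref cs) xpredT (mem cs); last first.
  by move/H; rewrite andbT.
move=> k [a|d p] c' /=; first by rewrite andbT => ->.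
case: eqP => // _; case E: (onth cs p) => [c0|] //=.
by rewrite inE => /eqP ->; exact: onth_mem E.
Qed.

Lemma fn_instantiate_sup cs P c : c \in fn P -> c \in fn (instantiate cs P).
Proof. by apply: (proj1 (@fn_map_sup (open_ref cs) c _)) => k [a|d p]. Qed.

Lemma fn_nu a P c : (c \in fn (nu a P)) = (c != a) && (c \in fn P).
Proof.
apply/idP/andP => [|[ca H]].
  have [|H _] := @fn_map_sub (close_ref a) (predC1 a) xpred0; last first.
    by move/H; rewrite orbF /= => /andP[H1 H2]; split.
  move=> k [b|d p] c' //=; case: eqP => //= /eqP ba; rewrite inE => /eqP ->.
  by rewrite ?inE eqxx ba.
apply: (proj1 (@fn_map_sup (close_ref a) c _)) => // k [b|d p] //=.
by rewrite inE => /eqP <-; rewrite (negPf ca) /= inE.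
Qed.

Lemma fn_nus cs P c : (c \in fn (nus cs P)) = (c \notin cs) && (c \in fn P).
Proof. by elim: cs => //= a cs IH; rewrite fn_nu IH inE negb_or andbA. Qed.

Lemma nus_cat cs cs' P : nus (cs ++ cs') P = nus cs (nus cs' P).
Proof. exact: foldr_cat. Qed.

(** An index beyond [Gamma] reads the default [[::]], in which no position has a sort; so a
    reference with a sort points into [Gamma]. *)
Lemma sort_of_weaken Gamma Delta r s :
  sort_of Gamma r = Some s -> sort_of (Gamma ++ Delta) r = Some s.
Proof.
case: r => [a|d p] //=; rewrite nth_cat; case: ltnP => // H.
by rewrite nth_default //; case: p.
Qed.

Lemma open_sort cs Gamma r s :
  sort_of (Gamma ++ [:: map (@nsort S) cs]) r = Some s ->
  sort_of (Gamma ++ [::]) (open_ref cs (size Gamma) r) = Some s.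
Proof.
rewrite cats0; case: r => [a|d p] //=; rewrite nth_cat; case: ltnP => H.
  by rewrite ltn_eqF.
case: eqP => [->|ne].
  by rewrite subnn /= => /(@onth_map_some _ _ _ _ _ _)[c E ->]; rewrite E.
have -> : nth [::] [:: [seq nsort i | i <- cs]] (d - size Gamma) = [::] by
  case E: (d - size Gamma) => [|[|k]] //=; move: ne; lia.
by case: p.
Qed.

Lemma close_sort a Gamma r s :
  sort_of (Gamma ++ [::]) r = Some s ->
  sort_of (Gamma ++ [:: [:: nsort a]]) (close_ref a (size Gamma) r) = Some s.
Proof.
rewrite cats0; case: r => [b|d p] /=; last exact: (@sort_of_weaken _ _ (Bound d p)).
by case=> <-; case: eqP => [->|] //=; rewrite nth_cat ltnn subnn.
Qed.

Lemma ws_instantiate cs P : sorted_proc [:: map (@nsort S) cs] P ->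
  well_sorted (instantiate cs P).
Proof. exact: (proj1 (map_proc_sorted (@open_sort cs)) P [::]). Qed.

Lemma ws_nu a P : well_sorted P -> well_sorted (nu a P).
Proof. exact: (proj1 (map_proc_sorted (@close_sort a)) P [::]). Qed.

Lemma typed_instantiate eta cs P : typed [:: map (@nsort S) cs] eta P ->
  typed [::] eta (instantiate cs P).
Proof. exact: (typed_map (@open_sort cs) (Gamma := [::])). Qed.

Lemma typed_nu eta a P : typed [::] eta P -> typed [::] eta (nu a P).
Proof.
move=> H; apply: ty_res; exact: (typed_map (@close_sort a) (Gamma := [::])).
Qed.

Lemma ws_nus cs P : well_sorted P -> well_sorted (nus cs P).
Proof. by move=> H; elim: cs => //= c cs; exact: ws_nu. Qed.

Lemma typed_nus eta cs P : typed [::] eta P -> typed [::] eta (nus cs P).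
Proof. by move=> H; elim: cs => //= c cs; exact: typed_nu. Qed.

Lemma only_out_instantiate cs P : all (@out_ctl S) cs -> only_out P ->
  only_out (instantiate cs P).
Proof.
move=> /allP H; apply: (proj1 (only_out_map _)) => k [a|d p] //= _.
by case: eqP => // _; case E: (onth _ _) => [c|] //=; apply/H/(onth_mem E).
Qed.

Lemma only_out_nu a P : out_ctl a -> only_out P -> only_out (nu a P).
Proof.
move=> Ha H; rewrite /= -/(out_ctl a) Ha; apply: (proj1 (only_out_map _)) H.
by move=> k [b|d p] //=; case: eqP.
Qed.

Lemma only_out_fn :
  (forall P, only_out P -> all (@out_ctl S) (fn P)) /\
  (forall G, only_out_guard G -> all (@out_ctl S) (fn_guard G)).
Proof.
have Hr r : out_ref r -> all (@out_ctl S) (fn_ref r) by case: r => //= a ->.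
apply: proc_guard_ind => //=.
- move=> r b /andP[/Hr]; rewrite all_cat => -> /=.
  by elim: b => //= r' b IH /andP[/Hr]; rewrite all_cat => -> /IH.
- by move=> r ss P IH /and3P[/Hr]; rewrite all_cat => -> _ /IH.
- by move=> P IHP Q IHQ /andP[/IHP]; rewrite all_cat => -> /IHQ.
- by move=> s P IH /andP[_ /IH].
- by move=> r ss P IH /and3P[/Hr]; rewrite all_cat => -> _ /IH.
- by move=> r r' G IH /and3P[/Hr + /Hr]; rewrite !all_cat => -> -> /IH.
- by move=> G1 IH1 G2 IH2 /andP[/IH1]; rewrite all_cat => -> /IH2.
Qed.

(** * Renamings and transpositions of names *)

Definition ren_ref (h : name S -> name S) (_ : nat) (r : ref S) : ref S :=
  if r is Free a then Free (h a) else r.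

Definition ren h P := map_proc (ren_ref h) 0 P.

Lemma ren_depth h :
  (forall P k l, map_proc (ren_ref h) k P = map_proc (ren_ref h) l P) /\
  (forall G k l, map_guard (ren_ref h) k G = map_guard (ren_ref h) l G).
Proof.
apply: proc_guard_ind => //= *; by f_equal; auto.
Qed.

Lemma fn_ren h :
  (forall P k, fn (map_proc (ren_ref h) k P) = map h (fn P)) /\
  (forall G k, fn_guard (map_guard (ren_ref h) k G) = map h (fn_guard G)).
Proof.
have Hr k r : fn_ref (ren_ref h k r) = map h (fn_ref r) by case: r.
apply: proc_guard_ind => //=; try by move=> *; rewrite ?Hr ?map_cat; congruence.
by move=> r b k; rewrite Hr map_cat; congr cat; elim: b => //= r' b ->; rewrite Hr map_cat.
Qed.

Lemma eq_ren_in (h h' : name S -> name S) :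
  (forall P k, {in fn P, h =1 h'} ->
     map_proc (ren_ref h) k P = map_proc (ren_ref h') k P) /\
  (forall G k, {in fn_guard G, h =1 h'} ->
     map_guard (ren_ref h) k G = map_guard (ren_ref h') k G).
Proof.
have Hr k r : {in fn_ref r, h =1 h'} -> ren_ref h k r = ren_ref h' k r.
  by case: r => //= a ->; rewrite // inE.
have catl (s t : seq (name S)) : {in s ++ t, h =1 h'} -> {in s, h =1 h'}.
  by move=> H c Hc; apply: H; rewrite mem_cat Hc.
have catr (s t : seq (name S)) : {in s ++ t, h =1 h'} -> {in t, h =1 h'}.
  by move=> H c Hc; apply: H; rewrite mem_cat Hc orbT.
apply: proc_guard_ind => //=.
- move=> r b k H; rewrite (Hr _ _ (catl _ _ H)); congr POut.
  elim: b {H}(catr _ _ H) => //= r' b IH H.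
  by rewrite (Hr _ _ (catl _ _ H)) IH //; exact: catr H.
- by move=> r ss P IH k H; rewrite (Hr _ _ (catl _ _ H)) IH //; exact: catr H.
- by move=> P IHP Q IHQ k H; rewrite IHP ?IHQ //; [exact: catr H|exact: catl H].
- by move=> s P IH k H; rewrite IH.
- by move=> G IH k H; rewrite IH.
- by move=> r ss P IH k H; rewrite (Hr _ _ (catl _ _ H)) IH //; exact: catr H.
- by move=> P IH k H; rewrite IH.
- move=> r r' G IH k H; rewrite (Hr _ _ (catl _ _ H)).
  by rewrite (Hr _ _ (catl _ _ (catr _ _ H))) IH //; exact: catr (catr _ _ H).
- by move=> G1 IH1 G2 IH2 k H; rewrite IH1 ?IH2 //; [exact: catr H|exact: catl H].
Qed.

Lemma map_proc_guard_id f : (forall k r, f k r = r) ->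
  (forall P k, map_proc f k P = P) /\ (forall G k, map_guard f k G = G).
Proof.
move=> Hf; apply: proc_guard_ind => //= *; f_equal => //.
by rewrite -[RHS]map_id; apply: eq_map.
Qed.

Lemma ren_id P : ren id P = P.
Proof. by apply: (proj1 (map_proc_guard_id _)) => k []. Qed.

Lemma ren_instantiate h cs P :
  ren h (instantiate cs P) = instantiate (map h cs) (ren h P).
Proof.
rewrite /ren /instantiate !(proj1 (map_proc_guard_comp _ _)).
apply: (proj1 (eq_map_proc_guard _)) => k [a|d p] //=.
by case: eqP => //= _; rewrite onth_map; case: (onth cs p).
Qed.

Lemma ren_nu h c P : injective h -> nsort (h c) = nsort c ->
  ren h (nu c P) = nu (h c) (ren h P).
Proof.
move=> hi hs; rewrite /nu hs /ren /=; congr PRes.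
rewrite (proj1 (ren_depth h) _ 1 0) !(proj1 (map_proc_guard_comp _ _)).
apply: (proj1 (eq_map_proc_guard _)) => k [a|d p] //=.
by rewrite (inj_eq hi); case: eqP.
Qed.

Lemma ren_nus h cs P : injective h -> (forall c, nsort (h c) = nsort c) ->
  ren h (nus cs P) = nus (map h cs) (ren h P).
Proof. by move=> hi hs; elim: cs => //= c cs IH; rewrite ren_nu // IH. Qed.

Definition ren_act h (mu : action S) : action S :=
  match mu with
  | ATau => ATau
  | AIn a b => AIn (h a) (map h b)
  | AOut C a b => AOut (h @` C) (h a) (map h b)
  end.

Lemma imfset_seq (h : name S -> name S) (cs : seq (name S)) : h @` [fset c in cs] = [fset c in map h cs].
Proof.
apply/fsetP => x; rewrite !inE /=; apply/imfsetP/mapP => -[y /= Hy ->].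
  by exists y => //; move: Hy; rewrite !inE.
by exists y => //; rewrite !inE.
Qed.

(** The side conditions of the rules are inequalities, non-memberships and conditions on sorts.
    Injectivity preserves the former, and preservation of sorts the latter. Every later change of an
    extruded or restricted name rests on this. *)
Lemma step_ren h P mu P' : injective h -> (forall c, nsort (h c) = nsort c) ->
  step P mu P' -> step (ren h P) (ren_act h mu) (ren h P').
Proof.
move=> hi hs; have hm cs : map (@nsort S) (map h cs) = map (@nsort S) cs.
  by rewrite -map_comp; apply: eq_map => c; exact: hs.
have hfr P0 c : c \notin fn P0 -> h c \notin fn (ren h P0).
  by rewrite /ren (proj1 (fn_ren h)) mem_map.
have hbn mu0 P0 : bn_fresh mu0 P0 -> bn_fresh (ren_act h mu0) (ren h P0).
  move=> Hf c; case: mu0 Hf => //= C a b Hf /imfsetP[/= c' Hc' ->].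
  exact/hfr/Hf.
elim=> {P mu P'}.
- move=> a b; rewrite /ren /= -map_comp.
  rewrite (_ : map _ b = map (@Free S) (map h b)); last by rewrite -map_comp.
  rewrite (_ : h @` fset0 = fset0); last exact: imfset0.
  exact: step_out.
- move=> a ss P c Hc; rewrite ren_instantiate /ren /= (proj1 (ren_depth h) _ 1 0).
  by apply: step_in; rewrite hm.
- move=> a ss P c Hc; rewrite {2}/ren /= -/(ren h _) ren_instantiate /ren /=.
  by rewrite (proj1 (ren_depth h) _ 1 0); apply: step_rep; rewrite hm.
- by move=> P; apply: step_tau.
- by move=> a G mu P' _ IH; apply: step_match.
- by move=> G1 G2 mu P' _ IH; apply: step_sumL.
- by move=> G1 G2 mu P' _ IH; apply: step_sumR.
- by move=> P Q mu P' _ IH Hf; apply: step_parL => //; apply: hbn.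
- by move=> P Q mu P' _ IH Hf; apply: step_parR => //; apply: hbn.
- move=> P Q cs a b P' Q' Hu Hf _ IH1 _ IH2; rewrite ren_nus //.
  apply: step_comL (map h cs) (h a) (map h b) _ _ _ _ _ IH2.
  + by rewrite map_inj_uniq.
  + by move=> c /mapP[c' Hc ->]; apply/hfr/Hf.
  + by move: IH1; rewrite /= imfset_seq.
- move=> P Q cs a b P' Q' Hu Hf _ IH1 _ IH2; rewrite ren_nus //.
  apply: step_comR (map h cs) (h a) (map h b) _ _ _ _ IH1 _.
  + by rewrite map_inj_uniq.
  + by move=> c /mapP[c' Hc ->]; apply/hfr/Hf.
  + by move: IH2; rewrite /= imfset_seq.
- move=> c P mu P' Hc Hmu _ IH; rewrite ren_nu //.
  rewrite {1}/ren /= -(hs c) (proj1 (ren_depth h) _ 1 0); apply: step_res.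
  + exact: hfr.
  + case: mu Hmu {IH} => //= [a b|C a b].
      by rewrite !inE !negb_or (inj_eq hi) mem_map.
    rewrite !inE !mem_cat !negb_or (inj_eq hi) mem_map // => /and3P[-> -> H] /=.
    by apply: contra H => /imfsetP[/= c' Hc' /hi ->].
  + by move: IH; rewrite ren_instantiate.
- move=> c P C a b P' Hc Hb Ha HC _ IH.
  rewrite {1}/ren /= -(hs c) (proj1 (ren_depth h) _ 1 0).
  rewrite (_ : h @` (c |` C) = h c |` (h @` C)).
    apply: step_open; rewrite ?mem_map ?(inj_eq hi) //; first exact: hfr.
      by apply: contra HC => /imfsetP[/= c' Hc' /hi ->].
    by move: IH; rewrite ren_instantiate.
  apply/fsetP => x; rewrite !inE; apply/imfsetP/orP.
    by case=> /= y; rewrite !inE => /orP[/eqP -> ->|Hy ->]; [left|right; apply/imfsetP; exists y].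
  case=> [/eqP ->|/imfsetP[/= y Hy ->]]; first by exists c; rewrite //= !inE eqxx.
  by exists y; rewrite //= !inE Hy orbT.
Qed.

(** Unlike the replacement of one name by another, a transposition is injective on all names, as
    [step_ren] demands. *)
Definition swap a b (c : name S) : name S :=
  if c == a then b else if c == b then a else c.

Lemma swapK a b : involutive (swap a b).
Proof.
move=> c; rewrite /swap; case: (c =P a) => [->|ca].
  by case: (b =P a) => [->|_]; rewrite ?eqxx.
by case: (c =P b) => [->|cb]; rewrite ?eqxx //; case: eqP => // _; case: eqP.
Qed.

Lemma swap_inj a b : injective (swap a b).
Proof. exact: inv_inj (@swapK a b). Qed.

Lemma swap_sort a b c : nsort a = nsort b -> nsort (swap a b c) = nsort c.
Proof. by move=> E; rewrite /swap; case: eqP => [->|_]; [|case: eqP => [->|]]. Qed.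

Lemma swapL a b : swap a b a = b. Proof. by rewrite /swap eqxx. Qed.

Lemma swapR a b : swap a b b = a.
Proof. by rewrite /swap eqxx; case: eqP. Qed.

Lemma swap_id a b c : c != a -> c != b -> swap a b c = c.
Proof. by rewrite /swap => /negPf -> /negPf ->. Qed.

Lemma ren_swap_fresh a b P : a \notin fn P -> b \notin fn P -> ren (swap a b) P = P.
Proof.
move=> Ha Hb; rewrite -[RHS]ren_id; apply: (proj1 (eq_ren_in _ _)) => c Hc.
by apply: swap_id; [apply: contraNneq Ha|apply: contraNneq Hb] => <-.
Qed.

Lemma ren_swapK a b P : ren (swap a b) (ren (swap a b) P) = P.
Proof.
rewrite /ren (proj1 (map_proc_guard_comp _ _)) -[RHS]ren_id.
by apply: (proj1 (eq_map_proc_guard _)) => k [c|d p] //=; rewrite swapK.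
Qed.

(** Replacing [a] by [c] and swapping the two agree on a process in which [c] is new;
    well-sortedness excludes a dangling index that opening would capture. *)
Lemma open_close a c P : well_sorted P -> (c = a \/ c \notin fn P) ->
  instantiate [:: c] (map_proc (close_ref a) 0 P) = ren (swap a c) P.
Proof.
move=> Hws Hc; rewrite /instantiate (proj1 (map_proc_guard_comp _ _)).
transitivity (ren (fun b => if b == a then c else b) P).
  apply: (proj1 (@eq_map_sorted _ [::] _ _) P [::]) => // Gamma [b|d p] s /=.
    by case: eqP => //= _; rewrite eqxx.
  rewrite cats0; case: eqP => // ->; rewrite nth_default //; by case: p.
apply: (proj1 (eq_ren_in _ _)) => b Hb; rewrite /swap; case: eqP => // ba.
case: eqP => // bc; case: Hc => [ca|]; first by congruence.
by rewrite -bc Hb.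
Qed.

End Substitution.

(** * Transitions *)

Section Transitions.
Variable S : sorting.
Implicit Types (P Q : proc S) (G : guard S) (r : ref S) (a b c : name S).
Implicit Types (mu : action S).

Lemma in_fset_seq (cs : seq (name S)) c : (c \in [fset c in cs]) = (c \in cs).
Proof. by rewrite !inE. Qed.

Lemma fset_seq_nil (cs : seq (name S)) : [fset c in cs] = fset0 -> cs = [::].
Proof.
case: cs => // c cs /fsetP/(_ c); by rewrite in_fset_seq mem_head inE.
Qed.

(** The parallel rules demand freshness of [C] for the idle component only; freshness for the acting
    one has to be derived, hence its place in this invariant. *)
Definition fn_effect P mu P' : Prop :=
  match mu with
  | ATau => {subset fn P' <= fn P}
  | AIn a b => a \in fn P /\ {subset fn P' <= fn P ++ b}
  | AOut C a b => [/\ a \in fn P, {in C, forall c, c \in b /\ c \notin fn P},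
      (forall c, c \in b -> c \in fn P \/ c \in C)
      & (forall c, c \in fn P' -> c \in fn P \/ c \in C)]
  end.

Lemma fn_effect_sub P Q mu P' : {subset fn P <= fn Q} -> bn_fresh mu Q ->
  fn_effect P mu P' -> fn_effect Q mu P'.
Proof.
case: mu => [|a b|C a b] /= PQ Hf.
- by move=> H c /H/PQ.
- by case=> Ha H; split; [exact: PQ|move=> c /H; rewrite !mem_cat => /orP[/PQ|] ->; rewrite ?orbT].
- case=> Ha HC Hb H; split; [exact: PQ| | |].
  + by move=> c Hc; split; [case: (HC c Hc)|exact: Hf].
  + by move=> c /Hb[/PQ|]; [left|right].
  + by move=> c /H[/PQ|]; [left|right].
Qed.

Lemma guard_no_out G C a (b : seq (name S)) P' : ~ step (PGuard G) (AOut C a b) P'.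
Proof.
elim: G P' => [|r ss P|P|r r' G IH|G1 IH1 G2 IH2] P' H; inversion H; subst;
  first [exact: (IH P') | exact: (IH1 P') | exact: (IH2 P')].
Qed.

Lemma bn_fresh_guard G mu P' Q : step (PGuard G) mu P' -> bn_fresh mu Q.
Proof. by case: mu => // C a b /guard_no_out. Qed.

Lemma step_fn P mu P' : step P mu P' -> fn_effect P mu P'.
Proof.
have catl (s t : seq (name S)) : {subset s <= s ++ t}.
  by move=> c Hc; rewrite mem_cat Hc.
have catr (s t : seq (name S)) : {subset t <= s ++ t}.
  by move=> c Hc; rewrite mem_cat Hc orbT.
elim=> {P mu P'}.
- move=> a b /=; split=> //; first by rewrite inE eqxx.
  move=> c Hc; left; rewrite inE; apply/orP; right; apply/flattenP.
  exists [:: c]; last by rewrite inE.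
  by rewrite -map_comp; apply/mapP; exists c.
- move=> a ss P c _ /=; split; first by rewrite inE eqxx.
  by move=> x /fn_instantiate; rewrite inE mem_cat => ->; rewrite orbT.
- move=> a ss P c _ /=; split; first by rewrite inE eqxx.
  move=> x; rewrite mem_cat => /orP[/fn_instantiate|].
    by rewrite inE mem_cat => ->; rewrite orbT.
  by rewrite inE => /orP[|] H; rewrite inE mem_cat H ?orbT.
- by move=> P c.
- move=> a G mu P' Hs IH; apply: fn_effect_sub IH; last exact: bn_fresh_guard Hs.
  by move=> c /= H; rewrite !inE H !orbT.
- by move=> G1 G2 mu P' Hs IH; apply: fn_effect_sub IH; [exact: catl|exact: bn_fresh_guard Hs].
- by move=> G1 G2 mu P' Hs IH; apply: fn_effect_sub IH; [exact: catr|exact: bn_fresh_guard Hs].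
- move=> P Q [|a b|C a b] P' _ /= IH Hf.
  + by move=> c; rewrite !mem_cat => /orP[/IH|] ->; rewrite ?orbT.
  + case: IH => Ha IH; split; first exact: catl.
    move=> c; rewrite !mem_cat => /orP[/IH|->]; rewrite ?orbT //.
    by rewrite mem_cat => /orP[|] ->; rewrite ?orbT.
  + case: IH => Ha HC Hb IH; split; first exact: catl.
    * move=> c Hc; case: (HC c Hc) => ? ?; split=> //.
      by rewrite mem_cat negb_or; apply/andP; split=> //; apply: Hf.
    * by move=> c /Hb[/catl|]; auto.
    * by move=> c; rewrite mem_cat => /orP[/IH[/catl|]|/catr]; auto.
- move=> P Q [|a b|C a b] Q' _ /= IH Hf.
  + by move=> c; rewrite !mem_cat => /orP[|/IH] ->; rewrite ?orbT.
  + case: IH => Ha IH; split; first exact: catr.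
    move=> c; rewrite !mem_cat => /orP[->|/IH] //.
    by rewrite mem_cat => /orP[|] ->; rewrite ?orbT.
  + case: IH => Ha HC Hb IH; split; first exact: catr.
    * move=> c Hc; case: (HC c Hc) => ? ?; split=> //.
      by rewrite mem_cat negb_or; apply/andP; split=> //; apply: Hf.
    * by move=> c /Hb[/catr|]; auto.
    * by move=> c; rewrite mem_cat => /orP[/catl|/IH[/catr|]]; auto.
- move=> P Q cs a b P' Q' _ Hf _ [Ha HC Hb IH1] _ [Ha' IH2] c.
  rewrite fn_nus /= !mem_cat => /andP[Hc /orP[/IH1[->|]|/IH2]] //.
    by rewrite in_fset_seq (negPf Hc).
  rewrite mem_cat => /orP[->|/Hb[->|]]; rewrite ?orbT //.
  by rewrite in_fset_seq (negPf Hc).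
- move=> P Q cs a b P' Q' _ Hf _ [Ha' IH1] _ [Ha HC Hb IH2] c.
  rewrite fn_nus /= !mem_cat => /andP[Hc /orP[/IH1|/IH2[->|]]]; rewrite ?orbT //.
    rewrite mem_cat => /orP[->|/Hb[->|]]; rewrite ?orbT //.
    by rewrite in_fset_seq (negPf Hc).
  by rewrite in_fset_seq (negPf Hc).
- move=> c P mu P' Hc Hmu _.
  have Hi x : x \in fn (instantiate [:: c] P) -> x != c -> x \in fn P.
    by move/fn_instantiate; rewrite inE => /orP[//|->].
  case: mu Hmu => [|a b|C a b] /=.
  + by move=> _ IH x; rewrite fn_nu => /andP[xc /IH /Hi]; exact.
  + rewrite inE negb_or => /andP[ca cb] [Ha IH]; split; first by apply: Hi => //; rewrite eq_sym.
    move=> x; rewrite fn_nu => /andP[xc /IH]; rewrite !mem_cat => /orP[/Hi -> //|->].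
    by rewrite orbT.
  + rewrite inE mem_cat !negb_or => /and3P[ca cb cC] [Ha HC Hb IH]; split.
    * by apply: Hi => //; rewrite eq_sym.
    * move=> x Hx; case: (HC x Hx) => ? H; split=> //.
      by apply: contra H; exact: fn_instantiate_sup.
    * move=> x Hx; case: (Hb x Hx) => [/Hi H|]; [left|by right].
      by apply: H; apply: contraNneq cb => <-.
    * move=> x; rewrite fn_nu => /andP[xc /IH[/Hi H|]]; [left|by right].
      exact: H.
- move=> c P C a b P' Hc Hb ca HC _ [Ha IHC IHb IH].
  have Hi x : x \in fn (instantiate [:: c] P) -> x \in fn P \/ x = c.
    by move/fn_instantiate; rewrite inE => /orP[|/eqP]; auto.
  split=> /=.
  + by case: (Hi _ Ha) => // E; rewrite E eqxx in ca.
  + move=> x; rewrite !inE => /orP[/eqP ->//|/IHC[? H]]; split=> //.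
    by apply: contra H; exact: fn_instantiate_sup.
  + by move=> x /IHb[/Hi[|->]|Hx]; [left|right|right]; rewrite // !inE ?eqxx ?Hx ?orbT.
  + by move=> x /IH[/Hi[|->]|Hx]; [left|right|right]; rewrite // !inE ?eqxx ?Hx ?orbT.
Qed.

Lemma ws_step P mu P' : step P mu P' -> well_sorted P -> well_sorted P'.
Proof.
rewrite /well_sorted; elim=> {P mu P'} //=.
- by move=> a ss P c <- /andP[_]; exact: ws_instantiate.
- by move=> a ss P c <- /andP[-> H]; rewrite H !andbT; exact: ws_instantiate.
- by move=> G1 G2 mu P' _ IH /andP[/IH].
- by move=> G1 G2 mu P' _ IH /andP[_ /IH].
- by move=> P Q mu P' _ IH _ /andP[/IH -> ->].
- by move=> P Q mu P' _ IH _ /andP[-> /IH ->].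
- move=> P Q cs a b P' Q' _ _ _ IH1 _ IH2 /andP[/IH1 H1 /IH2 H2].
  by apply: ws_nus; rewrite /well_sorted /= H1.
- move=> P Q cs a b P' Q' _ _ _ IH1 _ IH2 /andP[/IH1 H1 /IH2 H2].
  by apply: ws_nus; rewrite /well_sorted /= H1.
- move=> c P mu P' _ _ _ IH H; apply: ws_nu; apply: IH; exact: ws_instantiate.
- move=> c P C a b P' _ _ _ _ _ IH H; apply: IH; exact: ws_instantiate.
Qed.

Lemma step_obj_sorts P mu P' : step P mu P' -> well_sorted P ->
  match mu with
  | ATau => True
  | AIn a b => map (@nsort S) b = obj (nsort a)
  | AOut _ a b => map (@nsort S) b = obj (nsort a)
  end.
Proof.
rewrite /well_sorted; elim=> {P mu P'} //=.
- move=> a b /eqP; rewrite -map_comp => H.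
  by elim: b (obj _) H => [|c b IH] [|s ss] //= [-> /IH ->].
- by move=> a ss P c <- /andP[/eqP[]].
- by move=> a ss P c <- /andP[/eqP[]].
- by move=> G1 G2 mu P' _ IH /andP[/IH].
- by move=> G1 G2 mu P' _ IH /andP[_ /IH].
- by move=> P Q mu P' _ IH _ /andP[/IH].
- by move=> P Q mu P' _ IH _ /andP[_ /IH].
- move=> c P mu P' _ _ _ IH H; apply: IH; exact: ws_instantiate.
- move=> c P C a b P' _ _ _ _ _ IH H; apply: IH; exact: ws_instantiate.
Qed.

Lemma only_out_step P mu P' : step P mu P' -> only_out P ->
  only_out P' /\
  match mu with
  | ATau => True
  | AIn _ b => all (@out_ctl S) b
  | AOut _ _ b => all (@out_ctl S) b
  end.
Proof.
have Hss (cs : seq (name S)) : all (@outc S) (map (@nsort S) cs) = all (@out_ctl S) cs.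
  by rewrite all_map.
have Hnus cs P0 : all (@out_ctl S) cs -> only_out P0 -> only_out (nus cs P0).
  move=> + H; elim: cs => //= c cs IH /andP[Hc /IH]; exact: only_out_nu.
elim=> {P mu P'} //=.
- by move=> a b /andP[_]; rewrite all_map.
- move=> a ss P c <- /and3P[_]; rewrite Hss => Hc H.
  by split=> //; apply: only_out_instantiate.
- move=> a ss P c <- /and3P[-> ]; rewrite Hss => Hc H.
  by rewrite Hc H !andbT; split=> //; apply: only_out_instantiate.
- by move=> a G mu P' _ IH /and3P[_ _ /IH].
- by move=> G1 G2 mu P' _ IH /andP[/IH].
- by move=> G1 G2 mu P' _ IH /andP[_ /IH].
- by move=> P Q mu P' _ IH _ /andP[/IH[-> ?] ->].
- by move=> P Q mu P' _ IH _ /andP[-> /IH[-> ?]].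
- move=> P Q cs a b P' Q' _ _ /step_fn[_ HC _ _] IH1 _ IH2 /andP[/IH1[H1 _] /IH2[H2 Hb]].
  split=> //; apply: Hnus; last by rewrite /= H1.
  by apply/allP => c Hc; apply: (allP Hb); case: (HC c) => //; rewrite in_fset_seq.
- move=> P Q cs a b P' Q' _ _ _ IH1 /step_fn[_ HC _ _] IH2 /andP[/IH1[H1 Hb] /IH2[H2 _]].
  split=> //; apply: Hnus; last by rewrite /= H1.
  by apply/allP => c Hc; apply: (allP Hb); case: (HC c) => //; rewrite in_fset_seq.
- move=> c P mu P' _ _ _ IH /andP[Hc H].
  have [|H1 H2] := IH; first by apply: only_out_instantiate => //=; rewrite andbT.
  by split=> //; apply: only_out_nu.
- move=> c P C a b P' _ _ _ _ _ IH /andP[Hc H]; apply: IH.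
  by apply: only_out_instantiate => //=; rewrite andbT.
Qed.

(** Subject reduction as an account of the thread: an output at an output-controlled name gives the
    thread away and so occurs at type 1 only; an input there acquires one, for which only type 0 has
    room. *)
Lemma typed_step P mu P' : step P mu P' -> forall eta, typed [::] eta P ->
  match mu with
  | ATau => typed [::] eta P'
  | AIn a _ => if out_ctl a then eta = false -> typed [::] true P'
               else typed [::] eta P'
  | AOut _ a _ => if out_ctl a then eta = true /\ typed [::] false P'
                  else typed [::] eta P'
  end.
Proof.
have out_free a : is_out [::] (Free a) -> out_ctl a by case=> s [<-].
have inp_free a : is_inp [::] (Free a) -> out_ctl a = false.
  by case=> s [<-] /negPf.
elim=> {P mu P'}.
- move=> a b eta H; inversion H as [| | |x b' Ho|u b' Hi| | | | | |]; subst.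
    by rewrite (out_free _ Ho); split=> //; apply: ty_nil.
  by rewrite (inp_free _ Hi); apply: ty_nil.
- move=> a ss P c E eta H; inversion H as [? ? ? Hi Ht|? ? ? Ho Ht| | | | | | | | |]; subst.
    by rewrite (inp_free _ Hi); apply: typed_instantiate.
  by rewrite (out_free _ Ho) => _; apply: typed_instantiate.
- move=> a ss P c E eta H; inversion H as [| |? ? ? Ho Ht| | | | | | | |]; subst.
  rewrite (out_free _ Ho) => _; apply: (@ty_par _ _ true true false) => //.
  exact: typed_instantiate.
- by move=> P eta H; inversion H.
- move=> a G mu P' Hs IH eta H; inversion H; subst; exact: IH.
- move=> G1 G2 mu P' Hs IH eta H; inversion H; subst; exact: IH.
- move=> G1 G2 mu P' Hs IH eta H; inversion H; subst; exact: IH.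
- move=> P Q mu P' Hs IH Hf eta H.
  inversion H as [| | | | | | |? e1 e2 ? ? He H1 H2| | |]; subst.
  case: mu {Hs Hf} IH => [|a b|C a b] IH; move: (IH _ H1).
  + by move=> Ht; apply: (ty_par He).
  + case: ifP => _ Ht; last by apply: (ty_par He).
    move=> E; case: e1 e2 eta He E Ht H1 H2 {H IH} => [] [] [] //= _ _ Ht _ H2.
    by apply: (@ty_par _ _ true true false) => //; exact: Ht.
  + case: ifP => _ Ht; last by apply: (ty_par He).
    case: Ht => E Ht; case: e1 e2 eta He E Ht H1 H2 {H IH} => [] [] [] //= _ _ Ht _ H2.
    by split=> //; apply: (@ty_par _ _ false false false).
- move=> P Q mu P' Hs IH Hf eta H.
  inversion H as [| | | | | | |? e1 e2 ? ? He H1 H2| | |]; subst.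
  case: mu {Hs Hf} IH => [|a b|C a b] IH; move: (IH _ H2).
  + by move=> Ht; apply: (ty_par He).
  + case: ifP => _ Ht; last by apply: (ty_par He).
    move=> E; case: e1 e2 eta He E Ht H1 H2 {H IH} => [] [] [] //= _ _ Ht H1 _.
    by apply: (@ty_par _ _ true false true) => //; exact: Ht.
  + case: ifP => _ Ht; last by apply: (ty_par He).
    case: Ht => E Ht; case: e1 e2 eta He E Ht H1 H2 {H IH} => [] [] [] //= _ _ Ht H1 _.
    by split=> //; apply: (@ty_par _ _ false false false).
- move=> P Q cs a b P' Q' _ _ _ IH1 _ IH2 eta H; apply: typed_nus.
  inversion H as [| | | | | | |? e1 e2 ? ? He H1 H2| | |]; subst.
  move: (IH1 _ H1) (IH2 _ H2); case: ifP => _; last by move=> *; apply: (ty_par He).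
  case=> E H1' H2'; case: e1 e2 eta He E H1' H2' {H H1 H2} => [] [] [] //= _ _ H1' H2'.
  by apply: (@ty_par _ _ true false true) => //; exact: H2'.
- move=> P Q cs a b P' Q' _ _ _ IH1 _ IH2 eta H; apply: typed_nus.
  inversion H as [| | | | | | |? e1 e2 ? ? He H1 H2| | |]; subst.
  move: (IH1 _ H1) (IH2 _ H2); case: ifP => _; last by move=> *; apply: (ty_par He).
  move=> H1' [E H2']; case: e1 e2 eta He E H1' H2' {H H1 H2} => [] [] [] //= _ _ H1' H2'.
  by apply: (@ty_par _ _ true true false) => //; exact: H1'.
- move=> c P mu P' _ _ _ IH eta H; inversion H as [| | | | |? ? ? Ht| | | | |]; subst.
  move: (IH eta (@typed_instantiate _ eta [:: c] P Ht)).
  case: mu {IH} => [|a b|C a b]; [exact: typed_nu| |].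
    by case: ifP => _ Ht'; [move=> E; apply/typed_nu/Ht'|exact: typed_nu].
  by case: ifP => _; [case=> E Ht'; split=> //|move=> Ht']; exact: typed_nu.
- move=> c P C a b P' _ _ _ _ _ IH eta H; inversion H as [| | | | |? ? ? Ht| | | | |]; subst.
  exact: (IH eta (@typed_instantiate _ eta [:: c] P Ht)).
Qed.

End Transitions.

(** * Internal steps and barbs *)

Section Barbs.
Variable S : sorting.
Implicit Types (P Q Z Y : proc S) (G : guard S) (r : ref S) (a c x : name S).
Implicit Types (mu : action S) (b cs : seq (name S)).

Definition idx_bound (L : seq (name S)) : nat := (\max_(c <- L) c.2).+1.

Lemma idx_bound_notin (L : seq (name S)) (c : name S) : idx_bound L <= c.2 -> c \notin L.
Proof.
move=> H; apply/negP => Hc; move: H; rewrite /idx_bound ltnNge.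
by rewrite (@leq_bigmax_seq _ L xpredT (fun c : name S => c.2) c).
Qed.

(** An extruded name does not occur in the source, so swapping it with a name that is new altogether
    changes the action and the target but not the source. The names of [L] are cleared one by one,
    and a new [e] does not spoil those already cleared. *)
Lemma step_out_refresh P C a b P' (L : seq (name S)) : step P (AOut C a b) P' ->
  exists C' b' P'', step P (AOut C' a b') P'' /\ {in C', forall c, c \notin L}.
Proof.
move=> Hs; elim: L => [|d L [C' [b' [P'' [Hs' HC]]]]]; first by exists C, b, P'.
case: (boolP (d \in C')) => Hd; last first.
  exists C', b', P''; split=> // c Hc; rewrite inE negb_or HC // andbT.
  by apply: contraNneq Hd => <-.
pose e : name S := (nsort d, idx_bound (d :: L ++ fn P ++ enum_fset C')).
have : e \notin d :: L ++ fn P ++ enum_fset C' by exact: idx_bound_notin.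
rewrite inE !mem_cat !negb_or => /and4P[ed eL eP eC].
have [Ha HC' Hb _] := step_fn Hs'.
have dP : d \notin fn P by case: (HC' d).
have := step_ren (@swap_inj _ d e) (fun c => @swap_sort _ d e c erefl) Hs'.
rewrite ren_swap_fresh //= (@swap_id _ d e a); first 1 last.
- by apply: contraNneq dP => <-.
- by apply: contraNneq eP => <-.
move=> Hs''; exists (swap d e @` C'), (map (swap d e) b'), (ren (swap d e) P''); split=> //.
move=> c /imfsetP[/= c' Hc' ->]; rewrite inE negb_or /swap.
case: (c' =P d) => [_|/eqP c'd]; first by rewrite (negPf ed).
case: (c' =P e) => [E|_]; last by rewrite (negPf c'd) HC.
by rewrite E (negPf eC) in Hc'.
Qed.

Lemma fn_close a c P : c \notin fn (map_proc (close_ref a) 0 P) -> c = a \/ c \notin fn P.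
Proof.
move=> H; have := fn_nu a P c; rewrite /= (negPf H); case: eqP => /=; first by left.
by move=> _ <-; right.
Qed.

Lemma swap_fn a c P : c = a \/ c \notin fn P -> a \in fn (ren (swap a c) P) -> a = c.
Proof.
move=> Hca; rewrite /ren (proj1 (fn_ren _)) => /mapP[d Hd Ed].
have : swap a c a = d by rewrite -[RHS](@swapK _ a c) -Ed.
by rewrite swapL => E; subst d; case: Hca => [->//|]; rewrite Hd.
Qed.

(** The rule may have opened the binder with a name [c] other than [a]; swapping [a] and [c] turns
    its premise into a step of [P]. *)
Lemma step_tau_nu a P Z : well_sorted P -> step (nu a P) ATau Z ->
  exists2 P', step P ATau P' & Z = nu a P'.
Proof.
move=> Hws; rewrite {1}/nu; move E: (PRes _ _) => P0; move Em: ATau => mu Hs.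
case: Hs E Em => // c P1 mu1 P' /= Hc Hmu Hs [Es EP] Em; subst P1 mu1.
have Hca := fn_close Hc; rewrite open_close // in Hs.
have hs d := @swap_sort _ a c d Es.
have := step_ren (@swap_inj _ a c) hs Hs; rewrite ren_swapK => Hs2.
exists (ren (swap a c) P') => //=.
have := @ren_nu _ (swap a c) c P' (@swap_inj _ a c) (hs c); rewrite swapR => <-.
rewrite ren_swap_fresh // fn_nu ?eqxx //; apply/negP => /andP[/eqP ac].
by move/(step_fn Hs)/(swap_fn Hca).
Qed.

Lemma step_tau_nu_intro a P P' : well_sorted P -> step P ATau P' ->
  step (nu a P) ATau (nu a P').
Proof.
move=> Hws Hs; apply: step_res => //.
  by have := fn_nu a P a; rewrite eqxx /= => ->.
rewrite open_close //; last by left.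
rewrite (_ : ren _ P = P) //; rewrite -[RHS]ren_id.
by apply: (proj1 (eq_ren_in _ _)) => d _; rewrite /swap; case: eqP.
Qed.

Definition obarb P x := exists C b P', step P (AOut C x b) P'.

Lemma obarb_fn P x : obarb P x -> x \in fn P.
Proof. by case=> C [b [P' /step_fn []]]. Qed.

Lemma obarb_nu a P x : well_sorted P -> obarb (nu a P) x -> x <> a /\ obarb P x.
Proof.
move=> Hws [C [b [Z]]]; rewrite {1}/nu; move E: (PRes _ _) => P0; move Em: (AOut _ _ _) => mu Hs.
have key c C' b' P' : nsort a = nsort c -> c = a \/ c \notin fn P -> c <> x ->
    step (ren (swap a c) P) (AOut C' x b') P' -> x <> a /\ obarb P x.
  move=> Es Hca cx Hs'; have hs d := @swap_sort _ a c d Es.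
  have [Hx _ _ _] := step_fn Hs'.
  have xa : x <> a by move=> E1; subst x; apply: cx; rewrite (swap_fn Hca Hx).
  split=> //; have := step_ren (@swap_inj _ a c) hs Hs'; rewrite ren_swapK /=.
  by rewrite swap_id; [eexists _, _, _; eauto|apply/eqP|apply/eqP => E1; apply: cx].
case: Hs E Em => //.
- move=> c P1 mu1 P' /= Hc Hmu Hs [Es EP] Em; subst P1 mu1.
  have Hca := fn_close Hc; rewrite open_close // in Hs.
  apply: (key _ _ _ _ Es Hca _ Hs) => E; move: Hmu.
  by rewrite E /= inE eqxx.
- move=> c P1 C1 x1 b1 P' /= Hc Hcb cx1 HC1 Hs [Es EP] [EC Ex Eb]; subst.
  have Hca := fn_close Hc; rewrite open_close // in Hs.
  by apply: (key _ _ _ _ Es Hca _ Hs) => E; rewrite E eqxx in cx1.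
Qed.

(** If [a] is among the objects it gets extruded, otherwise the output passes under the restriction.
    Either rule needs [a] outside the names already extruded, which a refreshing ensures. *)
Lemma obarb_nu_intro a P x : well_sorted P -> x <> a -> obarb P x -> obarb (nu a P) x.
Proof.
move=> Hws xa [C0 [b0 [P0 /(@step_out_refresh _ _ _ _ _ [:: a])[C [b [P' [Hs HC]]]]]]].
have Ha : a \notin fn (map_proc (close_ref a) 0 P).
  by have := fn_nu a P a; rewrite eqxx /= => ->.
have aC : a \notin C by apply/negP => /HC; rewrite inE eqxx.
have EP : instantiate [:: a] (map_proc (close_ref a) 0 P) = P.
  rewrite open_close //; last by left.
  rewrite -[RHS]ren_id.
  by apply: (proj1 (eq_ren_in _ _)) => d _; rewrite /swap; case: eqP.
case: (boolP (a \in b)) => Hab.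
  exists (a |` C), b, P'; apply: step_open => //; last by rewrite EP.
  by apply/eqP => E; apply: xa.
exists C, b, (nu a P'); apply: step_res => //; last by rewrite EP.
rewrite /= inE mem_cat !negb_or Hab aC !andbT.
by apply/eqP => E; apply: xa.
Qed.

Lemma obarb_nus cs P x : well_sorted P -> obarb (nus cs P) x -> x \notin cs /\ obarb P x.
Proof.
move=> Hws; elim: cs => //= c cs IH /obarb_nu[|xc /IH[xcs H]]; first exact: ws_nus.
by split=> //; rewrite inE negb_or xcs andbT; apply/eqP.
Qed.

Lemma obarb_nus_intro cs P x : well_sorted P -> x \notin cs -> obarb P x ->
  obarb (nus cs P) x.
Proof.
move=> Hws; elim: cs => //= c cs IH; rewrite inE negb_or => /andP[/eqP xc xcs] H.
by apply: obarb_nu_intro => //; [exact: ws_nus|exact: IH].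
Qed.

Lemma step_tau_nus cs P Z : well_sorted P -> step (nus cs P) ATau Z ->
  exists2 P', step P ATau P' & Z = nus cs P'.
Proof.
move=> Hws; elim: cs Z => [|c cs IH] Z /=; first by exists Z.
case/step_tau_nu; first exact: ws_nus.
by move=> Z' /IH[P' H ->] ->; exists P'.
Qed.

Lemma step_tau_nus_intro cs P P' : well_sorted P -> step P ATau P' ->
  step (nus cs P) ATau (nus cs P').
Proof.
move=> Hws H; elim: cs => //= c cs IH; apply: step_tau_nu_intro => //.
exact: ws_nus.
Qed.

Lemma weak_refl P : weak P P. Proof. exact: rt_refl. Qed.

Lemma weak_trans P1 P2 P3 : weak P1 P2 -> weak P2 P3 -> weak P1 P3.
Proof. exact: rt_trans. Qed.

Lemma weak_step1 P P' : step P ATau P' -> weak P P'.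
Proof. exact: rt_step. Qed.

Lemma weak_ind (R : proc S -> proc S -> Prop) :
  (forall P, R P P) ->
  (forall P P1 P2, step P ATau P1 -> weak P1 P2 -> R P1 P2 -> R P P2) ->
  forall P P', weak P P' -> R P P'.
Proof.
move=> H0 H1 P P' Hw; elim: {Hw}(clos_rt_rt1n _ _ _ _ Hw) => // P0 P1 P2 Hs Hw IH.
by apply: H1 Hs _ IH; exact: clos_rt1n_rt.
Qed.

Lemma weak_inv (I : proc S -> Prop) :
  (forall P P', I P -> step P ATau P' -> I P') ->
  forall P P', weak P P' -> I P -> I P'.
Proof.
move=> HI; apply: weak_ind => // P P1 P2 Hs _ IH HP.
exact: IH (HI _ _ HP Hs).
Qed.

Lemma weak_ws P P' : weak P P' -> well_sorted P -> well_sorted P'.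
Proof. by apply: (@weak_inv (fun P => well_sorted P)) => P0 P1 H /ws_step; exact. Qed.

Lemma weak_fn P P' : weak P P' -> {subset fn P' <= fn P}.
Proof.
move=> Hw; apply: (@weak_inv (fun Z => {subset fn Z <= fn P}) _ _ _ Hw) => //.
by move=> Z Z' H /step_fn Hs c /Hs/H.
Qed.

Lemma weak_nus cs P Z : well_sorted P -> weak (nus cs P) Z ->
  exists2 P', weak P P' & Z = nus cs P'.
Proof.
move=> Hws Hw; suff [P' [_ H ->]] : exists P', [/\ well_sorted P', weak P P' & Z = nus cs P'].
  by exists P'.
apply: (@weak_inv (fun Z => exists P', [/\ well_sorted P', weak P P' & Z = nus cs P'])
  _ _ _ Hw) => [Z1 Z2 [P' [HP' Hw' ->]]|]; last by exists P; split=> //; exact: weak_refl.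
case/step_tau_nus => // P2 Hs ->; exists P2; split=> //; first exact: ws_step Hs HP'.
exact: weak_trans Hw' (weak_step1 Hs).
Qed.

Lemma weak_nus_intro cs P P' : well_sorted P -> weak P P' -> weak (nus cs P) (nus cs P').
Proof.
move=> + Hw; elim/weak_ind: Hw => [P0 _|P0 P1 P2 Hs _ IH Hws]; first exact: weak_refl.
apply: weak_trans (IH (ws_step Hs Hws)); apply: weak_step1.
exact: step_tau_nus_intro.
Qed.

Definition ubarb Z x := exists2 Z0, weak Z Z0 & obarb Z0 x.

Lemma ubarb_fn Z x : ubarb Z x -> x \in fn Z.
Proof. by case=> Z0 /weak_fn H /obarb_fn/H. Qed.

Lemma ubarb_weak Z Z' x : weak Z Z' -> ubarb Z' x -> ubarb Z x.
Proof. by move=> Hw [Z0 Hw' H]; exists Z0 => //; exact: weak_trans Hw Hw'. Qed.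

Lemma ubarb_nus cs P x : well_sorted P -> ubarb (nus cs P) x -> x \notin cs /\ ubarb P x.
Proof.
move=> Hws [Z0 /weak_nus[//|P' Hw ->]] /obarb_nus[|H1 H2]; first exact: weak_ws Hw Hws.
by split=> //; exists P'.
Qed.

Lemma ubarb_nus_intro cs P x : well_sorted P -> x \notin cs -> ubarb P x ->
  ubarb (nus cs P) x.
Proof.
move=> Hws Hx [P' Hw H]; exists (nus cs P'); first exact: weak_nus_intro.
by apply: obarb_nus_intro => //; exact: weak_ws Hw Hws.
Qed.

(** * Barbed bisimilarity at type 1 *)

Local Notation bb := (@barbed_bisimilar S true).

Lemma bb_sym Z Y : bb Z Y -> bb Y Z.
Proof. by case=> R HR H; exists R => //; apply: (proj1 HR). Qed.

Lemma bb_weak Z Z' Y : bb Z Y -> weak Z Z' -> exists2 Y', weak Y Y' & bb Z' Y'.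
Proof.
move=> + Hw; elim/weak_ind: Hw Y => [Z0|Z0 Z1 Z2 Hs _ IH] Y H.
  by exists Y => //; exact: weak_refl.
case: (H) => R HR HZ; have [_ _ Ht _] := proj2 HR _ _ HZ.
have [Y1 Hw1 H1] := Ht _ Hs; have [|Y2 Hw2 H2] := IH Y1; first by exists R.
by exists Y2 => //; exact: weak_trans Hw1 Hw2.
Qed.

Lemma bb_typed Z Y : bb Z Y -> seq_typed true Z.
Proof. by case=> R HR HZ; have [] := proj2 HR _ _ HZ. Qed.

(** At type 1 every output at an output-controlled name is allowed, so the untyped [ubarb] is a
    typed barb there. The typing of the state reached comes from its being barbed bisimilar to
    something. *)
Lemma bb_ubarb Z Y x : bb Z Y -> out_ctl x -> ubarb Z x -> ubarb Y x.
Proof.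
move=> H Hx [Z0 Hw [C [b [Z1 Hs]]]]; have [Y0 _ H0] := bb_weak H Hw.
have Hb : barb true Z x.
  exists C, b, Z1; exists Z0, Z1; split=> //; last exact: weak_refl.
  by split=> //; [exact: bb_typed H0|right].
case: H => R HR HZ; have [_ _ _ /(_ x)[HB _]] := proj2 HR _ _ HZ.
have [C' [b' [P' [P0 [P1 [Hw' [_ Hs' _] _]]]]]] := HB Hb.
by exists P0 => //; exists C', b', P1.
Qed.

(** One direction of a strong barbed bisimulation; typing is transferred too because
    [barbed_bisimulation] asks for it. *)
Definition strong_half (E : proc S -> proc S -> Prop) : Prop :=
  forall Z1 Z2, E Z1 Z2 ->
    [/\ forall Z1', step Z1 ATau Z1' -> exists2 Z2', step Z2 ATau Z2' & E Z1' Z2',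
        forall x, obarb Z1 x -> obarb Z2 x
      & seq_typed true Z1 -> seq_typed true Z2].

Lemma strong_half_weak E Z1 Z2 Z1' : strong_half E -> E Z1 Z2 -> weak Z1 Z1' ->
  exists2 Z2', weak Z2 Z2' & E Z1' Z2'.
Proof.
move=> HE + Hw; elim/weak_ind: Hw Z2 => [Z|Z Z' Z'' Hs _ IH] Z2 H.
  by exists Z2 => //; exact: weak_refl.
have [/(_ _ Hs)[Z2' Hs2 /IH[Z3 Hw3 H3]] _ _] := HE _ _ H.
by exists Z3 => //; apply: weak_trans Hw3; exact: weak_step1.
Qed.

Lemma strong_half_barb E Z1 Z2 x : strong_half E -> E Z1 Z2 ->
  barb true Z1 x -> barb true Z2 x.
Proof.
move=> HE H [C [b [P' [P0 [P1 [Hw [Ht Hs Ha] _]]]]]].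
have [P0' Hw' H0] := strong_half_weak HE H Hw.
have [_ Hob Hty] := HE _ _ H0.
have [|C' [b' [P1' Hs']]] := Hob x; first by exists C, b, P1.
exists C', b', P1', P0', P1'; split=> //; last exact: weak_refl.
by split=> //; exact: Hty.
Qed.

(** This takes the place of structural congruence: only the rearrangements actually used have to be
    shown to be strong bisimulations. *)
Lemma bb_strong E Z1 Z2 Y : strong_half E -> strong_half (fun A B => E B A) ->
  E Z1 Z2 -> bb Z1 Y -> bb Z2 Y.
Proof.
move=> HE HE' H12 [R HR H1Y].
(* A barbed bisimulation is symmetric, so the composite must allow a rearrangement on both sides;
   equality covers the side that is left alone. *)
pose Er A B := E A B \/ A = B.
have Hr : strong_half Er.
  move=> A B [/HE[H1 H2 H3]|<-].
    by split=> // A' /H1[B' ? ?]; exists B' => //; left.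
  by split=> // A' H; exists A' => //; right.
have Hr' : strong_half (fun A B => Er B A).
  move=> A B [/HE'[H1 H2 H3]|->].
    by split=> // A' /H1[B' ? ?]; exists B' => //; left.
  by split=> // A' H; exists A' => //; right.
exists (fun A B => exists A' B', [/\ Er A' A, Er B' B & R A' B']); last first.
  by exists Z1, Y; split=> //; [left|right].
split=> [A B [A' [B' [HA HB H]]]|A B [A' [B' [HA HB H]]]].
  by exists B', A'; split=> //; apply: (proj1 HR).
have [HtA HtB Hst Hba] := proj2 HR _ _ H.
have [_ _ HA1] := Hr _ _ HA; have [_ _ HB1] := Hr _ _ HB.
split; [exact: HA1|exact: HB1| |].
- move=> A1 HsA; have [/(_ _ HsA)[A1' HsA' HAA'] _ _] := Hr' _ _ HA.
  have [B1' HwB HR1] := Hst _ HsA'.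
  have [B1 HwB1 HBB1] := strong_half_weak Hr HB HwB.
  by exists B1 => //; exists A1', B1'.
- move=> x; split=> Hb.
    by apply: (strong_half_barb Hr HB); apply/Hba/(strong_half_barb Hr' HA).
  by apply: (strong_half_barb Hr HA); apply/Hba/(strong_half_barb Hr' HB).
Qed.

End Barbs.

(** * Tests *)

Section Tests.
Variable S : sorting.
Implicit Types (P Q Z Y : proc S) (G H : guard S) (r : ref S).
Implicit Types (a c x v w : name S) (mu : action S) (b cs X : seq (name S)).
Local Notation bb := (@barbed_bisimilar S true).

(* All names of [flag w] have the index of [w], so that flags with different
   indices share no name. *)
Definition dummies w : seq (name S) := [seq (s, w.2) | s <- obj (nsort w)].
Definition flag w : proc S := locked (out_msg w (dummies w)).
Definition probe x w : guard S := GIn (Free x) (obj (nsort x)) (flag w).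

(* At type 1 the flags are offered by internal steps.  At type 0, the case of
   [eta = true], they are raised by whoever brings the thread on a name in [X]. *)
Definition marker (eta : bool) X w w' : guard S :=
  if eta then foldr (fun x G => GSum (probe x w) (GSum (probe x w') G)) GNil X
  else GSum (GTau (flag w)) (GTau (flag w')).

Definition test eta X w w' H : guard S := GSum (marker eta X w w') H.

Lemma fn_msg w b : fn (out_msg w b) = w :: b.
Proof. by rewrite /= -map_comp; congr cons; elim: b => //= c b ->. Qed.

Lemma flagE w : flag w = out_msg w (dummies w).
Proof. by rewrite /flag -lock. Qed.

Lemma flag_self w : w \in fn (flag w).
Proof. by rewrite flagE fn_msg mem_head. Qed.

Lemma fn_flag c w : c \in fn (flag w) -> c.2 = w.2.
Proof. by rewrite flagE fn_msg inE => /orP[/eqP ->|/mapP[s _ ->]]. Qed.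

Lemma map_msg f k w b : (forall k c, f k (Free c) = Free c) ->
  map_proc f k (out_msg w b) = out_msg w b.
Proof. by move=> Hf; rewrite /out_msg /= Hf -map_comp; congr POut; apply: eq_map => c /=. Qed.

Lemma sorted_msg Gamma w b : map (@nsort S) b = obj (nsort w) ->
  sorted_proc Gamma (out_msg w b).
Proof. by move=> H; rewrite /= -H -map_comp -map_comp. Qed.

Lemma dummies_sort w : map (@nsort S) (dummies w) = obj (nsort w).
Proof. by rewrite -map_comp map_id. Qed.

Lemma sorted_flag Gamma w : sorted_proc Gamma (flag w).
Proof. rewrite flagE; exact/sorted_msg/dummies_sort. Qed.

Lemma typed_msg Gamma w b : out_ctl w -> typed Gamma true (out_msg w b).
Proof. by move=> Hw; apply: ty_out_out; exists (nsort w). Qed.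

Lemma typed_flag Gamma w : out_ctl w -> typed Gamma true (flag w).
Proof. rewrite flagE; exact: typed_msg. Qed.

Lemma map_flag f k w : (forall k c, f k (Free c) = Free c) ->
  map_proc f k (flag w) = flag w.
Proof. rewrite flagE; exact: map_msg. Qed.

Lemma instantiate_flag cs w : instantiate cs (flag w) = flag w.
Proof. exact: map_flag. Qed.

Lemma sorted_marker Gamma eta X w w' : sorted_guard Gamma (marker eta X w w').
Proof.
case: eta => /=; last by rewrite !sorted_flag.
by elim: X => //= x X ->; rewrite !eqxx !sorted_flag.
Qed.

Lemma typed_marker Gamma eta X w w' : all (@out_ctl S) X -> out_ctl w -> out_ctl w' ->
  typed Gamma (~~ eta) (PGuard (marker eta X w w')).
Proof.
move=> HX Hw Hw'; case: eta => /=; last first.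
  by apply: ty_sum; apply: ty_tau; exact: typed_flag.
elim: X HX => [|x X IH] /=; first by move=> _; apply: ty_nil.
move=> /andP[Hx /IH IHX]; have Hx' : is_out Gamma (Free x) by exists (nsort x).
apply: ty_sum; first by apply: ty_in_out => //; exact: typed_flag.
by apply: ty_sum => //; apply: ty_in_out => //; exact: typed_flag.
Qed.

Lemma step_sum_inv G1 G2 mu T1 : step (PGuard (GSum G1 G2)) mu T1 ->
  step (PGuard G1) mu T1 \/ step (PGuard G2) mu T1.
Proof. by move=> Hs; inversion Hs; subst; auto. Qed.

Lemma step_gtau_inv P mu T1 : step (PGuard (GTau P)) mu T1 -> mu = ATau /\ T1 = P.
Proof. by move=> Hs; inversion Hs. Qed.

Lemma step_probe_inv x w mu T1 : step (PGuard (probe x w)) mu T1 ->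
  (exists b, mu = AIn x b) /\ T1 = flag w.
Proof.
by move=> Hs; inversion Hs; subst; rewrite instantiate_flag; split=> //; eexists.
Qed.

Lemma step_marker eta X w w' mu T1 : step (PGuard (marker eta X w w')) mu T1 ->
  (T1 = flag w \/ T1 = flag w') /\ (if eta then exists x b, mu = AIn x b else mu = ATau).
Proof.
case: eta => /=; last first.
  by case/step_sum_inv=> /step_gtau_inv[-> ->]; auto.
elim: X => [|x X IH] /= Hs; first by inversion Hs.
case: (step_sum_inv Hs) => [/step_probe_inv[[b ->] ->]|]; first by split; [left|exists x, b].
case/step_sum_inv=> [/step_probe_inv[[b ->] ->]|/IH //].
by split; [right|exists x, b].
Qed.

Lemma step_test eta X w w' H mu T1 : step (PGuard (test eta X w w' H)) mu T1 ->
  [\/ T1 = flag w, T1 = flag w' | step (PGuard H) mu T1].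
Proof.
by case/step_sum_inv=> [/step_marker[[->|->] _]|Hs]; [apply: Or31|apply: Or32|apply: Or33].
Qed.

Lemma step_marker_in X w w' x b v : x \in X -> map (@nsort S) b = obj (nsort x) ->
  v = w \/ v = w' -> step (PGuard (marker true X w w')) (AIn x b) (flag v).
Proof.
move=> + Hb Hv; have Hp : step (PGuard (probe x v)) (AIn x b) (flag v).
  rewrite -[X in step _ _ X](instantiate_flag b); exact: step_in.
elim: X => //= y X IH; rewrite inE => /orP[/eqP <-|/IH Hs].
  by case: Hv => <-; [apply: step_sumL|apply/step_sumR/step_sumL].
by apply/step_sumR/step_sumR.
Qed.

Lemma fn_marker eta X w w' c : c \in fn_guard (marker eta X w w') ->
  [\/ c \in X, c \in fn (flag w) | c \in fn (flag w')].
Proof.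
case: eta => /=; last first.
  by rewrite mem_cat => /orP[|]; [apply: Or32|apply: Or33].
elim: X => //= x X IH; rewrite !inE !mem_cat !inE mem_cat.
case/or3P=> [/eqP ->||]; first by apply: Or31; rewrite eqxx.
  by move=> H; apply: Or32.
case/or3P=> [/eqP ->|H|/IH[H|H|H]]; first by apply: Or31; rewrite eqxx.
- by apply: Or33.
- by apply: Or31; rewrite H orbT.
- by apply: Or32.
- by apply: Or33.
Qed.

Lemma marker_has (eta : bool) X w w' v : (eta -> X <> [::]) -> v = w \/ v = w' ->
  v \in fn_guard (marker eta X w w').
Proof.
move=> HX Hv; have Hf := flag_self v.
case: eta HX => /= [/(_ isT)|_].
  case: X => //= x X _; rewrite !inE !mem_cat !inE !mem_cat.
  by case: Hv => E; rewrite E in Hf *; rewrite Hf ?orbT.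
by rewrite mem_cat; case: Hv => E; rewrite E in Hf *; rewrite Hf ?orbT.
Qed.

Lemma marker_supX X w w' : {subset X <= fn_guard (marker true X w w')}.
Proof.
move=> c; elim: X => //= x X IH; rewrite inE => /orP[/eqP ->|/IH H].
  by rewrite mem_head.
by rewrite !inE !mem_cat !inE !mem_cat H !orbT.
Qed.

Lemma step_par_inv P Q mu Z : step (PPar P Q) mu Z ->
  [\/ exists P', [/\ step P mu P', bn_fresh mu Q & Z = PPar P' Q],
      exists Q', [/\ step Q mu Q', bn_fresh mu P & Z = PPar P Q'],
      exists cs a b P' Q', [/\ mu = ATau, uniq cs /\ {in cs, forall c, c \notin fn Q},
        step P (AOut [fset c in cs] a b) P', step Q (AIn a b) Q'
      & Z = nus cs (PPar P' Q')]
    | exists cs a b P' Q', [/\ mu = ATau, uniq cs /\ {in cs, forall c, c \notin fn P},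
        step P (AIn a b) P', step Q (AOut [fset c in cs] a b) Q'
      & Z = nus cs (PPar P' Q')]].
Proof.
move=> Hs; inversion Hs; subst.
- by apply: Or41; eexists; split; eauto.
- by apply: Or42; eexists; split; eauto.
- by apply: Or43; eexists _, _, _, _, _; split; eauto.
- by apply: Or44; eexists _, _, _, _, _; split; eauto.
Qed.

Lemma step_par_guard (T : guard S) Q Z : step (PPar (PGuard T) Q) ATau Z ->
  [\/ exists2 T', step (PGuard T) ATau T' & Z = PPar T' Q,
      exists2 Q', step Q ATau Q' & Z = PPar (PGuard T) Q'
    | exists C a b T' Q', [/\ {in C, forall c, c \notin fn_guard T},
        step (PGuard T) (AIn a b) T', step Q (AOut [fset c in C] a b) Q'
      & Z = nus C (PPar T' Q')]].
Proof.
move=> Hs; inversion Hs; subst.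
- by apply: Or31; eexists; eauto.
- by apply: Or32; eexists; eauto.
- by exfalso; apply: guard_no_out; eauto.
- by apply: Or33; eexists _, _, _, _, _; split; eauto.
Qed.

Lemma weak_parR P Q Q' : weak Q Q' -> weak (PPar P Q) (PPar P Q').
Proof.
move=> Hw; elim/weak_ind: Hw => [Q0|Q0 Q1 Q2 Hs _ IH]; first exact: weak_refl.
by apply: weak_trans IH; apply: weak_step1; apply: step_parR.
Qed.

Lemma weak_parL P P' Q : weak P P' -> weak (PPar P Q) (PPar P' Q).
Proof.
move=> Hw; elim/weak_ind: Hw => [Q0|Q0 Q1 Q2 Hs _ IH]; first exact: weak_refl.
by apply: weak_trans IH; apply: weak_step1; apply: step_parL.
Qed.

Lemma ws_par P Q : well_sorted P -> well_sorted Q -> well_sorted (PPar P Q).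
Proof. by rewrite /well_sorted /= => -> ->. Qed.

(** The run is split at the first move of the test. A guard cannot output, so this move is internal
    or a reception. *)
Lemma weak_context (T : guard S) Q cs Y : well_sorted (PGuard T) -> well_sorted Q ->
  weak (nus cs (PPar (PGuard T) Q)) Y ->
  [\/ exists2 Q', weak Q Q' & Y = nus cs (PPar (PGuard T) Q'),
      exists Q1 T1, [/\ weak Q Q1, step (PGuard T) ATau T1
        & weak (nus cs (PPar T1 Q1)) Y]
    | exists Q1 Q2 C a b T1, [/\ weak Q Q1, step Q1 (AOut [fset c in C] a b) Q2,
        {in C, forall c, c \notin fn_guard T}, step (PGuard T) (AIn a b) T1
      & weak (nus (cs ++ C) (PPar T1 Q2)) Y]].
Proof.
move=> HT HQ /weak_nus[|Z Hw ->]; first exact: ws_par.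
move E: (PPar (PGuard T) Q) Hw => Z0 Hw.
elim/weak_ind: Hw Q HQ E => [Z1|Z1 Z2 Z3 Hs Hw IH] Q HQ E; subst Z1.
  by apply: Or31; exists Q => //; exact: weak_refl.
case: (step_par_guard Hs) => [[T' HsT E]|[Q' HsQ E]|[C [a [b [T' [Q' [HC HsT HsQ E]]]]]]]; subst Z2.
- apply: Or32; exists Q, T'; split=> //; first exact: weak_refl.
  by apply: weak_nus_intro => //; apply: ws_par => //; exact: ws_step HsT HT.
- have HQ' := ws_step HsQ HQ.
  case: (IH _ HQ' erefl) => [[Q2 HwQ ->]|[Q1 [T1 [HwQ HsT HY]]]|].
  + by apply: Or31; exists Q2 => //; exact: weak_trans (weak_step1 HsQ) HwQ.
  + by apply: Or32; exists Q1, T1; split=> //; exact: weak_trans (weak_step1 HsQ) HwQ.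
  + case=> Q1 [Q2 [C [a [b [T1 [HwQ Ho HC HsT HY]]]]]].
    apply: Or33; exists Q1, Q2, C, a, b, T1; split=> //.
    exact: weak_trans (weak_step1 HsQ) HwQ.
- apply: Or33; exists Q, Q', C, a, b, T'; split=> //; first exact: weak_refl.
  rewrite nus_cat; apply: weak_nus_intro => //; apply: ws_nus; apply: ws_par.
    exact: ws_step HsT HT.
  exact: ws_step HsQ HQ.
Qed.

Definition active P := exists x, ubarb P x.
(** The condition under which the flags can show up: a process of type 1 must be able to release its
    thread, whereas beside a process of type 0 the test has the thread already. *)
Definition acts (eta : bool) P := eta -> active P.

Lemma enum_fset_seq (C : {fset name S}) cs : cs = enum_fset C -> [fset c in cs] = C.
Proof. by move=> ->; apply/fsetP => c; rewrite !inE. Qed.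

Lemma obarb_flag v P : obarb (PPar (flag v) P) v.
Proof.
exists fset0, (dummies v), (PPar (PGuard GNil) P); apply: step_parL => //.
rewrite flagE; exact: step_out.
Qed.

Lemma ws_flag v : well_sorted (flag v).
Proof. exact: sorted_flag. Qed.

Lemma acts_fn eta P X w w' H v : acts eta P -> {subset fn P <= X} ->
  v = w \/ v = w' -> v \in fn_guard (test eta X w w' H).
Proof.
move=> Ha HX Hv; rewrite /= mem_cat marker_has // => /Ha[x /ubarb_fn/HX].
by case: X {HX}.
Qed.

(** Beside a process of type 0 the test raises [v] by itself. Beside one of type 1, some derivative
    of [P] outputs at a name of [X] and thereby hands over the thread; what it extrudes is
    refreshed, so that it captures no name of the test, in particular not [v]. *)
Lemma test_barb eta X w w' H P cs v : acts eta P -> {subset fn P <= X} ->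
  well_sorted P -> well_sorted (PGuard (test eta X w w' H)) ->
  v = w \/ v = w' -> v \notin cs ->
  ubarb (nus cs (PPar (PGuard (test eta X w w' H)) P)) v.
Proof.
move=> Ha HX HP HT Hv Hcs; apply: ubarb_nus_intro => //; first exact: ws_par.
have HvT := acts_fn H Ha HX Hv.
case: eta Ha HT HvT => [/(_ isT)[x [P0 Hw [C0 [b0 [P1 Hs0]]]]]|_] HT HvT; last first.
  exists (PPar (flag v) P); last exact: obarb_flag.
  apply: weak_step1; apply: step_parL => //; apply: step_sumL.
  by case: Hv => ->; [apply: step_sumL|apply: step_sumR]; apply: step_tau.
have [C [b [P2 [Hs HC]]]] := step_out_refresh (fn_guard (test true X w w' H)) Hs0.
have HP0 := weak_ws Hw HP.
have Hx : x \in X by apply: HX; apply: (weak_fn Hw); case: (step_fn Hs).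
apply: (@ubarb_weak _ _ (nus (enum_fset C) (PPar (flag v) P2))).
  apply: weak_trans (weak_parR _ Hw) _; apply: weak_step1.
  apply: step_comR (fset_uniq C) _ _ _.
  - by move=> c /HC.
  - by apply: step_sumL; apply: step_marker_in Hx (step_obj_sorts Hs HP0) Hv.
  - by rewrite (enum_fset_seq erefl).
apply: ubarb_nus_intro.
- by apply: ws_par; [exact: ws_flag|exact: ws_step Hs HP0].
- by apply/negP => /HC; rewrite HvT.
- by exists (PPar (flag v) P2); [exact: weak_refl|exact: obarb_flag].
Qed.

Definition marks w w' (L : seq (name S)) : Prop :=
  [/\ w.2 != w'.2, out_ctl w && out_ctl w', w \notin L & w' \notin L].

Lemma flag_notin v w : v.2 != w.2 -> v \notin fn (flag w).
Proof. by apply: contra => /fn_flag ->. Qed.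

Lemma no_barb cs P Q Y v : weak (nus cs (PPar P Q)) Y -> v \notin fn P -> v \notin fn Q ->
  ~ ubarb Y v.
Proof.
move=> Hw HP HQ /(ubarb_weak Hw)/ubarb_fn; rewrite fn_nus /= mem_cat.
by rewrite (negPf HP) (negPf HQ) andbF.
Qed.

(** A name known to the receiver cannot be extruded towards it, so it could only be sent if the
    sender had it before. *)
Lemma comm_fresh Q (C : seq (name S)) a b Q' (L : seq (name S)) v :
  step Q (AOut [fset c in C] a b) Q' -> {in C, forall c, c \notin L} ->
  v \in L -> v \notin fn Q -> v \notin b /\ v \notin fn Q'.
Proof.
move=> Hs HC HvL HvQ; have [_ _ Hb Hf] := step_fn Hs.
have HvC : v \notin [fset c in C] by rewrite in_fset_seq; apply/negP => /HC; rewrite HvL.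
by split; apply/negP; [case/Hb|case/Hf]; apply/negP.
Qed.

Lemma step_notin P mu P' v : step P mu P' -> v \notin fn P -> v \notin names_of mu ->
  v \notin fn P'.
Proof.
move=> /step_fn; case: mu => [|a b|C a b] /= Hf HP Hmu.
- by apply: contra HP; exact: Hf.
- case: Hf => _ Hf; apply/negP => /Hf; rewrite mem_cat (negPf HP) /=.
  by move: Hmu; rewrite inE negb_or => /andP[_ /negPf ->].
- case: Hf => _ _ _ Hf; apply/negP => /Hf[|HvC]; first by rewrite (negPf HP).
  by move: Hmu; rewrite inE mem_cat HvC !orbT.
Qed.

(** After a flag summand the other flag is free nowhere any more, and after a summand of [H] neither
    flag is. The process cannot supply the missing name, since it does not know it and extrusion
    avoids names of the test. *)
Lemma unmoved eta X w w' H Q cs Y : let T := test eta X w w' H in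
  well_sorted (PGuard T) -> well_sorted Q ->
  marks w w' (fn_guard H ++ fn Q) -> w \in fn_guard T -> w' \in fn_guard T ->
  weak (nus cs (PPar (PGuard T) Q)) Y -> ubarb Y w -> ubarb Y w' ->
  exists2 Q', weak Q Q' & Y = nus cs (PPar (PGuard T) Q').
Proof.
move=> T HT HQ [ww' _ HwL HwL'] HwT HwT' HwY Hb Hb'.
move: HwL HwL'; rewrite !mem_cat !negb_or => /andP[wH wQ] /andP[w'H w'Q].
have w'w : w'.2 != w.2 by rewrite eq_sym.
have fnw Q1 : weak Q Q1 -> w \notin fn Q1 /\ w' \notin fn Q1.
  by move=> /weak_fn Hf; split; [apply: contra wQ|apply: contra w'Q]; exact: Hf.
case: (weak_context HT HQ HwY) =>
  [//|[Q1 [T1 [HwQ HsT Hw1]]]|[Q1 [Q2 [C [a [b [T1 [HwQ Ho HC HsT Hw1]]]]]]]]; exfalso.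
  have [wQ1 w'Q1] := fnw _ HwQ.
  case: (step_test HsT) => [E|E|Hs]; try subst T1.
  - by apply: (no_barb Hw1 _ w'Q1) Hb'; apply: flag_notin.
  - by apply: (no_barb Hw1 _ wQ1) Hb; apply: flag_notin.
  - by apply: (no_barb Hw1 _ wQ1) Hb; apply: (step_notin Hs).
have [wQ1 w'Q1] := fnw _ HwQ.
have [wb wQ2] := comm_fresh Ho HC HwT wQ1.
have [w'b w'Q2] := comm_fresh Ho HC HwT' w'Q1.
case: (step_test HsT) => [E|E|Hs]; try subst T1.
- by apply: (no_barb Hw1 _ w'Q2) Hb'; apply: flag_notin.
- by apply: (no_barb Hw1 _ wQ2) Hb; apply: flag_notin.
- apply: (no_barb Hw1 _ wQ2) Hb; apply: (step_notin Hs) => //.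
  rewrite /= inE negb_or wb andbT; apply: contraNneq wH => ->.
  by case: (step_fn Hs).
Qed.

(** At type 0 the left side makes no output at an output-controlled name, and [Q] listens at no
    others; [Q] itself never outputs. So the two never communicate, and neither can provide the
    barb. *)
Lemma silent_no_barb T Q cs v : seq_typed false T -> well_sorted Q ->
  all (@out_ctl S) (fn Q) -> ~ active Q -> out_ctl v ->
  ~ ubarb (nus cs (PPar T Q)) v.
Proof.
move=> [HT Ht] HQ HoQ HnQ Hv /ubarb_nus[|_ [Z Hw Hob]]; first exact: ws_par.
have [T' [Q' [Ht' HoQ' HnQ' E]]] : exists T' Q', [/\ typed [::] false T',
    all (@out_ctl S) (fn Q'), ~ active Q' & Z = PPar T' Q'].
  apply: (@weak_inv _ (fun Z => exists T' Q', [/\ typed [::] false T',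
    all (@out_ctl S) (fn Q'), ~ active Q' & Z = PPar T' Q']) _ _ _ Hw); last by exists T, Q.
  move=> Z1 Z2 [T1 [Q1 [Ht1 Ho1 Hn1 ->]]] /step_par_inv.
  case=> [[T2 [Hs _ ->]]|[Q2 [Hs _ ->]]|[C [a [b [T2 [Q2 [_ _ Hs1 Hs2 _]]]]]]|].
  - by exists T2, Q1; split=> //; exact: (typed_step Hs Ht1).
  - exists T1, Q2; split=> //.
      by apply/allP => c Hc; apply: (allP Ho1); exact: (step_fn Hs).
    by case=> x Hx; apply: Hn1; exists x; apply: ubarb_weak Hx; exact: weak_step1.
  - have [Ha _] := step_fn Hs2; have := typed_step Hs1 Ht1.
    by rewrite (allP Ho1 _ Ha) => -[].
  - case=> C [a [b [T2 [Q2 [_ _ _ Hs2 _]]]]].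
    by case: Hn1; exists a, Q1; [exact: weak_refl|eexists _, _, _; eauto].
subst Z; case: Hob => C [b [Z1 /step_par_inv]].
case=> [[T2 [Hs _ _]]|[Q2 [Hs _ _]]|[? [? [? [? [? []]]]]]|[? [? [? [? [? []]]]]]] //.
  by have := typed_step Hs Ht'; rewrite Hv => -[].
by case: HnQ'; exists v, Q'; [exact: weak_refl|eexists _, _, _; eauto].
Qed.

Lemma context_acts eta T Q cs v : seq_typed (~~ eta) T -> well_sorted Q ->
  all (@out_ctl S) (fn Q) -> out_ctl v -> ubarb (nus cs (PPar T Q)) v -> acts eta Q.
Proof.
move=> HT HQ Ho Hv Hb; case: eta HT => //= HT _; apply: NNPP => Hn.
exact: (silent_no_barb (cs := cs) HT HQ Ho Hn Hv).
Qed.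

(** Once one side has gone from [T] to [B], the other must follow: [w] is lost, so [T] has not
    stayed; among the continuations of [G] only [B] keeps [v], so no other one was taken; and [v]
    with [v'] shows that [B] itself has not moved. *)
Lemma child eta X w w' G X' v v' H P Q cs1 cs2 Y :
  let T := test eta X w w' G in let B := test eta X' v v' H in
  bb (nus cs1 (PPar (PGuard B) P)) Y -> weak (nus cs2 (PPar (PGuard T) Q)) Y ->
  acts eta P -> {subset fn P <= X'} -> well_sorted P -> well_sorted (PGuard B) ->
  well_sorted Q -> all (@out_ctl S) (fn Q) -> {subset fn Q <= X} ->
  seq_typed (~~ eta) (PGuard T) ->
  (forall mu (G1 : proc S), step (PGuard G) mu G1 -> v \notin names_of mu ->
     (mu = ATau /\ G1 = PGuard B) \/ v \notin fn G1) ->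
  w \notin fn_guard B ++ fn P -> marks v v' (fn_guard H ++ fn Q) ->
  v.2 != w.2 -> v.2 != w'.2 ->
  out_ctl w -> v \in fn_guard G -> v \notin cs1 -> v' \notin cs1 -> w \notin cs2 ->
  exists2 Q', weak Q Q' & Y = nus cs2 (PPar (PGuard B) Q').
Proof.
move=> T B Hbb HwY Ha HX' HP HB HQ HoQ HX HT HG HwB Hm vw vw' Hoc HvG Hc1 Hc1' Hc2.
have [vv' /andP[Hov Hov'] HvL HvL'] := Hm.
move: HvL HvL'; rewrite !mem_cat !negb_or => /andP[vH vQ] /andP[v'H v'Q].
have Hbv : ubarb Y v.
  by apply: (bb_ubarb Hbb) => //; apply: test_barb => //; left.
have Hbv' : ubarb Y v'.
  by apply: (bb_ubarb Hbb) => //; apply: test_barb => //; right.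
have Hnw : ~ ubarb Y w.
  move/(bb_ubarb (bb_sym Hbb) Hoc)/ubarb_fn; rewrite fn_nus.
  by case/andP=> _ Hin; move: HwB; rewrite mem_cat; move: Hin; rewrite /= mem_cat => ->.
have HvT : v \in fn_guard T by rewrite /= mem_cat HvG orbT.
have fnv Q1 : weak Q Q1 -> v \notin fn Q1.
  by move=> /weak_fn Hf; apply: contra vQ; exact: Hf.
case: (weak_context (proj1 HT) HQ HwY) => [[Q' HwQ E]|[Q1 [T1 [HwQ HsT Hw1]]]|].
(* Had [T] stayed, it would still show [w]: the barb at [v] proves that [Q'] satisfies [acts]. *)
- exfalso; apply: Hnw; rewrite E in Hbv *.
  have HQ' := weak_ws HwQ HQ.
  have HoQ' : all (@out_ctl S) (fn Q').
    by apply/allP => c /(weak_fn HwQ); exact: (allP HoQ).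
  apply: test_barb (context_acts HT HQ' HoQ' Hov Hbv) _ HQ' (proj1 HT) _ Hc2; last by left.
  by move=> c /(weak_fn HwQ)/HX.
- have HQ1 := weak_ws HwQ HQ; have vQ1 := fnv _ HwQ.
  have v'Q1 : v' \notin fn Q1 by apply: contra v'Q; exact: (weak_fn HwQ).
  case: (step_test HsT) => [E|E|Hs]; try subst T1.
  + by exfalso; apply: (no_barb Hw1 _ vQ1) Hbv; apply: flag_notin.
  + by exfalso; apply: (no_barb Hw1 _ vQ1) Hbv; apply: flag_notin.
  + case: (HG _ _ Hs) => // [[_ E]|HvT1]; last by exfalso; apply: (no_barb Hw1 _ vQ1) Hbv.
    subst T1; have [|||Q' HwQ' ->] := unmoved HB HQ1 _ _ _ Hw1 Hbv Hbv'.
    * by split; rewrite ?mem_cat ?negb_or ?vH ?v'H //; apply/andP.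
    * by apply: acts_fn Ha HX' _; left.
    * by apply: acts_fn Ha HX' _; right.
    * by exists Q' => //; exact: weak_trans HwQ HwQ'.
- case=> Q1 [Q2 [C [a [b [T1 [HwQ Ho HC HsT Hw1]]]]]]; exfalso.
  have [vb vQ2] := comm_fresh Ho HC HvT (fnv _ HwQ).
  case: (step_test HsT) => [E|E|Hs]; try subst T1.
  + by apply: (no_barb Hw1 _ vQ2) Hbv; apply: flag_notin.
  + by apply: (no_barb Hw1 _ vQ2) Hbv; apply: flag_notin.
  + have va : v != a.
      apply: contraNneq (fnv _ HwQ) => ->; by case: (step_fn Ho).
    case: (HG _ _ Hs) => [|[//]|HvT1]; first by rewrite /= inE negb_or va.
    exact: (no_barb Hw1 HvT1 vQ2) Hbv.
Qed.

End Tests.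

(** * Internal choice between tests *)

Section Sums.
Variables (S : sorting) (s0 : srt S).
Implicit Types (P Q Z Y : proc S) (G H : guard S) (r : ref S) (eta : bool).
Implicit Types (a c x v w : name S) (mu : action S) (b cs X A : seq (name S)).
Local Notation bb := (@barbed_bisimilar S true).

Definition fl (i : nat) : name S := (s0, i).

Lemma fl_eq i j : (fl i == fl j) = (i == j).
Proof. by rewrite xpair_eqE eqxx. Qed.

Lemma idx_bound_lt A c : c \in A -> c.2 < idx_bound A.
Proof. by move=> Hc; rewrite ltnNge; apply: contraL Hc; exact: idx_bound_notin. Qed.

Lemma fl_notin A i : idx_bound A <= i -> fl i \notin A.
Proof. by move=> Hi; apply: idx_bound_notin. Qed.

(** Each branch owns two consecutive indices, for its two flags. [G0] closes the sum in place of
    [GNil], which is not typable at 1. *)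
Fixpoint gsum G0 (m : nat) (Fs : seq (nat -> proc S)) : guard S :=
  if Fs is F :: Fs' then GSum (GTau (F m)) (gsum G0 m.+2 Fs') else G0.

Lemma fn_gsum G0 m Fs c : c \in fn_guard (gsum G0 m Fs) ->
  c \in fn_guard G0 \/ exists F k, [/\ List.In F Fs, m <= k & c \in fn (F k)].
Proof.
elim: Fs m => [|F Fs IH] m /=; first by left.
rewrite mem_cat => /orP[H|/IH[|[F' [k [HF Hk H]]]]]; [right|by left|right].
  by exists F, m; split=> //; left.
by exists F', k; split=> //; [right|lia].
Qed.

Lemma sorted_gsum Gamma G0 m Fs : sorted_guard Gamma G0 ->
  (forall F k, List.In F Fs -> sorted_proc Gamma (F k)) ->
  sorted_guard Gamma (gsum G0 m Fs).
Proof.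
move=> H0; elim: Fs m => [|F Fs IH] m HF //=.
by rewrite HF ?IH //=; [move=> F' k H; apply: HF; right|left].
Qed.

Lemma typed_gsum Gamma eta G0 m Fs : typed Gamma eta (PGuard G0) ->
  (forall F k, List.In F Fs -> typed Gamma eta (F k)) ->
  typed Gamma eta (PGuard (gsum G0 m Fs)).
Proof.
move=> H0; elim: Fs m => [|F Fs IH] m HF //=.
apply: ty_sum; first by apply/ty_tau/HF; left.
by apply: IH => F' k H; apply: HF; right.
Qed.

(* The branch [F] is recognized by a flag of its own. *)
Lemma gsum_branch_at G0 m (Fs : seq (nat -> proc S)) (F : nat -> proc S) i : onth Fs i = Some F ->
  (forall j (F' : nat -> proc S), onth Fs j = Some F' -> j <> i -> fl (m + i.*2)%N \notin fn (F' (m + j.*2)%N)) ->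
  fl (m + i.*2)%N \notin fn_guard G0 ->
  step (PGuard (gsum G0 m Fs)) ATau (F (m + i.*2)%N) /\
  forall mu (G1 : proc S), step (PGuard (gsum G0 m Fs)) mu G1 ->
    fl (m + i.*2)%N \notin names_of mu ->
    (mu = ATau /\ G1 = F (m + i.*2)%N) \/ fl (m + i.*2)%N \notin fn G1.
Proof.
elim: Fs m i => [|F0 Fs IH] m [|i] //=.
- case=> ->; rewrite addn0 => HF H0; split; first by apply: step_sumL; apply: step_tau.
  move=> mu G1 /step_sum_inv[/step_gtau_inv[-> ->]|Hs Hmu]; [by left|right].
  apply: (step_notin Hs) => //.
  have {}HF j (F' : nat -> proc S) : onth Fs j = Some F' -> fl m \notin fn (F' (m.+2 + j.*2)%N).
    move=> Hj; have := HF j.+1 F' Hj; rewrite doubleS !addnS => H; exact: H.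
  elim: Fs m.+2 HF {IH Hs Hmu} => [|F1 Fs IH] m' HF //=.
  apply: notin_cat; first by have := HF 0 F1 erefl; rewrite addn0.
  by apply: IH => j F' Hj; have := HF j.+1 F' Hj; rewrite doubleS !addnS.
- rewrite doubleS !addnS -!addSn => HF HFs H0; have [|Hs Huniq] := IH m.+2 i HF _ H0.
    move=> j F' Hj ji; have := HFs j.+1 F' Hj; rewrite doubleS !addnS -!addSn.
    by apply=> -[].
  split; first exact: step_sumR.
  move=> mu G1 /step_sum_inv[/step_gtau_inv[-> ->] _|]; last exact: Huniq.
  by right; have := HFs 0 F0 erefl; rewrite addn0; apply.
Qed.

Lemma In_onth (T : Type) (s : seq T) (x : T) : List.In x s -> exists i, onth s i = Some x.
Proof.
by elim: s => //= y s IH [->|/IH[i Hi]]; [exists 0|exists i.+1].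
Qed.

Lemma onth_In (T : Type) (s : seq T) i (x : T) : onth s i = Some x -> List.In x s.
Proof.
elim: s i => [|y s IH] [|i] //=; first by case=> ->; left.
by move/IH; right.
Qed.

Lemma gsum_branch G0 m Fs F :
  (forall F k i, List.In F Fs -> m <= i -> m <= k -> fl i \in fn (F k) -> i = k \/ i = k.+1) ->
  (forall i, m <= i -> fl i \notin fn_guard G0) -> List.In F Fs ->
  exists k, [/\ m <= k, step (PGuard (gsum G0 m Fs)) ATau (F k)
    & forall mu (G1 : proc S), step (PGuard (gsum G0 m Fs)) mu G1 -> fl k \notin names_of mu ->
        (mu = ATau /\ G1 = F k) \/ fl k \notin fn G1].
Proof.
move=> HF H0 HIn; have [i Hi] := In_onth HIn.
have [||Hs Huniq] := gsum_branch_at (m := m) Hi (G0 := G0).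
- move=> j F' Hj ji; apply/negP => /(HF _ _ _ (onth_In Hj)) H.
  by case: H; lia.
- by apply: H0; lia.
- by exists (m + i.*2)%N; split=> //; lia.
Qed.

Definition ok P := well_sorted P /\ all (@out_ctl S) (fn P).

Lemma ok_weak P P' : weak P P' -> ok P -> ok P'.
Proof.
move=> Hw [H1 H2]; split; first exact: weak_ws Hw H1.
by apply/allP => c /(weak_fn Hw); exact: (allP H2).
Qed.

(** Names that the test does not know may be restricted at will; among those it knows only names of
    [A] may be, and the flags are chosen outside [A]. *)
Definition cs_ok cs G A := forall c, c \in cs -> c \in fn_guard G -> c \in A.

(** The two lists are independent because the two sides may extrude different names in their
    communications. *)
Definition sep G A P Q := forall cs1 cs2, cs_ok cs1 G A -> cs_ok cs2 G A ->
  ~ bb (nus cs1 (PPar (PGuard G) P)) (nus cs2 (PPar (PGuard G) Q)).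

Definition is_test eta X A w w' H :=
  seq_typed (~~ eta) (PGuard (test eta X w w' H)) /\ marks w w' (A ++ fn_guard H).

(* Quantifying over the derivatives of [Q] is what allows distinguishing tests
   to be combined by an internal choice. *)
Definition distinguishable eta P Q := forall A, exists w w' H,
  is_test eta (fn P ++ fn Q) A w w' H /\
  forall Q', weak Q Q' -> sep (test eta (fn P ++ fn Q) w w' H) A P Q'.

Lemma sep_sym G A P Q : sep G A P Q -> sep G A Q P.
Proof. by move=> H cs1 cs2 H1 H2 /bb_sym; exact: H. Qed.

Record tdata := TData { tX : seq (name S); tw : name S; tw' : name S; tH : guard S }.
Definition tguard eta (t : tdata) := test eta (tX t) (tw t) (tw' t) (tH t).

Lemma pick_tests eta P (D : proc S -> Prop) A l :
  (forall Q, D Q -> distinguishable eta P Q \/ distinguishable eta Q P) ->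
  exists ts : seq tdata,
    (forall t, List.In t ts -> is_test eta (tX t) A (tw t) (tw' t) (tH t)) /\
    (forall Q, List.In Q l -> D Q -> exists t, [/\ List.In t ts,
       {subset fn P <= tX t}, {subset fn Q <= tX t}
     & (forall Q', weak Q Q' -> sep (tguard eta t) A P Q') \/
       (forall P', weak P P' -> sep (tguard eta t) A Q P')]).
Proof.
have catl (s t : seq (name S)) : {subset s <= s ++ t}.
  by move=> c Hc; rewrite mem_cat Hc.
have catr (s t : seq (name S)) : {subset t <= s ++ t}.
  by move=> c Hc; rewrite mem_cat Hc orbT.
move=> HD; elim: l => [|Q l [ts [Hts Hl]]]; first by exists [::].
case: (classic (D Q)) => [HQ|HnQ]; last first.
  by exists ts; split=> // Q' [<-|]; [|exact: Hl].
case: (HD _ HQ) => /(_ A)[w [w' [H [Ht Hsep]]]].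
- exists (TData (fn P ++ fn Q) w w' H :: ts); split=> [t [<-|]|Q' [<- _|HQ' HDQ']] //; first exact: Hts.
    exists (TData (fn P ++ fn Q) w w' H); split=> //; [by left|exact: catl|exact: catr|by left].
  by have [t [? ? ? ?]] := Hl _ HQ' HDQ'; exists t; split=> //; right.
- exists (TData (fn Q ++ fn P) w w' H :: ts); split=> [t [<-|]|Q' [<- _|HQ' HDQ']] //; first exact: Hts.
    exists (TData (fn Q ++ fn P) w w' H); split=> //; [by left|exact: catr|exact: catl|by right].
  by have [t [? ? ? ?]] := Hl _ HQ' HDQ'; exists t; split=> //; right.
Qed.

Lemma seq_typed_test eta X w w' H : all (@out_ctl S) X -> out_ctl w -> out_ctl w' ->
  seq_typed (~~ eta) (PGuard H) -> seq_typed (~~ eta) (PGuard (test eta X w w' H)).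
Proof.
move=> HX Hw Hw' [H1 H2]; split.
  by apply/andP; split; [exact: sorted_marker|exact: H1].
by apply: ty_sum => //; exact: typed_marker.
Qed.

End Sums.

(** * One test against all answers to a challenge *)

Section Choice.
Variables (S : sorting) (s0 : srt S).
Hypothesis s0_out : outc s0.
Implicit Types (P Q Z Y : proc S) (G H : guard S) (r : ref S) (eta : bool).
Implicit Types (a c x v w : name S) (mu : action S) (b cs X A : seq (name S)).
Local Notation bb := (@barbed_bisimilar S true).
Local Notation fl := (fl s0).

Lemma fl_out i : out_ctl (fl i). Proof. exact: s0_out. Qed.

(** Given an answer [Q], the side that the test for [Q] keeps fixed enters the corresponding branch.
    The other side has to follow into the same branch, ending in some derivative, and from all
    derivatives the test separates. *)
Lemma choice_test eta X P (D : proc S -> Prop) l A :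
  ok P -> acts eta P -> {subset fn P <= X} -> all (@out_ctl S) X ->
  (forall Q, D Q -> [/\ ok Q, {subset fn Q <= X} & List.In Q l]) ->
  (forall Q, D Q -> distinguishable eta P Q \/ distinguishable eta Q P) ->
  exists w w' H, is_test eta X A w w' H /\
    forall Q, D Q -> sep (test eta X w w' H) A P Q.
Proof.
move=> HokP HaP HPX HX HD Hdist.
(* Avoiding [X] as well keeps the flags of the collected tests out of the free names of [P] and of
   every answer. *)
have [ts [Hts Hl]] := pick_tests (A ++ X) l Hdist.
pose U := flatten [seq fn_guard (tguard eta t) | t <- ts].
have HU t c : List.In t ts -> c \in fn_guard (tguard eta t) -> c \in U.
  rewrite /U; elim: ts {Hts Hl U} => //= t' ts IH [->|Ht] Hc; rewrite mem_cat ?Hc //.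
  by rewrite IH ?orbT.
pose m := idx_bound (A ++ X ++ U).
have Hm A' i : {subset A' <= A ++ X ++ U} -> m <= i -> fl i \notin A'.
  by move=> HA Hi; apply/negP => /HA; apply/negP/fl_notin.
have mA i : m <= i -> fl i \notin A by apply: Hm => c Hc; rewrite mem_cat Hc.
have mX i : m <= i -> fl i \notin X by apply: Hm => c Hc; rewrite !mem_cat Hc orbT.
have mt t i : List.In t ts -> m <= i -> fl i \notin fn_guard (tguard eta t).
  by move=> Ht; apply: Hm => c /(HU _ _ Ht) Hc; rewrite !mem_cat Hc !orbT.
have flag_idx i j : fl i \in fn (flag (fl j)) -> i = j by move/fn_flag.
have mark_idx i j k : m <= i -> fl i \in fn_guard (marker eta X (fl j) (fl k)) -> i = j \/ i = k.
  move=> Hi /fn_marker[Hc|/flag_idx E|/flag_idx E].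
  - by rewrite (negPf (mX i Hi)) in Hc.
  - by left.
  - by right.
(* Apart from its flags this stage leads to [t] only, so the second use of [child] has no other
   branch to exclude. *)
pose Fb t k := PGuard (test eta X (fl k) (fl k.+1) (GTau (PGuard (tguard eta t)))).
pose Fs := map Fb ts.
have HFs F : List.In F Fs -> exists2 t, List.In t ts & F = Fb t.
  rewrite /Fs; elim: ts {Hts Hl HU mt Fs U m Hm mA mX flag_idx mark_idx} => //= t ts' IH.
  by case=> [<-|/IH[t' H ->]]; [exists t; [left|]|exists t'; [right|]].
have FsI t : List.In t ts -> List.In (Fb t) Fs.
  rewrite /Fs; elim: ts {Hts Hl HU mt Fs HFs U m Hm mA mX flag_idx mark_idx} => //= t' ts' IH.
  by case=> [->|/IH]; [left|right].
have HFidx F k i : List.In F Fs -> m <= i -> fl i \in fn (F k) -> i = k \/ i = k.+1.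
  case/HFs=> t Ht -> Hi /=; rewrite mem_cat => /orP[/mark_idx|/=]; first exact.
  by rewrite (negPf (mt _ _ Ht Hi)).
(* [m] and [m.+1] are the flags of the whole test and [m.+2] serves the last summand; the branches
   start at [m.+3]. *)
pose G0 := marker eta X (fl m.+2) (fl m.+2).
pose H := gsum G0 m.+3 Fs.
have H0idx i : m <= i -> fl i \in fn_guard G0 -> i = m.+2.
  by move=> Hi /mark_idx[].
have HHidx i : m <= i -> fl i \in fn_guard H -> m.+2 <= i.
  move=> Hi /fn_gsum[/H0idx ->//|[F [k [HF Hk Hin]]]].
  by case: (HFidx _ _ _ HF Hi Hin); lia.
have Hty_t t : List.In t ts -> seq_typed (~~ eta) (PGuard (tguard eta t)) by case/Hts.
have HtyB t k : List.In t ts -> seq_typed (~~ eta) (Fb t k).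
  move=> Ht; have [H1 H2] := Hty_t _ Ht; apply: seq_typed_test => //; try exact: fl_out.
  by split=> //; apply: ty_tau.
have HtyH : seq_typed (~~ eta) (PGuard H).
  split.
    apply: sorted_gsum; first exact: sorted_marker.
    by move=> F k /HFs[t Ht ->]; case: (HtyB t k Ht).
  apply: typed_gsum; first by apply: typed_marker => //; exact: fl_out.
  by move=> F k /HFs[t Ht ->]; case: (HtyB t k Ht).
pose T := test eta X (fl m) (fl m.+1) H.
have HtyT : seq_typed (~~ eta) (PGuard T) by apply: seq_typed_test => //; exact: fl_out.
exists (fl m), (fl m.+1), H; split.
  split=> //; split; rewrite ?fl_eq ?fl_out ?mem_cat ?negb_or ?mA //=; try lia.
    by apply/negP => /HHidx; lia.
  by apply/negP => /HHidx; lia.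
move=> Q HQ cs1 cs2 Hcs1 Hcs2 Hbb; have [HokQ HQX HQl] := HD _ HQ.
have fl_cs cs i : cs_ok cs T A -> m <= i -> fl i \in fn_guard T -> fl i \notin cs.
  by move=> Hcs Hi HT; apply/negP => Hc; move: (mA i Hi); rewrite (Hcs _ Hc HT).
have wT : fl m \in fn_guard T by apply: (acts_fn H HaP HPX); left.
(* The barb of the test must also be seen beside [Q], and at type 1 it takes the thread of [Q] to
   produce it. *)
have HaQ : acts eta Q.
  apply: (context_acts HtyT (proj1 HokQ) (proj2 HokQ) (fl_out m)).
  apply: (bb_ubarb Hbb (fl_out m)).
  apply: test_barb HaP HPX (proj1 HokP) (proj1 HtyT) _ (fl_cs _ _ Hcs1 (leqnn m) wT).
  by left.
(* Stated for arbitrary processes, because [P] and [Q] exchange their roles when the test separates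
   in the other direction. *)
have descend t P1 Q1 cs3 cs4 : List.In t ts -> ok P1 -> ok Q1 -> acts eta P1 ->
    {subset fn P1 <= X} -> {subset fn Q1 <= X} -> {subset fn P1 <= tX t} ->
    cs_ok cs3 T A -> cs_ok cs4 T A ->
    bb (nus cs3 (PPar (PGuard T) P1)) (nus cs4 (PPar (PGuard T) Q1)) ->
    exists2 Q2, weak Q1 Q2 & bb (nus cs3 (PPar (PGuard (tguard eta t)) P1))
                              (nus cs4 (PPar (PGuard (tguard eta t)) Q2)).
  move=> Ht HokP1 HokQ1 HaP1 HP1X HQ1X HP1t Hcs3 Hcs4 Hbb1.
  have [||k [Hk Hsk Huniq]] := @gsum_branch _ s0 G0 m.+3 Fs (Fb t) _ _ (FsI _ Ht).
  - by move=> F k i HF Hi Hk; apply: HFidx => //; lia.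
  - by move=> i Hi; apply/negP => /H0idx; lia.
  have subBH : {subset fn (Fb t k) <= fn_guard H} by exact: (step_fn Hsk).
  have subHT : {subset fn_guard H <= fn_guard T} by move=> c Hc; rewrite /= mem_cat Hc orbT.
  have subtB : {subset fn_guard (tguard eta t) <= fn (Fb t k)}.
    by move=> c Hc; rewrite /= mem_cat /= Hc orbT.
  have kB : fl k \in fn (Fb t k) :=
    acts_fn (GTau (PGuard (tguard eta t))) HaP1 HP1X (or_introl erefl).
  have kB' : fl k.+1 \in fn (Fb t k) :=
    acts_fn (GTau (PGuard (tguard eta t))) HaP1 HP1X (or_intror erefl).
  have notP i : m <= i -> fl i \notin fn P1.
    by move=> Hi; apply/negP => /HP1X; apply/negP/mX.
  have notQ i : m <= i -> fl i \notin fn Q1.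
    by move=> Hi; apply/negP => /HQ1X; apply/negP/mX.
  have [Y HwY HbbY] : exists2 Y, weak (nus cs4 (PPar (PGuard T) Q1)) Y
      & bb (nus cs3 (PPar (Fb t k) P1)) Y.
    apply: bb_weak Hbb1 _; apply: weak_step1; apply: step_tau_nus_intro.
      by apply: ws_par; [exact: (proj1 HtyT)|exact: (proj1 HokP1)].
    by apply: step_parL => //; apply: step_sumR.
  have [|||||||Q2 HwQ2 EY] := child HbbY HwY HaP1 HP1X (proj1 HokP1) (proj1 (HtyB t k Ht))
    (proj1 HokQ1) (proj2 HokQ1) HQ1X HtyT Huniq _ _ _ _ (fl_out m) (subBH _ kB) _ _ _.
  - rewrite mem_cat negb_or notP // andbT; apply/negP => Hin.
    by case: (HFidx _ k m (FsI _ Ht) _ Hin); lia.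
  - have nL i : m.+3 <= i -> fl i \notin fn_guard (GTau (PGuard (tguard eta t))) ++ fn Q1.
      by move=> Hi; apply: notin_cat; [apply: mt => //; lia|apply: notQ; lia].
    split; [by rewrite /=; lia|by rewrite !fl_out| |]; apply: nL; lia.
  - by rewrite /=; lia.
  - by rewrite /=; lia.
  - by apply: fl_cs Hcs3 _ (subHT _ (subBH _ kB)); lia.
  - by apply: fl_cs Hcs3 _ (subHT _ (subBH _ kB')); lia.
  - by apply: fl_cs Hcs4 _ wT; lia.
  have Hmk : m <= k by lia.
  subst Y; have HokQ2 := ok_weak HwQ2 HokQ1.
  have HQ2 : {subset fn Q2 <= X} by move=> c /(weak_fn HwQ2)/HQ1X.
  have [Hty [vv' /andP[H2 H2'] H3 H3']] := Hts _ Ht.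
  have tB : tw t \in fn_guard (tguard eta t) by rewrite /tguard; apply: (acts_fn _ HaP1 HP1t); left.
  have tB' : tw' t \in fn_guard (tguard eta t) by rewrite /tguard; apply: (acts_fn _ HaP1 HP1t); right.
  have tcs v cs : v \notin A -> v \in fn_guard (tguard eta t) -> cs_ok cs T A -> v \notin cs.
    move=> HvA Hvt Hcs; apply/negP => Hc; move: HvA.
    by rewrite (Hcs _ Hc) // (subHT _ (subBH _ (subtB _ Hvt))).
  move: H3 H3'; rewrite !mem_cat !negb_or => /andP[/andP[vA vX] vH] /andP[/andP[v'A v'X] v'H].
  have nk i : m <= i -> (tw t).2 != i.
    move=> Hi; rewrite ltn_eqF //; apply: leq_trans Hi; apply: idx_bound_lt.
    by rewrite !mem_cat (HU _ _ Ht tB) !orbT.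
  have [Y HwY2 HbbY2] : exists2 Y, weak (nus cs4 (PPar (Fb t k) Q2)) Y
      & bb (nus cs3 (PPar (PGuard (tguard eta t)) P1)) Y.
    apply: bb_weak HbbY _; apply: weak_step1; apply: step_tau_nus_intro.
      by apply: ws_par; [exact: (proj1 (HtyB t k Ht))|exact: (proj1 HokP1)].
    by apply: step_parL => //; apply: step_sumR; apply: step_tau.
  have [||||||||Q3 HwQ3 EY] := child HbbY2 HwY2 HaP1 HP1t (proj1 HokP1) (proj1 Hty)
    (proj1 HokQ2) (proj2 HokQ2) HQ2 (HtyB t k Ht) _ _ _ _ _ (fl_out k) tB _ _ _.
  - by move=> mu G1 /step_gtau_inv[-> ->] _; left.
  - exact: (notin_cat (mt t k Ht Hmk) (notP k Hmk)).
  - split=> //; first by rewrite H2 H2'.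
      by apply: notin_cat => //; apply/negP => /HQ2; apply/negP.
    by apply: notin_cat => //; apply/negP => /HQ2; apply/negP.
  - exact: nk.
  - by apply: nk; exact: leqW.
  - exact: tcs.
  - exact: tcs.
  - exact: fl_cs Hcs4 Hmk (subHT _ (subBH _ kB)).
  by exists Q3; [exact: weak_trans HwQ2 HwQ3|rewrite -EY].
have [t [Ht HPt HQt Hsep]] := Hl _ HQl HQ.
have tcs_ok cs : cs_ok cs T A -> cs_ok cs (tguard eta t) (A ++ X).
  move=> Hcs c Hc Hct; rewrite mem_cat (Hcs _ Hc) //.
  have [||k [Hk Hsk _]] := @gsum_branch _ s0 G0 m.+3 Fs (Fb t) _ _ (FsI _ Ht).
  - by move=> F k i HF Hi Hk; apply: HFidx => //; lia.
  - by move=> i Hi; apply/negP => /H0idx; lia.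
  by rewrite /= mem_cat (step_fn Hsk) ?orbT //= mem_cat /= Hct orbT.
case: Hsep => Hsep.
  have [Q2 HwQ2 Hbb2] := descend t P Q cs1 cs2 Ht HokP HokQ HaP HPX HQX HPt Hcs1 Hcs2 Hbb.
  exact: Hsep _ HwQ2 _ _ (tcs_ok _ Hcs1) (tcs_ok _ Hcs2) Hbb2.
have [P2 HwP2 Hbb2] := descend t Q P cs2 cs1 Ht HokQ HokP HaQ HQX HPX HQt Hcs2 Hcs1 (bb_sym Hbb).
exact: Hsep _ HwP2 _ _ (tcs_ok _ Hcs2) (tcs_ok _ Hcs1) Hbb2.
Qed.

End Choice.

(** * Two strong equivalences of parallel compositions *)

Section Rearrange.
Variable S : sorting.
Implicit Types (P Q Z Y M : proc S) (b cs : seq (name S)) (a x v : name S) (mu : action S).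

Lemma step_msg_inv x b mu Z : step (out_msg x b) mu Z ->
  mu = AOut fset0 x b /\ Z = PGuard GNil.
Proof.
move E: (out_msg x b) => P Hs; case: Hs E => // x' b' [-> E]; split=> //.
by rewrite (@inj_map _ _ (@Free S) _ _ _ E) // => ? ? [].
Qed.

Lemma step_nil_inv mu Z : ~ step (PGuard (@GNil S)) mu Z.
Proof. by move=> Hs; inversion Hs. Qed.

(** A flag is consumed only by a receiver that knows [v], and [Q] never learns it. *)
Lemma flag_stays v Q cs Y : weak (nus cs (PPar (flag v) Q)) Y -> well_sorted Q ->
  v \notin fn Q -> v \notin cs -> ubarb Y v.
Proof.
move=> Hw HQ HvQ Hcs; have Hws : well_sorted (PPar (flag v) Q).
  by apply: ws_par => //; exact: ws_flag.
have [Z HwZ ->] := weak_nus Hws Hw.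
have [Q' [HQ' _ E]] : exists Q', [/\ well_sorted Q', v \notin fn Q' & Z = PPar (flag v) Q'].
  apply: (@weak_inv _ (fun Z => exists Q', [/\ well_sorted Q', v \notin fn Q'
    & Z = PPar (flag v) Q']) _ _ _ HwZ) => [Z1 Z2 [Q1 [HQ1 Hv ->]]|]; last by exists Q.
  case/step_par_inv=> [[P' [Hs _ _]]|[Q' [Hs _ ->]]|[C [a [b [P' [Q' [_ _ Hs1 Hs2 _]]]]]]|].
  - by move: Hs; rewrite flagE => /step_msg_inv[].
  - exists Q'; split=> //; first exact: ws_step Hs HQ1.
    by apply: contra Hv; exact: (step_fn Hs).
  - move: Hs1; rewrite flagE => /step_msg_inv[[_ Ea _] _]; subst a.
    by have [Hin _] := step_fn Hs2; rewrite Hin in Hv.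
  - by case=> C [a [b [P' [Q' [_ _ Hs1 _ _]]]]]; move: Hs1; rewrite flagE => /step_msg_inv[].
subst Z; apply: ubarb_nus_intro => //; first by apply: ws_par => //; exact: ws_flag.
by exists (PPar (flag v) Q'); [exact: weak_refl|exact: obarb_flag].
Qed.

Section UnderRes.
Variable B : proc S -> proc S -> Prop.

(** In the nameless syntax a restriction closes a name throughout the body, including under the
    restrictions already there. The base relation must therefore be stable under maps of references;
    typing is then transferred in an extended environment. *)
Inductive under_res : proc S -> proc S -> Prop :=
  | ur_base Z1 Z2 : B Z1 Z2 -> under_res Z1 Z2
  | ur_res s Z1 Z2 : under_res Z1 Z2 -> under_res (PRes s Z1) (PRes s Z2).

Hypothesis Bmap : forall f k Z1 Z2, B Z1 Z2 -> B (map_proc f k Z1) (map_proc f k Z2).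
Hypothesis Bsorted : forall Gamma Z1 Z2, B Z1 Z2 -> sorted_proc Gamma Z1 -> sorted_proc Gamma Z2.
Hypothesis Btyped : forall Gamma eta Z1 Z2, B Z1 Z2 -> typed Gamma eta Z1 -> typed Gamma eta Z2.

Lemma under_res_nus cs Z1 Z2 : B Z1 Z2 -> under_res (nus cs Z1) (nus cs Z2).
Proof.
have Hmap f k Z1' Z2' : under_res Z1' Z2' -> under_res (map_proc f k Z1') (map_proc f k Z2').
  by move=> H; elim: H k => [Y1 Y2 H|s Y1 Y2 _ IH] k; [apply/ur_base/Bmap|apply: ur_res].
by move=> H; elim: cs => [|c cs IH] /=; [exact: ur_base|apply/ur_res/Hmap].
Qed.

Lemma seq_typed_nus_transfer eta cs Z1 Z2 : B Z1 Z2 ->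
  seq_typed eta (nus cs Z1) -> seq_typed eta (nus cs Z2).
Proof.
move=> /(under_res_nus cs) H [H1 H2]; split.
  move: H1; rewrite /well_sorted => H1; elim: H [::] H1 {H2} => [Y1 Y2 HB|s Y1 Y2 _ IH] Gamma /=; first exact: (Bsorted HB).
  exact: IH.
elim: H [::] H2 {H1} => [Y1 Y2 HB|s Y1 Y2 _ IH] Gamma Ht; first exact: Btyped HB Ht.
by inversion Ht; subst; apply: ty_res; apply: IH.
Qed.

End UnderRes.

Lemma typed_par_inv Gamma (eta : bool) P Q : typed Gamma eta (PPar P Q) ->
  exists e1 e2 : bool, [/\ eta = (e1 + e2)%N :> nat, typed Gamma e1 P & typed Gamma e2 Q].
Proof. by move=> Ht; inversion Ht; subst; eexists _, _; split; eauto. Qed.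

Lemma typed_nil_inv Gamma eta : typed Gamma eta (PGuard (@GNil S)) -> eta = false.
Proof. by move=> Ht; inversion Ht. Qed.

(** From the message beside the test that has emitted it to the message beside the process that is
    to receive it. *)
Definition par_rot Z1 Z2 := exists M T P, Z1 = PPar (PPar M T) P /\ Z2 = PPar T (PPar P M).

Lemma seq_typed_par_rot eta cs M T P :
  seq_typed eta (nus cs (PPar (PPar M T) P)) <-> seq_typed eta (nus cs (PPar T (PPar P M))).
Proof.
split; [apply: (@seq_typed_nus_transfer par_rot)|apply: (@seq_typed_nus_transfer (fun A B => par_rot B A))];
  do ?[by exists M, T, P]; rewrite /par_rot.
- by move=> f k Z1 Z2 [M' [T' [P' [-> ->]]]] /=; eexists _, _, _; split.
- by move=> Gamma Z1 Z2 [M' [T' [P' [-> ->]]]] /= /andP[/andP[-> ->] ->].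
- move=> Gamma e Z1 Z2 [M' [T' [P' [-> ->]]]].
  case/typed_par_inv=> e1 [e2 [He /typed_par_inv[e3 [e4 [He' H3 H4]]] H2]].
  by case: e e1 e2 e3 e4 He He' H2 H3 H4 => [] [] [] [] [] //= _ _ H2 H3 H4;
    apply: (ty_par _ H4 (ty_par _ H2 H3)); try exact: (erefl (nat_of_bool true));
    try exact: (erefl (nat_of_bool false)).
- by move=> f k Z1 Z2 [M' [T' [P' [-> ->]]]] /=; eexists _, _, _; split.
- by move=> Gamma Z1 Z2 [M' [T' [P' [-> ->]]]] /= /and3P[-> -> ->].
- move=> Gamma e Z1 Z2 [M' [T' [P' [-> ->]]]].
  case/typed_par_inv=> e1 [e2 [He H1 /typed_par_inv[e3 [e4 [He' H3 H4]]]]].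
  by case: e e1 e2 e3 e4 He He' H1 H3 H4 => [] [] [] [] [] //= _ _ H1 H3 H4;
    apply: (ty_par _ (ty_par _ H4 H1) H3); try exact: (erefl (nat_of_bool true));
    try exact: (erefl (nat_of_bool false)).
Qed.

Definition pad Z1 Z2 := exists T P, Z1 = PPar T (PPar P (PGuard GNil)) /\ Z2 = PPar T P.

Lemma seq_typed_pad eta cs T P :
  seq_typed eta (nus cs (PPar T (PPar P (PGuard GNil)))) <-> seq_typed eta (nus cs (PPar T P)).
Proof.
split; [apply: (@seq_typed_nus_transfer pad)|apply: (@seq_typed_nus_transfer (fun A B => pad B A))];
  do ?[by exists T, P]; rewrite /pad.
- by move=> f k Z1 Z2 [T' [P' [-> ->]]] /=; eexists _, _; split.
- by move=> Gamma Z1 Z2 [T' [P' [-> ->]]] /=; rewrite andbT.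
- move=> Gamma e Z1 Z2 [T' [P' [-> ->]]].
  case/typed_par_inv=> e1 [e2 [He H1 /typed_par_inv[e3 [e4 [He' H3 /typed_nil_inv E]]]]].
  by subst e4; apply: (ty_par _ H1 H3); rewrite He He' addn0.
- by move=> f k Z1 Z2 [T' [P' [-> ->]]] /=; eexists _, _; split.
- by move=> Gamma Z1 Z2 [T' [P' [-> ->]]] /=; rewrite andbT.
- move=> Gamma e Z1 Z2 [T' [P' [-> ->]]] /typed_par_inv[e1 [e2 [He H1 H2]]].
  by apply: (ty_par He H1); apply: (@ty_par _ _ _ e2 false) => //; rewrite ?addn0 //; exact: ty_nil.
Qed.

(** A consumed message leaves [GNil]; including it makes the class closed under transitions. *)
Definition is_msg M := M = PGuard GNil \/ exists x b, M = out_msg x b.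

Lemma step_is_msg M mu Z : is_msg M -> step M mu Z ->
  exists x b, [/\ M = out_msg x b, mu = AOut fset0 x b & Z = PGuard GNil].
Proof.
case=> [->|[x [b ->]]]; first by move/step_nil_inv.
by case/step_msg_inv=> -> ->; exists x, b.
Qed.

Lemma nil_is_msg : is_msg (PGuard GNil). Proof. by left. Qed.

Lemma bn_fresh_cat mu P Q : bn_fresh mu P -> bn_fresh mu Q -> bn_fresh mu (PPar P Q).
Proof. by move=> H1 H2 c Hc; rewrite /= mem_cat negb_or H1 ?H2. Qed.

Lemma bn_fresh_parl mu P Q : bn_fresh mu (PPar P Q) -> bn_fresh mu P.
Proof. by move=> H c /H; rewrite /= mem_cat negb_or => /andP[]. Qed.

Lemma bn_fresh_parr mu P Q : bn_fresh mu (PPar P Q) -> bn_fresh mu Q.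
Proof. by move=> H c /H; rewrite /= mem_cat negb_or => /andP[]. Qed.

Lemma bn_fresh_seq cs a b P : bn_fresh (AOut [fset c in cs] a b) P <->
  (forall c, c \in cs -> c \notin fn P).
Proof. by split=> H c Hc; apply: H; move: Hc; rewrite /= in_fset_seq. Qed.

(** A message extrudes nothing and never receives, so each communication has a counterpart with the
    same restrictions in front. *)
Lemma par_rot_tau M T P Z : is_msg M -> step (PPar (PPar M T) P) ATau Z ->
  exists cs M' T' P', [/\ is_msg M',
    [/\ well_sorted M -> well_sorted M', well_sorted T -> well_sorted T'
      & well_sorted P -> well_sorted P'],
    Z = nus cs (PPar (PPar M' T') P')
    & step (PPar T (PPar P M)) ATau (nus cs (PPar T' (PPar P' M')))].
Proof.
move=> HM /step_par_inv[[Z1 [/step_par_inv Hs _ ->]]|[P' [Hs _ ->]]|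
  [cs [a [b [Z1 [P' [_ [Hu Hf] /step_par_inv Hs1 Hs2 ->]]]]]]|
  [cs [a [b [Z1 [P' [_ [Hu Hf] /step_par_inv Hs1 Hs2 ->]]]]]]].
- case: Hs => [[M' [/(step_is_msg HM)[? [? []]] //]]|[T' [Hs _ ->]]|
    [cs [a [b [M' [T' [_ [Hu Hf] Hs1 Hs2 ->]]]]]]|[cs [a [b [M' [T' [_ _ /(step_is_msg HM)[? [? []]] //]]]]]]].
  + exists [::], M, T', P; split=> //; first by split=> //; exact: ws_step Hs.
    exact: step_parL.
  + have [x [b' [EM [EC Ea Eb] EM']]] := step_is_msg HM Hs1; subst.
    have Ecs := fset_seq_nil EC; subst cs.
    exists [::], (PGuard GNil), T', P; split=> //; first exact: nil_is_msg.
      by split=> //; exact: ws_step Hs2.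
    apply: (@step_comR _ _ _ [::]) Hs2 _ => //; rewrite EC.
    by apply: step_parR => //; exact: step_out.
- exists [::], M, T, P'; split=> //; first by split=> //; exact: ws_step Hs.
  by apply: step_parR => //; apply: step_parL.
- case: Hs1 => [[M' [Hs1 _ ->]]|[T' [Hs1 Hf1 ->]]|[? [? [? [? [? [//]]]]]]|[? [? [? [? [? [//]]]]]]].
  + have [x [b' [EM [EC Ea Eb] EM']]] := step_is_msg HM Hs1; subst.
    have Ecs := fset_seq_nil EC; subst cs.
    exists [::], (PGuard GNil), T, P'; split=> //; first exact: nil_is_msg.
      by split=> //; exact: ws_step Hs2.
    apply: step_parR => //; apply: (@step_comR _ _ _ [::]) Hs2 _ => //; rewrite EC.
  + exists cs, M, T', P'; split=> //; first by split=> //; [exact: ws_step Hs1|exact: ws_step Hs2].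
    apply: step_comL Hs1 _ => //; last by apply: step_parL Hs2 _.
    move/bn_fresh_seq: Hf1 => Hf1 c Hc.
    by rewrite /= mem_cat negb_or Hf // Hf1.
- case: Hs1 => [[M' [/(step_is_msg HM)[? [? []]] //]]|[T' [Hs1 Hf1 ->]]|[? [? [? [? [? [//]]]]]]|[? [? [? [? [? [//]]]]]]].
  exists cs, M, T', P'; split=> //; first by split=> //; [exact: ws_step Hs1|exact: ws_step Hs2].
  apply: step_comR Hs1 _ => //.
    by move=> c Hc; move: (Hf c Hc); rewrite /= mem_cat negb_or => /andP[].
  apply: step_parL => //; apply/bn_fresh_seq => c Hc.
  by move: (Hf c Hc); rewrite /= mem_cat negb_or => /andP[].
Qed.

Lemma par_rot_tau_back M T P Z : is_msg M -> step (PPar T (PPar P M)) ATau Z ->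
  exists cs M' T' P', [/\ is_msg M',
    [/\ well_sorted M -> well_sorted M', well_sorted T -> well_sorted T'
      & well_sorted P -> well_sorted P'],
    Z = nus cs (PPar T' (PPar P' M'))
    & step (PPar (PPar M T) P) ATau (nus cs (PPar (PPar M' T') P'))].
Proof.
move=> HM /step_par_inv[[T' [Hs _ ->]]|[Z1 [/step_par_inv Hs _ ->]]|
  [cs [a [b [T' [Z1 [_ [Hu Hf] Hs1 /step_par_inv Hs2 ->]]]]]]|
  [cs [a [b [T' [Z1 [_ [Hu Hf] Hs1 /step_par_inv Hs2 ->]]]]]]].
- exists [::], M, T', P; split=> //; first by split=> //; exact: ws_step Hs.
  by apply: step_parL => //; apply: step_parR.
- case: Hs => [[P' [Hs _ ->]]|[M' [/(step_is_msg HM)[? [? []]] //]]|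
    [cs [a [b [P' [M' [_ _ _ /(step_is_msg HM)[? [? []]] //]]]]]]|[cs [a [b [P' [M' [_ [Hu Hf] Hs1 Hs2 ->]]]]]]].
  + exists [::], M, T, P'; split=> //; first by split=> //; exact: ws_step Hs.
    exact: step_parR.
  + have [x [b' [EM [EC Ea Eb] EM']]] := step_is_msg HM Hs2; subst.
    have Ecs := fset_seq_nil EC; subst cs.
    exists [::], (PGuard GNil), T, P'; split=> //; first exact: nil_is_msg.
      by split=> //; exact: ws_step Hs1.
    apply: (@step_comL _ _ _ [::]) _ Hs1 => //; rewrite EC.
    by apply: step_parL => //; exact: step_out.
- case: Hs2 => [[P' [Hs2 Hf1 ->]]|[M' [/(step_is_msg HM)[? [? []]] //]]|[? [? [? [? [? [//]]]]]]|[? [? [? [? [? [//]]]]]]].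
  exists cs, M, T', P'; split=> //; first by split=> //; [exact: ws_step Hs1|exact: ws_step Hs2].
  apply: step_comL _ Hs2 => //.
    by move=> c Hc; move: (Hf c Hc); rewrite /= mem_cat negb_or => /andP[].
  apply: step_parR => //; apply/bn_fresh_seq => c Hc.
  by move: (Hf c Hc); rewrite /= mem_cat negb_or => /andP[].
- case: Hs2 => [[P' [Hs2 Hf1 ->]]|[M' [Hs2 _ ->]]|[? [? [? [? [? [//]]]]]]|[? [? [? [? [? [//]]]]]]].
  + exists cs, M, T', P'; split=> //; first by split=> //; [exact: ws_step Hs1|exact: ws_step Hs2].
    apply: step_comR _ Hs2 => //; last by apply: step_parR Hs1 _.
    move/bn_fresh_seq: Hf1 => Hf1 c Hc.
    by rewrite /= mem_cat negb_or Hf1 // Hf.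
  + have [x [b' [EM [EC Ea Eb] EM']]] := step_is_msg HM Hs2; subst.
    have Ecs := fset_seq_nil EC; subst cs.
    exists [::], (PGuard GNil), T', P; split=> //; first exact: nil_is_msg.
      by split=> //; exact: ws_step Hs1.
    apply: step_parL => //; apply: (@step_comL _ _ _ [::]) _ Hs1 => //; rewrite EC.
Qed.

Lemma obarb_par_rot M T P x : obarb (PPar (PPar M T) P) x <-> obarb (PPar T (PPar P M)) x.
Proof.
split=> -[C [b [Z /step_par_inv]]].
- case=> [[Z1 [/step_par_inv Hs Hf _]]|[P' [Hs Hf _]]|[? [? [? [? [? []]]]]]|[? [? [? [? [? []]]]]]] //.
    case: Hs => [[M' [Hs Hf' _]]|[T' [Hs Hf' _]]|[? [? [? [? [? []]]]]]|[? [? [? [? [? []]]]]]] //.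
      by exists C, b, (PPar T (PPar P M')); apply: step_parR => //; apply: step_parR.
    by exists C, b, (PPar T' (PPar P M)); apply: step_parL => //; exact: bn_fresh_cat.
  exists C, b, (PPar T (PPar P' M)).
  by apply: step_parR; [apply: step_parL => //; exact: bn_fresh_parl Hf|exact: bn_fresh_parr Hf].
- case=> [[T' [Hs Hf _]]|[Z1 [/step_par_inv Hs Hf _]]|[? [? [? [? [? []]]]]]|[? [? [? [? [? []]]]]]] //.
    exists C, b, (PPar (PPar M T') P).
    by apply: step_parL; [apply: step_parR => //; exact: bn_fresh_parr Hf|exact: bn_fresh_parl Hf].
  case: Hs => [[P' [Hs Hf' _]]|[M' [Hs Hf' _]]|[? [? [? [? [? []]]]]]|[? [? [? [? [? []]]]]]] //.
    by exists C, b, (PPar (PPar M T) P'); apply: step_parR => //; exact: bn_fresh_cat.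
  by exists C, b, (PPar (PPar M' T) P); apply: step_parL => //; apply: step_parL.
Qed.

Definition par_rotE Z1 Z2 := exists cs M T P, [/\ is_msg M,
  [/\ well_sorted M, well_sorted T & well_sorted P],
  Z1 = nus cs (PPar (PPar M T) P) & Z2 = nus cs (PPar T (PPar P M))].

Lemma par_rotE_sim : strong_half par_rotE.
Proof.
move=> Z1 Z2 [cs [M [T [P [HM [H1 H2 H3] -> ->]]]]].
have W1 : well_sorted (PPar (PPar M T) P) by do 2?apply: ws_par.
have W2 : well_sorted (PPar T (PPar P M)) by do 2?apply: ws_par.
split.
- move=> Z /step_tau_nus[//|Z' /par_rot_tau[//|cs' [M' [T' [P' [HM' [K1 K2 K3] -> Hs]]]]] ->].
  exists (nus cs (nus cs' (PPar T' (PPar P' M')))); first exact: step_tau_nus_intro.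
  by rewrite -!nus_cat; exists (cs ++ cs'), M', T', P'; split=> //; split; auto.
- by move=> x /obarb_nus[//|Hx /obarb_par_rot H]; apply: obarb_nus_intro.
- by move/seq_typed_par_rot.
Qed.

Lemma par_rotE_back : strong_half (fun A B => par_rotE B A).
Proof.
move=> Z2 Z1 [cs [M [T [P [HM [H1 H2 H3] -> ->]]]]].
have W1 : well_sorted (PPar (PPar M T) P) by do 2?apply: ws_par.
have W2 : well_sorted (PPar T (PPar P M)) by do 2?apply: ws_par.
split.
- move=> Z /step_tau_nus[//|Z' /par_rot_tau_back[//|cs' [M' [T' [P' [HM' [K1 K2 K3] -> Hs]]]]] ->].
  exists (nus cs (nus cs' (PPar (PPar M' T') P'))); first exact: step_tau_nus_intro.
  by rewrite -!nus_cat; exists (cs ++ cs'), M', T', P'; split=> //; split; auto.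
- by move=> x /obarb_nus[//|Hx /obarb_par_rot H]; apply: obarb_nus_intro.
- by move/seq_typed_par_rot.
Qed.

Lemma step_pad_inv P mu Z : step (PPar P (PGuard GNil)) mu Z ->
  exists2 P', step P mu P' & Z = PPar P' (PGuard GNil).
Proof.
case/step_par_inv=> [[P' [Hs _ ->]]|[Q' [/step_nil_inv //]]|
  [? [? [? [? [? [_ _ _ /step_nil_inv //]]]]]]|[? [? [? [? [? [_ _ _ /step_nil_inv //]]]]]]].
by exists P'.
Qed.

Lemma step_pad P mu P' : step P mu P' -> step (PPar P (PGuard GNil)) mu (PPar P' (PGuard GNil)).
Proof. by move=> Hs; apply: step_parL. Qed.

Definition padE Z1 Z2 := exists cs T P, [/\ well_sorted T, well_sorted P,
  Z1 = nus cs (PPar T (PPar P (PGuard GNil))) & Z2 = nus cs (PPar T P)].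

Lemma fn_pad P : fn (PPar P (PGuard GNil)) = fn P. Proof. by rewrite /= cats0. Qed.

Lemma bn_fresh_pad mu P : bn_fresh mu (PPar P (PGuard GNil)) <-> bn_fresh mu P.
Proof. by rewrite /bn_fresh fn_pad. Qed.

Lemma padE_sim : strong_half padE.
Proof.
move=> Z1 Z2 [cs [T [P [H1 H2 -> ->]]]].
have W1 : well_sorted (PPar T (PPar P (PGuard GNil))) by do 2?apply: ws_par.
have W2 : well_sorted (PPar T P) by apply: ws_par.
split.
- move=> Z /step_tau_nus[//|Z' /step_par_inv Hs ->].
  case: Hs => [[T' [Hs _ ->]]|[P0 [/step_pad_inv[P' Hs ->] _ ->]]|
    [cs' [a [b [T' [P0 [_ [Hu Hf] Hs1 /step_pad_inv[P' Hs2 ->] ->]]]]]]|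
    [cs' [a [b [T' [P0 [_ [Hu Hf] Hs1 /step_pad_inv[P' Hs2 ->] ->]]]]]]].
  + exists (nus cs (PPar T' P)); first by apply: step_tau_nus_intro => //; apply: step_parL.
    by exists cs, T', P; split=> //; exact: ws_step Hs H1.
  + exists (nus cs (PPar T P')); first by apply: step_tau_nus_intro => //; apply: step_parR.
    by exists cs, T, P'; split=> //; exact: ws_step Hs H2.
  + exists (nus cs (nus cs' (PPar T' P'))).
      apply: step_tau_nus_intro => //; apply: step_comL Hs1 Hs2 => //.
      by move=> c /Hf; rewrite fn_pad.
    rewrite -!nus_cat; exists (cs ++ cs'), T', P'; split=> //.
      exact: ws_step Hs1 H1.
    exact: ws_step Hs2 H2.
  + exists (nus cs (nus cs' (PPar T' P'))).
      by apply: step_tau_nus_intro => //; apply: step_comR Hs1 Hs2.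
    rewrite -!nus_cat; exists (cs ++ cs'), T', P'; split=> //.
      exact: ws_step Hs1 H1.
    exact: ws_step Hs2 H2.
- move=> x /obarb_nus[//|Hx [C [b [Z /step_par_inv Hs]]]]; apply: obarb_nus_intro => //.
  case: Hs => [[T' [Hs /bn_fresh_pad Hf _]]|[P0 [/step_pad_inv[P' Hs _] Hf _]]|[? [? [? [? [? []]]]]]|[? [? [? [? [? []]]]]]] //.
    by exists C, b, (PPar T' P); apply: step_parL.
  by exists C, b, (PPar T P'); apply: step_parR.
- by move/seq_typed_pad.
Qed.

Lemma padE_back : strong_half (fun A B => padE B A).
Proof.
move=> Z2 Z1 [cs [T [P [H1 H2 -> ->]]]].
have W1 : well_sorted (PPar T (PPar P (PGuard GNil))) by do 2?apply: ws_par.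
have W2 : well_sorted (PPar T P) by apply: ws_par.
split.
- move=> Z /step_tau_nus[//|Z' /step_par_inv Hs ->].
  case: Hs => [[T' [Hs _ ->]]|[P' [Hs _ ->]]|
    [cs' [a [b [T' [P' [_ [Hu Hf] Hs1 Hs2 ->]]]]]]|
    [cs' [a [b [T' [P' [_ [Hu Hf] Hs1 Hs2 ->]]]]]]].
  + exists (nus cs (PPar T' (PPar P (PGuard GNil)))).
      by apply: step_tau_nus_intro => //; apply: step_parL.
    by exists cs, T', P; split=> //; exact: ws_step Hs H1.
  + exists (nus cs (PPar T (PPar P' (PGuard GNil)))).
      by apply: step_tau_nus_intro => //; apply: step_parR => //; exact: step_pad.
    by exists cs, T, P'; split=> //; exact: ws_step Hs H2.
  + exists (nus cs (nus cs' (PPar T' (PPar P' (PGuard GNil))))).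
      apply: step_tau_nus_intro => //; apply: step_comL Hs1 (step_pad Hs2) => //.
      by move=> c /Hf; rewrite fn_pad.
    rewrite -!nus_cat; exists (cs ++ cs'), T', P'; split=> //.
      exact: ws_step Hs1 H1.
    exact: ws_step Hs2 H2.
  + exists (nus cs (nus cs' (PPar T' (PPar P' (PGuard GNil))))).
      by apply: step_tau_nus_intro => //; apply: step_comR Hs1 (step_pad Hs2).
    rewrite -!nus_cat; exists (cs ++ cs'), T', P'; split=> //.
      exact: ws_step Hs1 H1.
    exact: ws_step Hs2 H2.
- move=> x /obarb_nus[//|Hx [C [b [Z /step_par_inv Hs]]]]; apply: obarb_nus_intro => //.
  case: Hs => [[T' [Hs Hf _]]|[P' [Hs Hf _]]|[? [? [? [? [? []]]]]]|[? [? [? [? [? []]]]]]] //.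
    by exists C, b, (PPar T' (PPar P (PGuard GNil))); apply: step_parL => //; apply/bn_fresh_pad.
  by exists C, b, (PPar T (PPar P' (PGuard GNil))); apply: step_parR => //; exact: step_pad.
- by move/seq_typed_pad.
Qed.

Lemma weak_pad_inv P Z : weak (PPar P (PGuard GNil)) Z ->
  exists2 P', weak P P' & Z = PPar P' (PGuard GNil).
Proof.
move=> Hw; apply: (@weak_inv _ (fun Z => exists2 P', weak P P' & Z = PPar P' (PGuard GNil)) _ _ _ Hw).
  move=> Z1 Z2 [P' Hw' ->] /step_pad_inv[P2 Hs ->]; exists P2 => //.
  exact: weak_trans Hw' (weak_step1 Hs).
by exists P => //; exact: weak_refl.
Qed.

End Rearrange.

(** * Internal and input challenges *)

Section TauInput.
Variables (S : sorting) (s0 : srt S).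
Hypothesis s0_out : outc s0.
Implicit Types (P Q Z Y : proc S) (G H : guard S) (r : ref S) (eta : bool).
Implicit Types (a c x v w : name S) (mu : action S) (b cs X A : seq (name S)).
Local Notation bb := (@barbed_bisimilar S true).
Local Notation fl := (fl s0).

Lemma marks_sub w w' A A' : {subset A <= A'} -> marks w w' A' -> marks w w' A.
Proof.
by move=> HA [H1 H2 H3 H4]; split=> //; [apply: contra H3|apply: contra H4]; exact: HA.
Qed.

Lemma cs_ok_sub cs G G' A A' : {subset fn_guard G' <= fn_guard G} -> {subset A <= A'} ->
  cs_ok cs G A -> cs_ok cs G' A'.
Proof. by move=> HG HA H c Hc /HG/(H _ Hc)/HA. Qed.

Lemma marks_notin_cs w cs G A : w \notin A -> w \in fn_guard G -> cs_ok cs G A -> w \notin cs.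
Proof. by move=> HA HG H; apply/negP => Hc; move: HA; rewrite (H _ Hc HG). Qed.

Lemma fl_marks A m : idx_bound A <= m -> marks (fl m) (fl m.+1) A.
Proof.
move=> Hm; split; [by rewrite /= ltn_eqF|by rewrite !fl_out| |]; apply: fl_notin => //.
exact: leqW.
Qed.

(** No new layer is needed: the choice among the tests for the answers already works. Both its flags
    stay visible while [P] moves to [P'], so the answering side leaves it in place too and merely
    passes to a derivative of [Q], from which it separates [P']. *)
Lemma distinguishable_tau eta P Q P' l : ok P -> ok Q -> step P ATau P' ->
  (forall Q', weak Q Q' -> List.In Q' l) ->
  (forall Q', weak Q Q' -> distinguishable eta P' Q' \/ distinguishable eta Q' P') ->
  (eta -> ~ active P' -> forall Q', weak Q Q' -> active Q') ->
  distinguishable eta P Q.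
Proof.
move=> HokP HokQ Hs Hl Hd Hsil A; set X := fn P ++ fn Q.
have HX : all (@out_ctl S) X by rewrite all_cat (proj2 HokP) (proj2 HokQ).
have HokP' := ok_weak (weak_step1 Hs) HokP.
have HP'X : {subset fn P' <= X} by move=> c /(step_fn Hs); exact: sub_catl.
have HPX : {subset fn P <= X} by exact: sub_catl.
have HQX Q' : weak Q Q' -> {subset fn Q' <= X}.
  by move=> Hw c /(weak_fn Hw); exact: sub_catr.
have par_tau T cs : well_sorted (PGuard T) ->
    weak (nus cs (PPar (PGuard T) P)) (nus cs (PPar (PGuard T) P')).
  move=> HT; apply: weak_step1; apply: step_tau_nus_intro; last by apply: step_parR.
  by apply: ws_par => //; exact: (proj1 HokP).
case: (classic (acts eta P')) => [Ha|Hna].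
  have [|w [w' [H [[HT Hm] Hsep]]]] := choice_test (s0 := s0) s0_out (l := l) (A ++ X)
    HokP' Ha HP'X HX _ Hd.
    by move=> Q' Hw; split; [exact: ok_weak Hw HokQ|exact: HQX|exact: Hl].
  exists w, w', H; split.
    split=> //; apply: marks_sub Hm => c; rewrite !mem_cat => /orP[->//|->].
    by rewrite !orbT.
  move=> Q1 HwQ1 cs1 cs2 Hcs1 Hcs2 Hbb; set T := test _ _ _ _ _ in Hbb Hcs1 Hcs2 Hsep.
  have [Y HwY HbbY] := bb_weak Hbb (par_tau _ cs1 (proj1 HT)).
  have [ww' /andP[How How'] wA w'A] := Hm.
  case/notin_cat_inv: wA => /notin_cat_inv[wA wX] wH.
  case/notin_cat_inv: w'A => /notin_cat_inv[w'A w'X] w'H.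
  have wT : w \in fn_guard T by apply: (acts_fn H Ha HP'X); left.
  have w'T : w' \in fn_guard T by apply: (acts_fn H Ha HP'X); right.
  have Hb : ubarb Y w.
    apply: (bb_ubarb HbbY) => //; apply: (test_barb Ha HP'X (proj1 HokP') (proj1 HT)); first by left.
    exact: marks_notin_cs wA wT Hcs1.
  have Hb' : ubarb Y w'.
    apply: (bb_ubarb HbbY) => //; apply: (test_barb Ha HP'X (proj1 HokP') (proj1 HT)); first by right.
    exact: marks_notin_cs w'A w'T Hcs1.
  have HokQ1 := ok_weak HwQ1 HokQ.
  have [|Q2 HwQ2 EY] := unmoved (proj1 HT) (proj1 HokQ1) _ wT w'T HwY Hb Hb'.
    split=> //; first by rewrite How How'.
      by apply: notin_cat => //; apply/negP => /(HQX _ HwQ1); apply/negP.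
    by apply: notin_cat => //; apply/negP => /(HQX _ HwQ1); apply/negP.
  rewrite EY in HbbY.
  apply: (Hsep Q2 (weak_trans HwQ1 HwQ2) cs1 cs2 _ _ HbbY).
    by apply: cs_ok_sub Hcs1 => //; exact: sub_catl.
  by apply: cs_ok_sub Hcs2 => //; exact: sub_catl.
(* Now [P'] is silent and no flag can appear beside it, whereas every derivative of [Q] can still
   hand over its thread and raise one. *)
case: eta Hna Hsil Hd => Hna Hsil Hd; last by case: Hna.
have Hn : ~ active P' by move=> Ha; apply: Hna => _.
pose m := idx_bound (A ++ X); exists (fl m), (fl m.+1), GNil.
have HT : seq_typed false (PGuard (test true X (fl m) (fl m.+1) GNil)).
  by apply: (@seq_typed_test _ true) => //; try exact: fl_out; split=> //; exact: ty_nil.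
have [ww' _ wA w'A] : marks (fl m) (fl m.+1) (A ++ X) by exact: fl_marks.
split.
  split=> //; apply: (@marks_sub _ _ _ (A ++ X)); last exact: fl_marks.
  by rewrite cats0; exact: sub_catl.
move=> Q1 HwQ1 cs1 cs2 Hcs1 Hcs2 Hbb; set T := test _ _ _ _ _ in Hbb Hcs1 Hcs2 HT.
have [Y HwY HbbY] := bb_weak Hbb (par_tau _ cs1 (proj1 HT)).
have HnY i : ~ ubarb Y (fl i).
  move/(bb_ubarb (bb_sym HbbY) (fl_out s0_out i)).
  exact: (silent_no_barb HT (proj1 HokP') (proj2 HokP') Hn (fl_out s0_out i)).
have HokQ1 := ok_weak HwQ1 HokQ.
case/notin_cat_inv: wA => wA wX; case/notin_cat_inv: w'A => w'A w'X.
have HaQ Q2 : weak Q1 Q2 -> acts true Q2.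
  by move=> Hw _; apply: Hsil => //; exact: weak_trans HwQ1 Hw.
have Hfn Q2 : weak Q1 Q2 -> {subset fn Q2 <= X}.
  by move=> Hw; apply: HQX; exact: weak_trans HwQ1 Hw.
have wT : fl m \in fn_guard T.
  by apply: (acts_fn GNil (HaQ _ (weak_refl Q1)) (Hfn _ (weak_refl Q1))); left.
have w'T : fl m.+1 \in fn_guard T.
  by apply: (acts_fn GNil (HaQ _ (weak_refl Q1)) (Hfn _ (weak_refl Q1))); right.
case: (weak_context (proj1 HT) (proj1 HokQ1) HwY) => [[Q2 HwQ2 EY]|[Q2 [T1 [HwQ2 HsT _]]]|].
- apply: (HnY m); rewrite EY; apply: (test_barb (HaQ _ HwQ2) (Hfn _ HwQ2)).
  + exact: weak_ws HwQ2 (proj1 HokQ1).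
  + exact: (proj1 HT).
  + by left.
  + exact: marks_notin_cs wA wT Hcs2.
- case: (step_sum_inv HsT) => [/step_marker[_ /= [x [b //]]]|].
  exact: step_nil_inv.
- case=> Q2 [Q3 [C [a [b [T1 [HwQ2 Ho HC HsT Hw1]]]]]].
  (* An answer in which the thread has been taken already is excluded as well: a raised flag remains
     visible. *)
  have stays v : v \notin A -> v \notin X -> v \in fn_guard T -> T1 = flag v -> ubarb Y v.
    move=> vA vX vT E; subst T1; apply: (flag_stays Hw1).
    + exact: ws_step Ho (weak_ws HwQ2 (proj1 HokQ1)).
    + apply: (proj2 (comm_fresh Ho HC vT _)).
      by apply: contra vX; exact: Hfn.
    + apply: notin_cat; first exact: marks_notin_cs vA vT Hcs2.
      by apply/negP => /HC; rewrite vT.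
  case: (step_test HsT) => [E|E|].
  + exact: HnY (stays _ wA wX wT E).
  + exact: HnY (stays _ w'A w'X w'T E).
  + exact: step_nil_inv.
Qed.

(** Receiving the message of an input challenge leaves an inert component behind; separation is
    insensitive to it. *)
Lemma sep_pad G A P Q : well_sorted (PGuard G) -> well_sorted P ->
  sep G A P Q -> sep G A (PPar P (PGuard GNil)) Q.
Proof.
move=> HG HP Hsep cs1 cs2 H1 H2 Hbb; apply: (Hsep cs1 cs2 H1 H2).
by apply: (bb_strong (@padE_sim S) (@padE_back S) _ Hbb); exists cs1, (PGuard G), P.
Qed.

Lemma distinguishable_padl eta P Q : well_sorted P -> distinguishable eta P Q ->
  distinguishable eta (PPar P (PGuard GNil)) Q.
Proof.
move=> HP Hd A; have [w [w' [H [Ht Hsep]]]] := Hd A; exists w, w', H; rewrite fn_pad.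
by split=> // Q' HwQ; apply: sep_pad; [exact: (proj1 (proj1 Ht))|exact: HP|exact: Hsep].
Qed.

Lemma distinguishable_padr eta P Q : well_sorted P -> distinguishable eta Q P ->
  distinguishable eta Q (PPar P (PGuard GNil)).
Proof.
move=> HP Hd A; have [w [w' [H [Ht Hsep]]]] := Hd A; exists w, w', H; rewrite fn_pad.
split=> // Z /weak_pad_inv[P' HwP ->]; apply: sep_sym; apply: sep_pad.
- exact: (proj1 (proj1 Ht)).
- exact: weak_ws HwP HP.
- by apply: sep_sym; exact: Hsep.
Qed.

(** The new test makes an internal step to the message in parallel with the given test [T]. The
    message needs the thread, which the new test has as [P] and [Q] are of type 0; [T] is left with
    type 0, the right one beside processes that now hold the message. *)
Lemma distinguishable_input P Q x b : ok P -> ok Q ->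
  map (@nsort S) b = obj (nsort x) -> out_ctl x ->
  distinguishable true (PPar P (out_msg x b)) (PPar Q (out_msg x b)) ->
  distinguishable false P Q.
Proof.
set M := out_msg x b; move=> HokP HokQ Hb Hx Hd A.
have HM : well_sorted M by exact: sorted_msg.
have isM : is_msg M by right; exists x, b.
pose A1 := A ++ fn P ++ fn Q ++ fn M.
have [w [w' [H [[HT Hm] Hsep]]]] := Hd A1.
set X := _ ++ _ in HT Hsep; set T := test _ _ _ _ _ in HT Hsep.
pose m := idx_bound (A1 ++ fn_guard T); pose u := fl m; pose u' := fl m.+1.
pose R := test false (fn P ++ fn Q) u u' (GTau (PPar M (PGuard T))).
have [uu' /andP[Hou Hou'] uA1 u'A1] : marks u u' (A1 ++ fn_guard T) by exact: fl_marks.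
have HR : seq_typed true (PGuard R).
  apply: (@seq_typed_test _ false) => //; first by rewrite all_cat (proj2 HokP) (proj2 HokQ).
  split; first by rewrite /well_sorted; apply/andP; split; [exact: HM|exact: (proj1 HT)].
  by apply: ty_tau; apply: (@ty_par _ _ true true false) => //; [exact: typed_msg|exact: (proj2 HT)].
exists u, u', (GTau (PPar M (PGuard T))); split.
  split=> //; apply: (@marks_sub _ _ _ (A1 ++ fn_guard T)); last exact: fl_marks.
  rewrite [fn_guard _](_ : _ = fn M ++ fn_guard T) // => c.
  rewrite mem_cat => /orP[HcA|]; first by do 2![apply: sub_catl].
  rewrite mem_cat => /orP[HcM|HcT]; last exact: sub_catr.
  by apply: sub_catl; do 3![apply: sub_catr].
move=> Q1 HwQ1 cs1 cs2 Hcs1 Hcs2 Hbb; rewrite -/R in Hcs1 Hcs2 Hbb.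
have HokQ1 := ok_weak HwQ1 HokQ.
have TR : {subset fn_guard T <= fn_guard R}.
  by move=> c Hc; apply: sub_catr; apply: sub_catr.
have [Y HwY HbbY] : exists2 Y, weak (nus cs2 (PPar (PGuard R) Q1)) Y
    & bb (nus cs1 (PPar (PPar M (PGuard T)) P)) Y.
  apply: bb_weak Hbb _; apply: weak_step1; apply: step_tau_nus_intro.
    by apply: ws_par; [exact: (proj1 HR)|exact: (proj1 HokP)].
  by apply: step_parL => //; apply: step_sumR; exact: step_tau.
have HaPM Q0 : acts true (PPar Q0 M).
  move=> _; exists x, (PPar Q0 M); first exact: weak_refl.
  by exists fset0, b, (PPar Q0 (PGuard GNil)); apply: step_parR => //; exact: step_out.
have HrE cs Q0 : well_sorted Q0 -> par_rotE (nus cs (PPar (PPar M (PGuard T)) Q0))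
    (nus cs (PPar (PGuard T) (PPar Q0 M))).
  by move=> H0; exists cs, M, (PGuard T), Q0; split=> //; split=> //; exact: (proj1 HT).
have Hbbr : bb (nus cs1 (PPar (PGuard T) (PPar P M))) Y.
  exact: (bb_strong (@par_rotE_sim S) (@par_rotE_back S) (HrE cs1 P (proj1 HokP)) HbbY).
have HPX : {subset fn (PPar P M) <= X} by exact: sub_catl.
have HQX : {subset fn (PPar Q M) <= X} by exact: sub_catr.
have [ww' /andP[How How'] wA w'A] := Hm.
have wT : w \in fn_guard T by apply: (acts_fn H (HaPM P) HPX); left.
have w'T : w' \in fn_guard T by apply: (acts_fn H (HaPM P) HPX); right.
have notA v : v \notin A1 ++ fn_guard H -> [/\ v \notin A, v \notin fn Q, v \notin fn M & v \notin fn_guard H].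
  case/notin_cat_inv=> /notin_cat_inv[? /notin_cat_inv[_ /notin_cat_inv[? ?]]] ?.
  by split.
have [wA' wQ wM wH] := notA _ wA; have [w'A' w'Q w'M w'H] := notA _ w'A.
have barbs Y' : bb (nus cs1 (PPar (PGuard T) (PPar P M))) Y' -> ubarb Y' w /\ ubarb Y' w'.
  move=> HY'; have HPM : well_sorted (PPar P M) by apply: ws_par => //; exact: (proj1 HokP).
  split; apply: (bb_ubarb HY') => //.
    apply: (test_barb (HaPM P) HPX HPM (proj1 HT)); first by left.
    exact: marks_notin_cs wA' (TR _ wT) Hcs1.
  apply: (test_barb (HaPM P) HPX HPM (proj1 HT)); first by right.
  exact: marks_notin_cs w'A' (TR _ w'T) Hcs1.
have [HbY HbY'] := barbs _ Hbbr.
have w_lt : w.2 < m by apply: idx_bound_lt; exact: sub_catr.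
have wu : w.2 != u.2 by rewrite ltn_eqF.
have wu' : w.2 != u'.2 by rewrite ltn_eqF // leqW.
case: (weak_context (proj1 HR) (proj1 HokQ1) HwY) =>
  [[Q2 HwQ2 EY]|[Q2 [T1 [HwQ2 HsT Hw1]]]|[Q2 [Q3 [C [a [c [T1 [_ _ _ HsT _]]]]]]]].
(* An unmoved [R] would show [u], which has disappeared on the other side. *)
- have : ubarb Y u.
    rewrite EY; apply: test_barb => //.
    + by move=> c /(weak_fn HwQ2)/(weak_fn HwQ1); exact: sub_catr.
    + exact: weak_ws HwQ2 (proj1 HokQ1).
    + exact: (proj1 HR).
    + by left.
    + apply: marks_notin_cs Hcs2.
        by case/notin_cat_inv: uA1 => /notin_cat_inv[].
      apply: (@acts_fn _ false Q2 (fn P ++ fn Q)); [by []| |by left].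
      by move=> d /(weak_fn HwQ2)/(weak_fn HwQ1); exact: sub_catr.
  move/(bb_ubarb (bb_sym HbbY) Hou)/ubarb_fn; rewrite fn_nus => /andP[_].
  rewrite [fn (PPar (PPar _ _) _)](_ : _ = (fn M ++ fn_guard T) ++ fn P) //.
  case/notin_cat_inv: uA1 => /notin_cat_inv[_ /notin_cat_inv[uP /notin_cat_inv[_ uM]]] uT.
  by apply/negP; do 2![apply: notin_cat => //].
- have wQ2 : w \notin fn Q2 by apply: contra wQ => /(weak_fn HwQ2)/(weak_fn HwQ1).
  case: (step_test HsT) => [E|E|/step_gtau_inv[_ E]]; subst T1.
  + by apply: (no_barb Hw1 _ wQ2) HbY; apply: flag_notin.
  + by apply: (no_barb Hw1 _ wQ2) HbY; apply: flag_notin.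
  + have HQ2 := weak_ws HwQ2 (proj1 HokQ1).
    (* The rest of the run is replayed after regrouping, where [unmoved] applies to [T] beside
       [PPar Q2 M]. *)
    have [Y' HwY' EY'] := strong_half_weak (@par_rotE_sim S) (HrE cs2 Q2 HQ2) Hw1.
    have HbbY' : bb (nus cs1 (PPar (PGuard T) (PPar P M))) Y'.
      apply: bb_sym; exact: (bb_strong (@par_rotE_sim S) (@par_rotE_back S) EY' (bb_sym Hbbr)).
    have [Hb1 Hb1'] := barbs _ HbbY'.
    have HQ2M : well_sorted (PPar Q2 M) by apply: ws_par.
    have w'Q2 : w' \notin fn Q2 by apply: contra w'Q => /(weak_fn HwQ2)/(weak_fn HwQ1).
    have [|Q5 HwQ5 EQ5] := unmoved (proj1 HT) HQ2M _ wT w'T HwY' Hb1 Hb1'.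
      split=> //; first by rewrite How How'.
        by do 2![apply: notin_cat => //].
      by do 2![apply: notin_cat => //].
    rewrite EQ5 in HbbY'; apply: (Hsep Q5 _ cs1 cs2 _ _ HbbY').
    * apply: weak_trans HwQ5; apply: weak_parL; exact: weak_trans HwQ1 HwQ2.
    * by apply: cs_ok_sub Hcs1 => //; exact: sub_catl.
    * by apply: cs_ok_sub Hcs2 => //; exact: sub_catl.
- by case: (step_sum_inv HsT) => [/step_marker[_ /=]|/step_gtau_inv[]].
Qed.

End TauInput.

(** * Renaming extruded names *)

Section Abstraction.
Variable S : sorting.
Implicit Types (P Q : proc S) (b : seq (name S)) (C : {fset name S}) (c : name S).

(** A test that mentions the extruded names [C] becomes the body of an input that receives them:
    each is replaced by its first position in [b], so that opening with [b] restores the test. *)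
Definition abs_ref C b (k : nat) (r : ref S) : ref S :=
  if r is Free c then if c \in C then Bound k (index c b) else r else r.

Lemma abs_sort C b : {in C, forall c, c \in b} -> forall Gamma r s,
  sort_of (Gamma ++ [::]) r = Some s ->
  sort_of (Gamma ++ [:: map (@nsort S) b]) (abs_ref C b (size Gamma) r) = Some s.
Proof.
move=> HC Gamma [c|d p] s; rewrite cats0; last first.
  exact: (@sort_of_weaken _ _ _ (Bound d p)).
move=> [<-] /=; case: ifP => //= Hc; rewrite nth_cat ltnn subnn /= onth_map.
by rewrite onth_index //; exact: HC.
Qed.

Lemma instantiate_abs C b P : {in C, forall c, c \in b} -> well_sorted P ->
  instantiate b (map_proc (abs_ref C b) 0 P) = P.
Proof.
move=> HC HP; rewrite /instantiate (proj1 (map_proc_guard_comp _ _)).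
rewrite -[RHS](proj1 (map_proc_guard_id (f := fun _ r => r) _) P 0) //.
apply: (proj1 (@eq_map_sorted _ _ [::] _ _) P [::]) => // Gamma [c|d p] s /=.
  by case: ifP => //= Hc _; rewrite eqxx onth_index //; exact: HC.
rewrite cats0; case: eqP => // ->; rewrite nth_default //; by case: p.
Qed.

Lemma fn_abs C b P k c : (c \in fn (map_proc (abs_ref C b) k P)) = (c \in fn P) && (c \notin C).
Proof.
apply/idP/andP => [|[Hc HcC]].
  have [|H _] := @fn_map_sub _ (abs_ref C b) [pred c | c \notin C] xpred0; last first.
    by move/H; rewrite orbF => /andP[].
  move=> k' [a|d p] a' //=; case: ifP => //= Ha; rewrite !inE => /eqP ->.
  by rewrite eqxx Ha.
apply: (proj1 (@fn_map_sup _ (abs_ref C b) c _)) => // k' [a|d p] //=.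
by rewrite inE => /eqP <-; rewrite (negPf HcC) /= inE.
Qed.

End Abstraction.

(** * Aligning the objects of two outputs *)

Section Alignment.
Variable S : sorting.
Implicit Types (P Q K : proc S) (b N C : seq (name S)) (c x : name S).

Lemma weak_ren (h : name S -> name S) P P' : injective h -> (forall c, nsort (h c) = nsort c) ->
  weak P P' -> weak (ren h P) (ren h P').
Proof.
move=> hi hs Hw; elim/weak_ind: Hw => [P0|P0 P1 P2 Hs _ IH]; first exact: weak_refl.
apply: weak_trans IH; apply: weak_step1; exact: (step_ren hi hs Hs).
Qed.

(* The positions where [b] and [b1] differ hold extruded names only; these are
   swapped from left to right, [k] being the length of the prefix already done. *)
Lemma align_output K N b x Q1 :
  {in b, forall c, c \notin N -> c \notin fn K} -> {subset fn Q1 <= N} ->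
  forall n k b1 C1 Q2 Q3, (k + n = size b)%N ->
  map (@nsort S) b1 = map (@nsort S) b ->
  step Q1 (AOut [fset c in C1] x b1) Q2 -> weak Q2 Q3 ->
  {in C1, forall c, c \notin N /\ c \notin fn K} ->
  (forall i j, i < size b -> j < size b ->
     (nth x b i == nth x b j) = (nth x b1 i == nth x b1 j)) ->
  (forall i c, i < size b -> c \in N -> (nth x b i == c) = (nth x b1 i == c)) ->
  (forall i, i < k -> nth x b i = nth x b1 i) ->
  exists C2 Q2' Q3', [/\ step Q1 (AOut [fset c in C2] x b) Q2', weak Q2' Q3',
    nus C1 (PPar (instantiate b1 K) Q3) = nus C2 (PPar (instantiate b K) Q3')
    & {in C2, forall c, c \notin N /\ c \notin fn K}].
Proof.
move=> HbK HQ1; elim=> [|n IH] k b1 C1 Q2 Q3 Hk Hsort Hs Hw HC1 Hpat HpatN Hag.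
  have Eb : b = b1.
    apply: (@eq_from_nth _ x); first by move/(congr1 size): Hsort; rewrite !size_map.
    by move=> i Hi; apply: Hag; lia.
  by subst b1; exists C1, Q2, Q3.
have Hkb : k < size b by lia.
have Hsz : size b1 = size b by move/(congr1 size): Hsort; rewrite !size_map.
set p := nth x b k; set q := nth x b1 k.
case: (p =P q) => [Epq|pq].
  apply: (IH k.+1 b1 C1 Q2 Q3) => //; first by lia.
  by move=> i; rewrite ltnS leq_eqVlt => /orP[/eqP ->//|]; exact: Hag.
(* Position [k] of both lists compares equally with every known name; if [p] or [q] were known, they
   would coincide. *)
have pN : p \notin N by apply/negP => HN; have := HpatN k p Hkb HN; rewrite eqxx => /esym/eqP E; apply: pq.
have qN : q \notin N by apply/negP => HN; have := HpatN k q Hkb HN; rewrite eqxx => /eqP E; apply: pq.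
have pb : p \in b by apply: mem_nth.
have qb1 : q \in b1 by apply: mem_nth; rewrite Hsz.
have [Hx HC Hb Hf] := step_fn Hs.
have qC : q \in C1.
  by case: (Hb _ qb1) => [/HQ1|]; rewrite ?(negPf qN) // in_fset_seq.
have pK : p \notin fn K by apply: HbK.
have qK : q \notin fn K by case: (HC1 _ qC).
have spq : nsort p = nsort q.
  have : nth (nsort x) (map (@nsort S) b) k = nth (nsort x) (map (@nsort S) b1) k by rewrite Hsort.
  by rewrite !(nth_map x) ?Hsz.
pose h := swap p q; have hi : injective h by exact: swap_inj.
have hs c : nsort (h c) = nsort c by exact: swap_sort.
have hN c : c \in N -> h c = c.
  by move=> HN; apply: swap_id; apply: contraTneq HN => ->.
have pQ1 : p \notin fn Q1 by apply/negP => /HQ1; apply/negP.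
have qQ1 : q \notin fn Q1 by apply/negP => /HQ1; apply/negP.
have Hs' : step Q1 (AOut [fset c in map h C1] x (map h b1)) (ren h Q2).
  by have := step_ren hi hs Hs; rewrite (ren_swap_fresh pQ1 qQ1) /= imfset_seq hN //; exact: HQ1.
(* [q] is restricted, and [p] is either restricted or does not occur, so the swap only renames bound
   names. *)
have EZ : nus C1 (PPar (instantiate b1 K) Q3) =
          nus (map h C1) (PPar (instantiate (map h b1) K) (ren h Q3)).
  have Er : ren h (nus C1 (PPar (instantiate b1 K) Q3)) = nus C1 (PPar (instantiate b1 K) Q3).
    apply: ren_swap_fresh; rewrite fn_nus ?qC //.
    case: (boolP (p \in C1)) => //= pC; rewrite mem_cat negb_or; apply/andP; split.
      apply/negP => /fn_instantiate; rewrite (negPf pK) /= => /Hb[|]; rewrite ?(negPf pQ1) //.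
      by rewrite in_fset_seq (negPf pC).
    by apply/negP => /(weak_fn Hw)/Hf[|]; rewrite ?(negPf pQ1) // in_fset_seq (negPf pC).
  rewrite -Er ren_nus // {1}/ren /= -/(ren h (instantiate b1 K)) -/(ren h Q3).
  by rewrite ren_instantiate (_ : ren h K = K) //; exact: ren_swap_fresh.
have nth_h i : i < size b -> nth x (map h b1) i = h (nth x b1 i).
  by move=> Hi; rewrite (nth_map x) ?Hsz.
rewrite EZ; apply: (IH k.+1 (map h b1) (map h C1) (ren h Q2) (ren h Q3)) => //.
- by lia.
- by rewrite -map_comp -Hsort; apply: eq_map => c; exact: hs.
- exact: weak_ren.
- move=> c /mapP[c' Hc' ->]; rewrite /h /swap; case: eqP => // _; case: eqP => // _.
  exact: HC1.
- by move=> i j Hi Hj; rewrite !nth_h // (inj_eq hi); exact: Hpat.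
- by move=> i c Hi Hc; rewrite nth_h // -{2}(hN c Hc) (inj_eq hi); exact: HpatN.
- move=> i; rewrite ltnS leq_eqVlt => /orP[/eqP ->|Hi].
    by rewrite nth_h // /h swapR.
  have Hib : i < size b by apply: ltn_trans Hkb.
  (* The swap leaves the finished prefix alone: there both lists agree, and a [p] or [q] in it would
     by the common pattern of equalities force [p = q]. *)
  have EH := Hpat i k Hib Hkb; rewrite -(Hag i Hi) -/p -/q in EH.
  rewrite nth_h // -(Hag i Hi) /h swap_id //; apply/eqP => E; rewrite E eqxx in EH.
    by apply: pq; apply/eqP; rewrite -EH.
  by apply: pq; apply/eqP; rewrite eq_sym EH.
Qed.

End Alignment.

(** * Output challenges *)

Section Output.
Variables (S : sorting) (s0 : srt S).
Implicit Types (P Q Z Y : proc S) (G H : guard S) (r : ref S) (eta : bool).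
Implicit Types (a c d x v w z : name S) (mu : action S) (b cs X A : seq (name S)).
Local Notation bb := (@barbed_bisimilar S true).
Local Notation fl := (fl s0).

(* Matching is typed at 0, so the thread is parked at [z] while it is tested. *)
Definition eq_test z r1 r2 v : proc S :=
  PPar (flag z) (PGuard (GMatch r1 r2 (GIn (Free z) (obj (nsort z)) (flag v)))).

Lemma fn_eq_test z r1 r2 v c : c \in fn (eq_test z r1 r2 v) ->
  [\/ c.2 = z.2, c.2 = v.2 | c \in fn_ref r1 ++ fn_ref r2].
Proof.
rewrite /= !mem_cat inE orbA => /or3P[/orP[/fn_flag|H1]|H2|/orP[/eqP ->|/fn_flag]].
- by move=> ->; apply: Or31.
- by apply: Or33; rewrite H1.
- by apply: Or33; rewrite H2 orbT.
- by apply: Or31.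
- by move=> ->; apply: Or32.
Qed.

Lemma sorted_eq_test Gamma z r1 r2 v : isSome (sort_of Gamma r1) -> isSome (sort_of Gamma r2) ->
  sorted_proc Gamma (eq_test z r1 r2 v).
Proof. by move=> /= -> ->; rewrite !sorted_flag eqxx. Qed.

Lemma typed_eq_test Gamma z r1 r2 v : out_ctl z -> out_ctl v ->
  typed Gamma true (eq_test z r1 r2 v).
Proof.
move=> Hz Hv; apply: (@ty_par _ _ true true false) => //; first exact: typed_flag.
by apply: ty_match; apply: ty_in_out; [exists (nsort z)|exact: typed_flag].
Qed.

Lemma step_eq_test_inv z d1 d2 v mu Z : d1 <> d2 ->
  step (eq_test z (Free d1) (Free d2) v) mu Z -> exists b, mu = AOut fset0 z b.
Proof.
move=> dd; have stuck mu' Z' :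
    ~ step (PGuard (GMatch (Free d1) (Free d2) (GIn (Free z) (obj (nsort z)) (flag v)))) mu' Z'.
  by move=> Hs; inversion Hs.
case/step_par_inv=> [[Z1 [Hs _ _]]|[Z1 [/stuck //]]|
  [? [? [? [? [? [_ _ _ /stuck //]]]]]]|[? [? [? [? [? [_ _ _ /stuck //]]]]]]].
by move: Hs; rewrite flagE => /step_msg_inv[-> _]; eexists.
Qed.

(** The matching is stuck, and the message at [z] finds no receiver because [Q] does not know
    [z]. *)
Lemma eq_test_dead z d1 d2 v Q cs Y : d1 <> d2 -> z != v -> well_sorted Q ->
  z \notin fn Q -> v \notin fn Q ->
  weak (nus cs (PPar (eq_test z (Free d1) (Free d2) v) Q)) Y -> ~ obarb Y v.
Proof.
move=> dd zv HQ HzQ HvQ Hw; set E := eq_test _ _ _ _ in Hw *.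
have HE : well_sorted E by exact: sorted_eq_test.
have [|Z HwZ ->] := weak_nus _ Hw; first exact: ws_par.
have [Q' [HQ' HzQ' HvQ' EZ]] : exists Q', [/\ well_sorted Q', z \notin fn Q',
    v \notin fn Q' & Z = PPar E Q'].
  apply: (@weak_inv _ (fun Z => exists Q', [/\ well_sorted Q', z \notin fn Q',
    v \notin fn Q' & Z = PPar E Q']) _ _ _ HwZ); last by exists Q.
  move=> Z1 Z2 [Q1 [H1 H2 H3 ->]] /step_par_inv.
  case=> [[Z' [/(step_eq_test_inv dd)[b //]]]|[Q' [Hs _ ->]]|
    [C [a [b [Z' [Q' [_ _ /(step_eq_test_inv dd)[b' [_ Ea _]] Hs2 _]]]]]]|
    [C [a [b [Z' [Q' [_ _ /(step_eq_test_inv dd)[b' //]]]]]]]].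
    exists Q'; split=> //; first exact: ws_step Hs H1.
      by apply: contra H2; exact: (step_fn Hs).
    by apply: contra H3; exact: (step_fn Hs).
  by subst a; have [Hin _] := step_fn Hs2; rewrite Hin in H2.
subst Z => /obarb_nus[|_ [C [b [Z1 /step_par_inv]]]]; first exact: ws_par.
case=> [[Z' [/(step_eq_test_inv dd)[b' [_ Ev _]] _ _]]|[Q2 [Hs _ _]]|[? [? [? [? [? []]]]]]|[? [? [? [? [? []]]]]]] //.
  by rewrite Ev eqxx in zv.
by have [Hin _ _ _] := step_fn Hs; rewrite Hin in HvQ'.
Qed.

Lemma eq_test_alive z d v Q : ubarb (PPar (eq_test z (Free d) (Free d) v) Q) v.
Proof.
exists (PPar (PPar (PGuard GNil) (flag v)) Q); last first.
  exists fset0, (dummies v), (PPar (PPar (PGuard GNil) (PGuard GNil)) Q).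
  by apply: step_parL => //; apply: step_parR => //; rewrite flagE; exact: step_out.
apply: weak_step1; apply: step_parL => //.
apply: (@step_comL _ _ _ [::] z (dummies z)) => //.
  rewrite [[fset c in _]](_ : _ = fset0); last by apply/fsetP => c; rewrite !inE.
  by rewrite flagE; exact: step_out.
apply: step_match; rewrite -[X in step _ _ X](instantiate_flag (dummies z)).
by apply: step_in; exact: dummies_sort.
Qed.

Definition eq_branches z (prs : seq (ref S * ref S)) : seq (nat -> proc S) :=
  [seq (fun k => eq_test z pr.1 pr.2 (fl k)) | pr <- prs].

(** The sender has given its thread away, so the marker is the one for processes of type 0, which
    ignores its list of names; hence [[::]]. The summand for [flag z] closes the sum at type 1. *)
Definition kguard w w' P z m prs : guard S :=
  test false [::] w w' (GSum (GTau P) (gsum (GTau (flag z)) m (eq_branches z prs))).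

Definition open_pair b (pr : ref S * ref S) := (open_ref b 0 pr.1, open_ref b 0 pr.2).

Lemma instantiate_kguard b w w' P z m prs :
  instantiate b (PGuard (kguard w w' P z m prs)) =
  PGuard (kguard w w' (instantiate b P) z m (map (open_pair b) prs)).
Proof.
rewrite /instantiate /= !map_flag //; congr (PGuard (GSum _ (GSum _ _))).
elim: prs m => [|[r1 r2] prs IH] m /=; first by rewrite map_flag.
by rewrite !map_flag // IH.
Qed.

Lemma In_branches z prs F : List.In F (eq_branches z prs) ->
  exists2 pr, List.In pr prs & F = (fun k => eq_test z pr.1 pr.2 (fl k)).
Proof.
elim: prs => //= pr prs IH [<-|/IH[pr' H ->]]; first by exists pr => //; left.
by exists pr' => //; right.
Qed.

Lemma fn_branches z m prs c :
  c \in fn_guard (gsum (GTau (flag z)) m (eq_branches z prs)) ->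
  [\/ c.2 = z.2, m <= c.2 | exists2 pr, List.In pr prs & c \in fn_ref pr.1 ++ fn_ref pr.2].
Proof.
move=> Hin; case: (fn_gsum Hin) => [/fn_flag ->|[F [k [/In_branches[pr Hpr ->] Hk]]]].
  by apply: Or31.
case/fn_eq_test=> [->|->|H]; [by apply: Or31|by apply: Or32|by apply: Or33; exists pr].
Qed.

Lemma branches_flag z G0 m prs i pr : onth prs i = Some pr ->
  fl (m + i.*2) \in fn_guard (gsum G0 m (eq_branches z prs)).
Proof.
elim: prs m i => [|pr' prs IH] m [|i] //= Hi; rewrite mem_cat.
  by rewrite addn0 !(mem_cat, inE) flag_self !orbT.
by rewrite doubleS !addnS -!addSn IH ?orbT.
Qed.

Lemma step_branches z m prs mu T1 :
  step (PGuard (gsum (GTau (flag z)) m (eq_branches z prs))) mu T1 -> mu = ATau.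
Proof.
elim: prs m => [|pr prs IH] m /=; first by case/step_gtau_inv.
by case/step_sum_inv=> [/step_gtau_inv[]|/IH].
Qed.

Lemma step_kguard w w' P z m prs mu T1 : step (PGuard (kguard w w' P z m prs)) mu T1 ->
  mu = ATau.
Proof.
case/step_sum_inv=> [/step_marker[]//|].
by case/step_sum_inv=> [/step_gtau_inv[]|/step_branches].
Qed.

(** The flag [e] occurs in the branch of pair [i] and nowhere else, so it shows up only if this
    branch is taken and its matching succeeds. *)
Lemma kguard_barb w w' P z m prs i d1 d2 Q cs :
  let e := fl (m + i.*2) in
  well_sorted (PGuard (kguard w w' P z m prs)) -> well_sorted Q ->
  onth prs i = Some (Free d1, Free d2) ->
  z.2 < m -> w.2 < m -> w'.2 < m -> e \notin fn P -> e \notin fn Q -> z \notin fn Q ->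
  (forall pr, List.In pr prs -> e \notin fn_ref pr.1 ++ fn_ref pr.2) ->
  e \notin cs ->
  ubarb (nus cs (PPar (PGuard (kguard w w' P z m prs)) Q)) e <-> d1 = d2.
Proof.
move=> e HK HQ Hi Hz Hw Hw' HeP HeQ HzQ Hprs Hcs.
have ne k : k < m -> e.2 != k by move=> Hk; rewrite /e /=; lia.
have Hon : onth (eq_branches z prs) i = Some (fun k => eq_test z (Free d1) (Free d2) (fl k)).
  by rewrite onth_map Hi.
have [||Hs Huniq] := @gsum_branch_at _ s0 (GTau (flag z)) m _ _ i Hon.
- move=> j F' Hj ji; move: Hj; rewrite onth_map; case E: (onth prs j) => [pr|] //= [<-].
  apply/negP => /fn_eq_test[/eqP|/eqP|].
  + by rewrite (negPf (ne _ Hz)).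
  + by rewrite /=; lia.
  + by apply/negP; apply: Hprs; exact: onth_In E.
- by apply: flag_notin; exact: ne.
rewrite -/e in Hs Huniq; set K := kguard _ _ _ _ _ _ in HK *.
split=> [[Y HwY Hob]|E].
  apply: NNPP => dd; case: (weak_context HK HQ HwY).
  - case=> Q' HwQ EY; move: Hob; rewrite EY => /obarb_nus[|_ [C [b [Z /step_par_inv]]]].
      by apply: ws_par => //; exact: weak_ws HwQ HQ.
    case=> [[Z' [/guard_no_out //]]|[Q2 [Hs2 _ _]]|[? [? [? [? [? []]]]]]|[? [? [? [? [? []]]]]]] //.
    have [Hin _ _ _] := step_fn Hs2; move: HeQ; by rewrite (weak_fn HwQ Hin).
  - case=> Q1 [T1 [HwQ HsT Hw1]].
    have HeQ1 : e \notin fn Q1 by apply: contra HeQ; exact: (weak_fn HwQ).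
    have Hb : ubarb Y e by exists Y => //; exact: weak_refl.
    case: (step_test HsT) => [E|E|/step_sum_inv[/step_gtau_inv[_ E]|Hs1]]; try subst T1.
    + by apply: (no_barb Hw1 _ HeQ1) Hb; apply: flag_notin; exact: ne.
    + by apply: (no_barb Hw1 _ HeQ1) Hb; apply: flag_notin; exact: ne.
    + exact: (no_barb Hw1 HeP HeQ1) Hb.
    + case: (Huniq _ _ Hs1) => // [[_ E]|HeT]; last exact: (no_barb Hw1 HeT HeQ1) Hb.
      subst T1; apply: (eq_test_dead dd _ _ _ HeQ1 Hw1 Hob).
      * by apply/eqP => Ez; move: (ne _ Hz); rewrite Ez eqxx.
      * exact: weak_ws HwQ HQ.
      * by apply: contra HzQ; exact: (weak_fn HwQ).
  - by case=> Q1 [Q2 [C [a [b [T1 [_ _ _ /step_kguard]]]]]].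
subst d2; apply: ubarb_nus_intro => //; first exact: ws_par.
apply: ubarb_weak (eq_test_alive z d1 e Q); apply: weak_step1; apply: step_parL => //.
by apply: step_sumR; apply: step_sumR.
Qed.

End Output.

(** * The test for an output challenge *)

Section OutputChallenge.
Variables (S : sorting) (s0 : srt S).
Hypothesis s0_out : outc s0.
Implicit Types (P Q Z Y : proc S) (G H : guard S) (r : ref S) (eta : bool).
Implicit Types (a c d x v w z : name S) (mu : action S) (b cs X A : seq (name S)).
Local Notation bb := (@barbed_bisimilar S true).
Local Notation fl := (fl s0).

(** The comparisons stand directly under the receiving prefix, so its parameters have depth 0; the
    second component codes a position ([inl]) or a known name ([inr]). *)
Definition eq_ref (p : nat * (nat + name S)) : ref S * ref S :=
  (Bound 0 p.1, match p.2 with inl j => Bound 0 j | inr a => Free a end).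

Definition eq_positions (n : nat) X : seq (nat * (nat + name S)) :=
  [seq (i, t) | i <- iota 0 n, t <- map inl (iota 0 n) ++ map inr X].

Definition eq_pairs n X : seq (ref S * ref S) := map eq_ref (eq_positions n X).

Lemma eq_positions_pos n X i j : i < n -> j < n -> (i, inl j) \in eq_positions n X.
Proof.
move=> Hi Hj; apply: allpairs_f; first by rewrite mem_iota.
by rewrite mem_cat map_f // mem_iota.
Qed.

Lemma eq_positions_name n X i a : i < n -> a \in X -> (i, inr a) \in eq_positions n X.
Proof.
move=> Hi Ha; apply: allpairs_f; first by rewrite mem_iota.
by rewrite mem_cat map_f // orbT.
Qed.

Lemma eq_positions_inv n X p : p \in eq_positions n X ->
  p.1 < n /\ match p.2 with inl j => j < n | inr a => a \in X end.
Proof.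
case/allpairsP=> -[i t] /= [Hi Ht ->] /=; rewrite mem_iota in Hi; split=> //.
move: Ht; rewrite mem_cat => /orP[/mapP[j Hj ->]|/mapP[a Ha ->]] //.
by rewrite mem_iota in Hj.
Qed.

Lemma In_eq_pairs n X pr : List.In pr (eq_pairs n X) ->
  exists2 p, p \in eq_positions n X & pr = eq_ref p.
Proof.
rewrite /eq_pairs; elim: (eq_positions n X) => //= p ps IH [<-|/IH[p' Hp ->]].
  by exists p; rewrite ?mem_head.
by exists p' => //; rewrite inE Hp orbT.
Qed.

Lemma onth_eq_pairs n X b p : p \in eq_positions n X ->
  onth (map (open_pair b) (eq_pairs n X)) (index p (eq_positions n X)) =
  Some (open_pair b (eq_ref p)).
Proof. by move=> Hp; rewrite onth_map onth_map onth_index. Qed.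

Lemma open_bound b x i : i < size b -> open_ref b 0 (Bound 0 i) = Free (nth x b i).
Proof.
move=> Hi /=; case E: (onth b i) => [c|]; first by rewrite (onth_nth x c b i E).
by have := onthTE b i; rewrite E Hi.
Qed.

Lemma fn_open_pair b n X pr : List.In pr (map (open_pair b) (eq_pairs n X)) -> n = size b ->
  {subset fn_ref pr.1 ++ fn_ref pr.2 <= b ++ X}.
Proof.
move=> + En; have : forall pr', List.In pr' (eq_pairs n X) -> exists2 p,
    p \in eq_positions n X & pr' = eq_ref p by exact: In_eq_pairs.
elim: (eq_pairs n X) => //= pr' prs IH Hall [E|]; last by apply: IH => pr'' H; apply: Hall; right.
have [|p Hp Epr] := Hall pr'; first by left.
have [H1 H2] := eq_positions_inv Hp; move: E; rewrite {}Epr => <- c.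
have inb i (x : name S) : i < n -> c \in fn_ref (open_ref b 0 (Bound 0 i)) -> c \in b ++ X.
  move=> Hi; rewrite (@open_bound b x) -?En //= inE => /eqP ->.
  by rewrite mem_cat mem_nth // -En.
rewrite mem_cat => /orP[|]; first exact: (inb _ c H1).
rewrite {1}/eq_ref /open_pair; case: p.2 H2 => [j|a] H2; first exact: (inb _ c H2).
by rewrite /= inE => /eqP ->; rewrite mem_cat H2 orbT.
Qed.

(** The comparison flags visible on the two sides must coincide, so the objects of the answer have
    the same pattern of equalities as [b]. Aligned by swaps, they become [b], the extruded names
    become [C], and the answer is a weak transition with the very label of the challenge. The inner
    test [T1], abstracted from [C], takes over. *)
Lemma distinguishable_output P Q C x b P' l : ok P -> ok Q ->
  step P (AOut C x b) P' -> {in C, forall c, c \notin fn Q} -> all (@out_ctl S) b ->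
  (forall Q', weak_step Q (AOut C x b) Q' -> List.In Q' l) ->
  (forall Q', weak_step Q (AOut C x b) Q' ->
     distinguishable false P' Q' \/ distinguishable false Q' P') ->
  distinguishable true P Q.
Proof.
move=> HokP HokQ Hs HCQ Hbo Hl Hd A; set X := fn P ++ fn Q.
have HX : all (@out_ctl S) X by rewrite all_cat (proj2 HokP) (proj2 HokQ).
have [xP HC Hb Hf'] := step_fn Hs.
have Hss := step_obj_sorts Hs (proj1 HokP).
have HCb : {in C, forall c, c \in b} by move=> c /HC[].
have HCX : {in C, forall c, c \notin X}.
  by move=> c Hc; apply: notin_cat; [case: (HC c Hc)|exact: HCQ].
have bC c : c \in b -> c \notin X -> c \in C.
  by move=> /Hb[H|//] /notin_cat_inv[]; rewrite H.
(* The names in [C] will be restricted in front of [T1], which may mention them; [cs_ok] permits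
   this only if they belong to [A1]. *)
pose X1 := X ++ b; pose A1 := A ++ X1.
have HX1 : all (@out_ctl S) X1 by rewrite all_cat HX Hbo.
have CX1 : {in C, forall c, c \in X1} by move=> c /HCb Hc; rewrite /X1 mem_cat Hc orbT.
have PX : {subset fn P <= X} by exact: sub_catl.
have QX : {subset fn Q <= X} by exact: sub_catr.
have XX1 : {subset X <= X1} by exact: sub_catl.
have P'X1 : {subset fn P' <= X1} by move=> c /Hf'[/PX/XX1|/CX1].
have ok_of Z : well_sorted Z -> {subset fn Z <= X1} -> ok Z.
  by move=> H1 H2; split=> //; apply/allP => c /H2; exact: (allP HX1).
have HokP' : ok P' by apply: ok_of => //; exact: ws_step Hs (proj1 HokP).
have DX1 Q' : weak_step Q (AOut C x b) Q' -> well_sorted Q' /\ {subset fn Q' <= X1}.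
  case=> Q1 [Q2 [Hw1 Hs1 Hw2]]; split.
    exact: weak_ws Hw2 (ws_step Hs1 (weak_ws Hw1 (proj1 HokQ))).
  have [_ _ _ Hf2] := step_fn Hs1.
  by move=> c /(weak_fn Hw2)/Hf2[/(weak_fn Hw1)/QX/XX1|/CX1].
have [//||w1 [w1' [H1 [[HT1 Hm1] Hsep1]]]] := choice_test s0_out (eta := false) (l := l) A1
  HokP' _ P'X1 HX1 _ Hd.
  by move=> Q' HD; have [? ?] := DX1 _ HD; split=> //; [exact: ok_of|exact: Hl].
set T1 := test false X1 w1 w1' H1 in HT1 Hsep1.
pose m := idx_bound (A1 ++ fn_guard T1).
have flA i : m <= i -> fl i \notin A1.
  by move=> Hi; apply: contra (@fl_notin _ s0 (A1 ++ fn_guard T1) i Hi); exact: sub_catl.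
have flT i : m <= i -> fl i \notin fn_guard T1.
  by move=> Hi; apply: contra (@fl_notin _ s0 (A1 ++ fn_guard T1) i Hi); exact: sub_catr.
have flX1 i : m <= i -> fl i \notin X1.
  by move=> Hi; apply: contra (flA i Hi); exact: sub_catr.
have idxA c : c \in A1 -> c.2 < m.
  by move=> Hc; apply: idx_bound_lt; exact: sub_catl.
have idxT c : c \in fn_guard T1 -> c.2 < m.
  by move=> Hc; apply: idx_bound_lt; exact: sub_catr.
clearbody m.
have X1A : {subset X1 <= A1} by exact: sub_catr.
(* The flags before and after reception occupy [m] to [m.+3] and the parking name [m.+4], so the
   comparison flags start at [m.+4.+1]. *)
pose u := fl m; pose u' := fl m.+1; pose w := fl m.+2; pose w' := fl m.+3.
pose z := fl m.+4; pose n := size b.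
pose Tp := map_proc (abs_ref C b) 0 (PGuard T1).
pose Kg := kguard s0 w w' Tp z m.+4.+1 (eq_pairs n X).
pose R := test true X u u' (GIn (Free x) (obj (nsort x)) (PGuard Kg)).
pose Kc (c : seq (name S)) := kguard s0 w w' (instantiate c Tp) z m.+4.+1
  (map (open_pair c) (eq_pairs n X)).
have EK b0 : instantiate b0 (PGuard Kg) = PGuard (Kc b0) by exact: instantiate_kguard.
have ETb : instantiate b Tp = PGuard T1 by apply: instantiate_abs => //; exact: (proj1 HT1).
have HoX : out_ctl x by apply: (allP (proj2 HokP)).
have HTp : sorted_proc [:: map (@nsort S) b] Tp.
  exact: (proj1 (map_proc_sorted (abs_sort HCb)) (PGuard T1) [::] (proj1 HT1)).
have KgS : sorted_proc [:: obj (nsort x)] (PGuard Kg).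
  rewrite -Hss; apply/andP; split; first exact: (@sorted_marker _ _ false [::] w w').
  apply/andP; split.
    exact: HTp.
  apply: sorted_gsum; first exact: sorted_flag.
  move=> F k /In_branches[pr /In_eq_pairs[p /eq_positions_inv[Hp1 Hp2] ->] ->].
  have Hbd i : i < n -> isSome (sort_of [:: [seq nsort c | c <- b]] (Bound 0 i)).
    by move=> Hi /=; rewrite onthTE size_map.
  case: p Hp1 Hp2 => i [j|a] Hi Hj; apply: sorted_eq_test => //; exact: Hbd.
have KgT : typed [:: obj (nsort x)] true (PGuard Kg).
  rewrite -Hss; apply: ty_sum.
    by apply: (@typed_marker _ _ false) => //; exact: fl_out.
  apply: ty_sum.
    apply: ty_tau; exact: (typed_map (abs_sort HCb) (Gamma := [::]) (proj2 HT1)).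
  apply: typed_gsum; first by apply: ty_tau; apply: typed_flag; exact: fl_out.
  by move=> F k /In_branches[pr _ ->]; apply: typed_eq_test; exact: fl_out.
have HR : seq_typed false (PGuard R).
  apply: (@seq_typed_test _ true) => //; try exact: fl_out.
  split; first by apply/andP; split=> //; exact: KgS.
  by apply: ty_in_out => //; exists (nsort x).
have fnTp c : c \in fn Tp -> c \in fn_guard T1 /\ c \notin C.
  by rewrite /Tp fn_abs => /andP[].
have fnBr c : c \in fn_guard (gsum (GTau (flag z)) m.+4.+1 (eq_branches s0 z (eq_pairs n X))) ->
    m.+4 <= c.2 \/ c \in X.
  case/fn_branches=> [->|H|[pr /In_eq_pairs[p /eq_positions_inv[_ Hp] ->]]]; [by left|left; move: H; (clear; lia)|].
  by rewrite /=; case: p.2 Hp => [j|a] //= Ha; rewrite inE => /eqP ->; right.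
have fnKg c : c \in fn_guard Kg -> [\/ m.+2 <= c.2, c \in fn Tp | c \in X].
  rewrite [fn_guard Kg](_ : _ = fn_guard (marker false [::] w w') ++ (fn Tp ++
    fn_guard (gsum (GTau (flag z)) m.+4.+1 (eq_branches s0 z (eq_pairs n X))))) //.
  rewrite mem_cat => /orP[/fn_marker[//|/fn_flag ->|/fn_flag ->]|]; try by apply: Or31 => /=.
  rewrite mem_cat => /orP[H|/fnBr[H|H]]; [by apply: Or32|by apply: Or31; move: H; (clear; lia)|by apply: Or33].
have ER : fn_guard R = fn_guard (marker true X u u') ++ (x :: fn_guard Kg) by [].
have CKg : {in C, forall c, c \notin fn_guard Kg}.
  move=> c Hc; apply/negP => /fnKg[H|/fnTp[_]|]; last by apply/negP; exact: HCX.
    by move: H (idxA _ (X1A _ (CX1 _ Hc))); (clear; lia).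
  by rewrite Hc.
have CR : {in C, forall c, c \notin fn_guard R}.
  move=> c Hc; rewrite ER; have cm := idxA _ (X1A _ (CX1 _ Hc)).
  apply: notin_cat.
    apply/negP => /fn_marker[|/fn_flag|/fn_flag]; first by apply/negP; exact: HCX.
      by move: cm; rewrite /=; (clear; lia).
    by move: cm; rewrite /=; (clear; lia).
  apply: notin_cons; last exact: CKg.
  by apply: contraTneq xP => <-; case: (HC c Hc).
have KgR : {subset fn_guard Kg <= fn_guard R}.
  by move=> c Hc; rewrite ER; apply: sub_catr; rewrite inE Hc orbT.
have XR : {subset X <= fn_guard R}.
  by move=> c Hc; rewrite ER; apply: sub_catl; exact: marker_supX.
have TpKg : {subset fn Tp <= fn_guard Kg}.
  by move=> c Hc; apply: sub_catr; apply: sub_catl.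
have wKg : w \in fn_guard Kg by apply: sub_catl; apply: (@marker_has _ false [::]) => //; left.
have w'Kg : w' \in fn_guard Kg by apply: sub_catl; apply: (@marker_has _ false [::]) => //; right.
have zKg : z \in fn_guard Kg.
  apply: sub_catr; apply: sub_catr; elim: (eq_pairs n X) m.+4.+1 => [|pr prs IH] k.
    exact: flag_self.
  by apply: sub_catr; exact: IH.
have eKg p : p \in eq_positions n X ->
    fl (m.+4.+1 + (index p (eq_positions n X)).*2) \in fn_guard Kg.
  move=> Hp; apply: sub_catr; apply: sub_catr; apply: (@branches_flag _ _ _ _ _ _ _ (eq_ref p)).
  by rewrite onth_map onth_index.
exists u, u', (GIn (Free x) (obj (nsort x)) (PGuard Kg)); split.
  split=> //; split; [by rewrite /=; (clear; lia)|by rewrite !fl_out| |]; apply: notin_cat.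
  - by apply: contra (flA m (leqnn m)); exact: sub_catl.
  - apply: notin_cons; first by apply: contraNneq (flX1 m (leqnn m)) => E; rewrite -/u E; exact/XX1/PX.
    apply/negP => /fnKg[|/fnTp[/idxT]|/XX1]; [by rewrite /=; (clear; lia)|by rewrite ltnn|].
    exact/negP/flX1.
  - by apply: contra (flA m.+1 (leqnSn m)); exact: sub_catl.
  - apply: notin_cons; first by apply: contraNneq (flX1 m.+1 (leqnSn m)) => E; rewrite -/u' E; exact/XX1/PX.
    apply/negP => /fnKg[|/fnTp[/idxT]|/XX1]; [by rewrite /=; (clear; lia)|by rewrite /=; (clear; lia)|].
    by apply/negP/flX1.
move=> Q1 HwQ1 cs1 cs2 Hcs1 Hcs2 Hbb; rewrite -/R in Hcs1 Hcs2 Hbb.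
have csA cs c : cs_ok cs R A -> c \notin A -> c \in fn_guard R -> c \notin cs.
  by move=> Hcs HcA HcR; exact: marks_notin_cs HcA HcR Hcs.
have flA' i : m <= i -> fl i \notin A.
  by move=> Hi; apply: contra (flA i Hi); exact: sub_catl.
have HokQ1 := ok_weak HwQ1 HokQ.
have HQ1X : {subset fn Q1 <= X} by move=> c /(weak_fn HwQ1)/QX.
pose C0 := enum_fset C.
have inC0 c : (c \in C0) = (c \in C) by [].
have HKb : well_sorted (PGuard (Kc b)).
  by rewrite -EK; apply: ws_instantiate; rewrite Hss.
have [Y HwY HbbY] : exists2 Y, weak (nus cs2 (PPar (PGuard R) Q1)) Y
    & bb (nus (cs1 ++ C0) (PPar (PGuard (Kc b)) P')) Y.
  apply: bb_weak Hbb _; rewrite nus_cat; apply: weak_step1; apply: step_tau_nus_intro.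
    by apply: ws_par; [exact: (proj1 HR)|exact: (proj1 HokP)].
  apply: (step_comR (a := x) (b := b)); first exact: fset_uniq.
  - by move=> c /CR.
  - by rewrite -EK; apply: step_sumR; apply: step_in.
  - by rewrite (enum_fset_seq erefl).
have notP' i : m <= i -> fl i \notin fn P'.
  by move=> Hi; apply: contra (flX1 i Hi); exact: P'X1.
have ncs1 i : m <= i -> fl i \in fn_guard R -> fl i \notin cs1 ++ C0.
  move=> Hi HiR; apply: notin_cat; first by apply: csA Hcs1 _ HiR; exact: flA'.
  by apply: contraTN HiR => /CR.
have wR : w \in fn_guard R by exact: KgR.
have w'R : w' \in fn_guard R by exact: KgR.
have Hbw : ubarb Y w.
  apply: (bb_ubarb HbbY (fl_out s0_out _)).
  apply: (@test_barb _ false X1) => //; [exact: (proj1 HokP')|by left|].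
  by apply: ncs1 wR; (clear; lia).
have Hbw' : ubarb Y w'.
  apply: (bb_ubarb HbbY (fl_out s0_out _)).
  apply: (@test_barb _ false X1) => //; [exact: (proj1 HokP')|by right|].
  by apply: ncs1 w'R; (clear; lia).
have fnKc c (b0 : seq (name S)) : size b0 = n -> c \in fn_guard (GSum (GTau (instantiate b0 Tp))
      (gsum (GTau (flag z)) m.+4.+1 (eq_branches s0 z (map (open_pair b0) (eq_pairs n X))))) ->
    [\/ c \in fn (instantiate b0 Tp), m.+4 <= c.2 | c \in b0 ++ X].
  move=> Hsz; rewrite [fn_guard _](_ : _ = fn (instantiate b0 Tp) ++ fn_guard
    (gsum (GTau (flag z)) m.+4.+1 (eq_branches s0 z (map (open_pair b0) (eq_pairs n X))))) //.
  rewrite mem_cat => /orP[H|/fn_branches[->|H|[pr Hpr Hc]]]; first by apply: Or31.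
  - by apply: Or32.
  - by apply: Or32; move: H; (clear; lia).
  - by apply: Or33; exact: fn_open_pair Hpr (esym Hsz) _ Hc.
(* Having received, the test on the left has lost [u]; the answering side cannot have kept it, so
   its test has moved too. *)
have Hnu : ~ ubarb Y u.
  move/(bb_ubarb (bb_sym HbbY) (fl_out s0_out _))/ubarb_fn; rewrite fn_nus => /andP[_].
  rewrite [fn (PPar _ _)](_ : _ = (fn_guard (marker false [::] w w') ++
    fn_guard (GSum (GTau (instantiate b Tp)) (gsum (GTau (flag z)) m.+4.+1
      (eq_branches s0 z (map (open_pair b) (eq_pairs n X)))))) ++ fn P') //.
  apply/negP; apply: notin_cat; last exact: notP'.
  apply: notin_cat.
    by apply/negP => /fn_marker[//|/fn_flag|/fn_flag] /=; (clear; lia).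
  apply/negP => /(fnKc _ _ erefl)[|/=|].
  - by rewrite ETb; apply/negP; exact: flT.
  - by (clear; lia).
  - rewrite mem_cat => Hc; have : u \in X1 by rewrite mem_cat orbC.
    by apply/negP; exact: flX1.
have flQ Q0 i : {subset fn Q0 <= X} -> m <= i -> fl i \notin fn Q0.
  by move=> HQ0 Hi; apply: contra (flX1 i Hi) => /HQ0/XX1.
case: (weak_context (proj1 HR) (proj1 HokQ1) HwY) =>
  [[Q2 HwQ2 EY]|[Q2 [T2 [_ HsT _]]]|[Q2 [Q3 [C1 [a [b1 [T2 [HwQ2 Ho HC1 HsT Hw2]]]]]]]].
- apply: Hnu; rewrite EY in Hbw *; have HokQ2 := ok_weak HwQ2 HokQ1.
  apply: test_barb (proj1 HokQ2) (proj1 HR) _ _.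
  + exact: (context_acts (eta := true) HR (proj1 HokQ2) (proj2 HokQ2) (fl_out s0_out _) Hbw).
  + by move=> c /(weak_fn HwQ2)/HQ1X.
  + by left.
  + apply: csA Hcs2 _ _; first by apply: flA'.
    rewrite ER; apply: sub_catl; apply: (@marker_has _ true); last by left.
    by move=> _ E; move: (PX _ xP); rewrite E.
- case: (step_sum_inv HsT) => [/step_marker[_ [y [b' //]]]|Hin]; by inversion Hin.
have HQ2X : {subset fn Q2 <= X} by move=> c /(weak_fn HwQ2)/HQ1X.
have HokQ2 := ok_weak HwQ2 HokQ1.
have fresh i : m <= i -> fl i \in fn_guard R -> fl i \notin b1 /\ fl i \notin fn Q3.
  by move=> Hi HiR; apply: comm_fresh Ho HC1 HiR _; exact: flQ.
have [wb1 wQ3] : w \notin b1 /\ w \notin fn Q3 by apply: fresh => //; (clear; lia).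
have [w'b1 w'Q3] : w' \notin b1 /\ w' \notin fn Q3 by apply: fresh => //; (clear; lia).
case: (step_test HsT) => [E|E|Hin]; try subst T2.
- by case: (no_barb Hw2 _ wQ3 Hbw); apply: flag_notin => /=; (clear; lia).
- by case: (no_barb Hw2 _ wQ3 Hbw); apply: flag_notin => /=; (clear; lia).
have [Ea ET2 Hsort1] : [/\ a = x, T2 = PGuard (Kc b1) & map (@nsort S) b1 = obj (nsort x)].
  by inversion Hin; subst; split=> //; rewrite EK.
subst a T2; have Hsz1 : size b1 = n by rewrite /n -(size_map (@nsort S)) Hsort1 -Hss size_map.
have HKb1 : well_sorted (PGuard (Kc b1)).
  by rewrite -EK; apply: ws_instantiate; rewrite Hsort1.
have HQ3 := ws_step Ho (proj1 HokQ2).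
(* Both [w] and [w'] are visible, so the receiving test has not yet chosen a summand. *)
have [|||Q4 HwQ4 EY] := @unmoved _ false [::] w w' _ Q3 _ _ HKb1 HQ3 _ _ _ Hw2 Hbw Hbw'.
- have nK v : v \notin b1 -> v \notin X -> v \notin fn_guard T1 -> v.2 < m.+4 ->
    v \notin fn_guard (GSum (GTau (instantiate b1 Tp))
      (gsum (GTau (flag z)) m.+4.+1 (eq_branches s0 z (map (open_pair b1) (eq_pairs n X))))).
    move=> vb vX vT vm; apply/negP => /(fnKc _ _ Hsz1)[/fn_instantiate/orP[/fnTp[]|]||].
    + by rewrite (negPf vT).
    + by rewrite (negPf vb).
    + by rewrite leqNgt vm.
    + by rewrite mem_cat (negPf vb) (negPf vX).
  split; [by rewrite /=; (clear; lia)|by rewrite !fl_out| |]; apply: notin_cat => //; apply: nK => //.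
  + by apply: contra (flX1 m.+2 (leqW (leqnSn m))); exact: XX1.
  + by apply: flT; (clear; lia).
  + by apply: contra (flX1 m.+3 (leqW (leqW (leqnSn m)))); exact: XX1.
  + by apply: flT; (clear; lia).
- by apply: sub_catl; apply: (@marker_has _ false [::]) => //; left.
- by apply: sub_catl; apply: (@marker_has _ false [::]) => //; right.
have HQ4Q3 := weak_fn HwQ4.
have HQ4 := weak_ws HwQ4 HQ3.
have ncs2 i : m <= i -> fl i \in fn_guard R -> fl i \notin cs2 ++ C1.
  move=> Hi HiR; apply: notin_cat; first by apply: csA Hcs2 _ HiR; exact: flA'.
  by apply: contraTN HiR => /HC1.
(* On either side the comparison flag of [p] is visible exactly if the two names compared are equal
   there, and barbs agree. *)
have pattern p : p \in eq_positions n X -> forall d1 d2 d1' d2',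
    open_pair b (eq_ref p) = (Free d1, Free d2) ->
    open_pair b1 (eq_ref p) = (Free d1', Free d2') -> (d1 = d2 <-> d1' = d2').
  move=> Hp d1 d2 d1' d2' E1 E2; set i := index p (eq_positions n X).
  set e := fl (m.+4.+1 + i.*2); have eR : e \in fn_guard R by apply/KgR/eKg.
  have em : m <= m.+4.+1 + i.*2 by (clear; lia).
  have [eb1 eQ3] := fresh _ em eR.
  have zR : z \in fn_guard R by exact: KgR.
  have [zb1 zQ3] : z \notin b1 /\ z \notin fn Q3 by apply: fresh => //; (clear; lia).
  have eX : e \notin X by apply: contra (flX1 _ em); exact: XX1.
  have eb : e \notin b by apply: contra (flX1 _ em); exact: sub_catr.
  have eTp b0 : e \notin b0 -> e \notin fn (instantiate b0 Tp).
    move=> eb0; apply/negP => /fn_instantiate/orP[/fnTp[H _]|]; last by rewrite (negPf eb0).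
    by move: (flT _ em); rewrite H.
  have epr (b0 : seq (name S)) : size b0 = n -> e \notin b0 ->
      forall pr, List.In pr (map (open_pair b0) (eq_pairs n X)) -> e \notin fn_ref pr.1 ++ fn_ref pr.2.
    move=> Hsz eb0 pr Hpr; apply/negP => /(fn_open_pair Hpr (esym Hsz)).
    by apply/negP; exact: notin_cat.
  have K1 : ubarb (nus (cs1 ++ C0) (PPar (PGuard (Kc b)) P')) e <-> d1 = d2.
    apply: kguard_barb => //; try by rewrite /=; (clear; lia).
    - exact: (proj1 HokP').
    - by rewrite onth_eq_pairs // E1.
    - exact: eTp.
    - exact: notP'.
    - by apply: notP'; (clear; lia).
    - exact: epr.
    - exact: ncs1.
  have K2 : ubarb (nus (cs2 ++ C1) (PPar (PGuard (Kc b1)) Q4)) e <-> d1' = d2'.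
    apply: kguard_barb => //; try by rewrite /=; (clear; lia).
    - by rewrite onth_eq_pairs // E2.
    - exact: eTp.
    - by apply: contra eQ3; exact: HQ4Q3.
    - by apply: contra zQ3; exact: HQ4Q3.
    - exact: epr.
    - exact: ncs2.
  rewrite EY in HbbY; split=> [/K1|/K2] H; [apply/K2|apply/K1].
    exact: (bb_ubarb HbbY (fl_out s0_out _) H).
  exact: (bb_ubarb (bb_sym HbbY) (fl_out s0_out _) H).
have HC1' : {in C1, forall c, c \notin X /\ c \notin fn (PGuard Kg)}.
  move=> c /HC1 Hc; split; first by apply: contra Hc; exact: XR.
  by apply: contra Hc; exact: KgR.
have iff_eq (T : eqType) (t1 t2 t3 t4 : T) : (t1 = t2 <-> t3 = t4) -> (t1 == t2) = (t3 == t4).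
  by move=> [H12 H21]; apply/eqP/eqP.
have [C2 [Q3' [Q4' [Ho' HwQ4' EZ HC2]]]] : exists C2 Q2' Q3',
    [/\ step Q2 (AOut [fset c in C2] x b) Q2', weak Q2' Q3',
      nus C1 (PPar (instantiate b1 (PGuard Kg)) Q4) = nus C2 (PPar (instantiate b (PGuard Kg)) Q3')
    & {in C2, forall c, c \notin X /\ c \notin fn (PGuard Kg)}].
  apply: (@align_output _ (PGuard Kg) X b x Q2 _ HQ2X n 0 b1 C1 Q3 Q4) => //.
  - by move=> c Hc HcX; apply: CKg; exact: bC.
  - by rewrite Hsort1 Hss.
  - move=> i j Hi Hj; apply: iff_eq; apply: (pattern (i, inl j)).
    + exact: eq_positions_pos.
    + by rewrite /open_pair /eq_ref !(@open_bound _ x).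
    + by rewrite /open_pair /eq_ref !(@open_bound _ x) // Hsz1.
  - move=> i c Hi Hc; apply: iff_eq; apply: (pattern (i, inr c)).
    + exact: eq_positions_name.
    + by rewrite /open_pair /eq_ref (@open_bound _ x).
    + by rewrite /open_pair /eq_ref (@open_bound _ x) // Hsz1.
rewrite !EK in EZ; rewrite EY !nus_cat EZ -!nus_cat in HbbY.
have [xQ2 HC2b HbQ2 HfQ3'] := step_fn Ho'.
(* With equal objects the extruded names agree: on both sides they are the objects outside [X]. *)
have EC : [fset c in C2] = C.
  apply/fsetP => c; apply/idP/idP => Hc.
    have [Hcb _] := HC2b c Hc; apply: bC => //.
    by rewrite in_fset_seq in Hc; case: (HC2 c Hc).
  have Hcb := HCb c Hc; case: (HbQ2 c Hcb) => // /HQ2X.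
  by rewrite (negPf (HCX c Hc)).
have inC2 c : (c \in C2) = (c \in C) by rewrite -EC in_fset_seq.
have HD Q5 : weak Q4' Q5 -> weak_step Q (AOut C x b) Q5.
  move=> Hw5; exists Q2, Q3'; split; first exact: weak_trans HwQ1 HwQ2.
    by rewrite -EC.
  exact: weak_trans HwQ4' Hw5.
have [HQ4' HQ4X] := DX1 _ (HD _ (weak_refl _)).
have HokQ4 := ok_of _ HQ4' HQ4X.
(* Opened with [b], the abstracted test is [T1] again; the left side enters it and the other one has
   to follow. *)
have [Y2 HwY2 HbbY2] : exists2 Y2, weak (nus (cs2 ++ C2) (PPar (PGuard (Kc b)) Q4')) Y2
    & bb (nus (cs1 ++ C0) (PPar (PGuard T1) P')) Y2.
  apply: bb_weak HbbY _; apply: weak_step1; apply: step_tau_nus_intro.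
    by apply: ws_par => //; exact: (proj1 HokP').
  apply: step_parL => //; apply: step_sumR; apply: step_sumL; rewrite ETb; exact: step_tau.
have TR c : c \in fn_guard T1 -> c \notin C -> c \in fn_guard R.
  by move=> H1c H2c; apply/KgR/TpKg; rewrite /Tp fn_abs; apply/andP; split.
(* [R] knows all names of [T1] except those in [C], and these lie in [A1]. *)
have csT1 cs (C' : seq (name S)) : (forall c, (c \in C') = (c \in C)) -> cs_ok cs R A ->
    cs_ok (cs ++ C') T1 A1.
  move=> EC' Hcs c; rewrite mem_cat EC' => Hc HcT.
  case: (boolP (c \in C)) Hc => [Hc _|HcC]; first exact: (X1A _ (CX1 _ Hc)).
  by rewrite orbF => Hc; apply: sub_catl; apply: Hcs Hc _; exact: TR.
have cs1T := csT1 cs1 C0 inC0 Hcs1; have cs2T := csT1 cs2 C2 inC2 Hcs2.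
have [w1w1' /andP[Ho1 Ho1'] w1A w1'A] := Hm1.
case/notin_cat_inv: w1A => w1A w1H; case/notin_cat_inv: w1'A => w1'A w1'H.
have w1T : w1 \in fn_guard T1 by apply: sub_catl; apply: (@marker_has _ false [::]) => //; left.
have w1'T : w1' \in fn_guard T1 by apply: sub_catl; apply: (@marker_has _ false [::]) => //; right.
have w1m := idxT _ w1T.
have HtyKb : seq_typed true (PGuard (Kc b)).
  split=> //; rewrite -EK; apply: typed_instantiate; rewrite Hss; exact: KgT.
have wQ4 c : c \notin A1 -> c \notin fn Q4' by apply: contra => /HQ4X/X1A.
have [||||||||||Q5 HwQ5 EY2] := @child _ false X1 w w' _ X1 w1 w1' H1 P' Q4' _ _ _ HbbY2 HwY2
  _ P'X1 (proj1 HokP') (proj1 HT1) (proj1 HokQ4) (proj2 HokQ4) HQ4X HtyKb _ _ _ _ _ (fl_out s0_out _) _ _ _ _.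
- by [].
- move=> mu G1 /step_sum_inv[/step_gtau_inv[-> ->]|Hs1 Hmu]; first by left; rewrite ETb.
  right; apply: (step_notin Hs1) => //; apply/negP => /fn_branches[|/=|[pr Hpr]].
  + by move: w1m; rewrite /=; (clear; lia).
  + by move: w1m; (clear; lia).
  + move/(fn_open_pair Hpr erefl); rewrite mem_cat orbC -mem_cat => /X1A.
    by apply/negP.
- by apply: notin_cat; [apply: flT|apply: notP']; (clear; lia).
- split=> //; first by rewrite Ho1 Ho1'.
    by apply: notin_cat => //; exact: wQ4.
  by apply: notin_cat => //; exact: wQ4.
- by move: w1m; rewrite /=; (clear; lia).
- by move: w1m; rewrite /=; (clear; lia).
- have w1b : w1 \in fn (instantiate b Tp) by rewrite ETb.
  exact: (sub_catl _ w1b).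
- exact: marks_notin_cs w1A w1T cs1T.
- exact: marks_notin_cs w1'A w1'T cs1T.
- apply: notin_cat; first by apply: csA Hcs2 _ wR; apply: flA'; (clear; lia).
  by rewrite inC2; apply: contraTN wR => /CR.
rewrite EY2 in HbbY2.
exact: (Hsep1 Q5 (HD _ HwQ5) _ _ cs1T cs2T HbbY2).
Qed.

End OutputChallenge.

(** * Approximants of sequential bisimilarity *)

Section FiniteSets.
Variable T : Type.
Implicit Types (A B : T -> Prop).

Definition fin A := exists l : seq T, forall t, A t -> List.In t l.

Lemma fin_sub A B : (forall t, A t -> B t) -> fin B -> fin A.
Proof. by move=> AB [l Hl]; exists l => t /AB/Hl. Qed.

Lemma fin_or A B : fin A -> fin B -> fin (fun t => A t \/ B t).
Proof.
move=> [l Hl] [l' Hl']; exists (l ++ l') => t.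
by case=> [/Hl|/Hl'] H; apply: List.in_or_app; [left|right].
Qed.

Lemma fin_map A (f : T -> T) : fin A -> fin (fun t => exists2 t', A t' & t = f t').
Proof.
move=> [l Hl]; exists (map f l) => t [t' /Hl H ->].
by elim: l {Hl} H => //= t0 l IH [->|/IH]; [left|right].
Qed.

Lemma fin_bind A (B : T -> T -> Prop) : fin A -> (forall t, A t -> fin (B t)) ->
  fin (fun t => exists2 t', A t' & B t' t).
Proof.
move=> [l Hl] HB.
suff [l' Hl'] : fin (fun t => exists2 t', List.In t' l /\ A t' & B t' t).
  by exists l' => t [t' H1 H2]; apply: Hl'; exists t' => //; split=> //; exact: Hl.
elim: l {Hl} => [|t0 l IH]; first by exists [::] => t [t' []].
case: (classic (A t0)) => [/HB H0|H0].
  apply: fin_sub (fin_or H0 IH) => t [t' [[E|H1] H2] H3]; first by left; rewrite E.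
  by right; exists t'.
by apply: fin_sub IH => t [t' [[E|H1] H2] H3]; [case: H0; rewrite E|exists t'].
Qed.

(** If each of the finitely many candidates failed at some stage, then at the sum of these stages
    none would be left. *)
Lemma fin_compact A (B : nat -> T -> Prop) : fin A ->
  (forall n, exists2 t, A t & B n t) -> (forall n t, B n.+1 t -> B n t) ->
  exists2 t, A t & forall n, B n t.
Proof.
move=> [l Hl] HB Hmono; apply: NNPP => Hno.
have Hmono' n k t : B (n + k)%N t -> B n t.
  by elim: k => [|k IH]; rewrite ?addn0 // addnS => /Hmono.
suff [N HN] : exists N, forall t, List.In t l -> A t -> ~ B N t.
  by have [t At Bt] := HB N; exact: HN (Hl _ At) At Bt.
elim: l {Hl} => [|t0 l [N HN]]; first by exists 0.
case: (classic (A t0)) => [A0|nA0]; last first.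
  by exists N => t [E|/HN]; [rewrite -E => /nA0|].
have [n Hn] : exists n, ~ B n t0.
  by apply: not_all_ex_not => H; apply: Hno; exists t0.
exists (N + n)%N => t [E _|Ht At] Bt; last exact: HN Ht At (Hmono' _ _ _ Bt).
by apply: Hn; rewrite E; apply: (Hmono' _ N); rewrite addnC.
Qed.

End FiniteSets.

(** * Image finiteness with a message in parallel *)

Section ImageFinite.
Variable S : sorting.
Implicit Types (P Q Z M : proc S) (mu : action S) (b : seq (name S)) (x : name S).

Lemma image_finite_step P mu P' : image_finite P -> step P mu P' -> image_finite P'.
Proof. by move=> [I [HP Hcl Hfin]] Hs; exists I; split=> //; exact: Hcl HP Hs. Qed.

Lemma image_finite_weak P P' : image_finite P -> weak P P' -> image_finite P'.
Proof.
move=> HP Hw; apply: (weak_inv _ Hw HP) => P0 P1 H0 Hs; exact: image_finite_step H0 Hs.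
Qed.

Lemma image_finite_weak_step P mu P' : image_finite P -> weak_step P mu P' -> image_finite P'.
Proof.
move=> HP [P0 [P1 [Hw0 Hs Hw1]]].
exact: image_finite_weak (image_finite_step (image_finite_weak HP Hw0) Hs) Hw1.
Qed.

Lemma fin_weak_step P mu : image_finite P -> fin (weak_step P mu).
Proof. by move=> [I [HP _ Hfin]]; exact: Hfin. Qed.

Lemma weak_inv_step P P' : weak P P' -> P = P' \/ weak_step P ATau P'.
Proof.
move=> Hw; elim/weak_ind: Hw => [P0|P0 P1 P2 Hs Hw _]; first by left.
by right; exists P0, P1; split=> //; exact: weak_refl.
Qed.

Lemma fin_weak P : image_finite P -> fin (weak P).
Proof.
move=> /(fin_weak_step ATau)[l Hl]; exists (P :: l) => P' /weak_inv_step[->|/Hl]; [by left|by right].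
Qed.

Lemma weak_step_pad_inv P mu Z : weak_step (PPar P (PGuard GNil)) mu Z ->
  exists2 P', weak_step P mu P' & Z = PPar P' (PGuard GNil).
Proof.
case=> Z0 [Z1 [/weak_pad_inv[P0 Hw0 ->] /step_pad_inv[P1 Hs ->] /weak_pad_inv[P2 Hw2 ->]]].
by exists P2 => //; exists P0, P1.
Qed.

Lemma step_par_msg_inv P x b mu Z : step (PPar P (out_msg x b)) mu Z ->
  [\/ exists2 P', step P mu P' & Z = PPar P' (out_msg x b),
      mu = AOut fset0 x b /\ Z = PPar P (PGuard GNil)
    | mu = ATau /\ exists2 P', step P (AIn x b) P' & Z = PPar P' (PGuard GNil)].
Proof.
case/step_par_inv=> [[P' [Hs _ ->]]|[Z' [/step_msg_inv[-> ->] _ ->]]|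
  [cs [a [b' [P' [Z' [-> _ _ /step_msg_inv[]]]]]]]|
  [cs [a [b' [P' [Z' [-> _ Hs1 /step_msg_inv[[EC Ea Eb] ->] ->]]]]]]] //.
- by apply: Or31; exists P'.
- by apply: Or32.
- apply: Or33; split=> //; subst; exists P' => //.
  by rewrite (fset_seq_nil EC).
Qed.

Lemma weak_par_msg_inv P x b Z : weak (PPar P (out_msg x b)) Z ->
  (exists2 P', weak P P' & Z = PPar P' (out_msg x b)) \/
  (exists2 P', weak_step P (AIn x b) P' & Z = PPar P' (PGuard GNil)).
Proof.
move E: (PPar P _) => Z0 Hw; elim/weak_ind: Hw P E => [Z1 P <-|Z1 Z2 Z3 Hs Hw IH P E].
  by left; exists P => //; exact: weak_refl.
subst Z1; case: (step_par_msg_inv Hs) => [[P' Hs' EZ]|[//]|[_ [P' Hs' EZ]]]; subst Z2.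
  case: (IH P' erefl) => [[P2 Hw2 ->]|[P2 [P3 [P4 [Hw3 Hs3 Hw4]]] ->]].
    by left; exists P2 => //; exact: weak_trans (weak_step1 Hs') Hw2.
  right; exists P2 => //; exists P3, P4; split=> //.
  exact: weak_trans (weak_step1 Hs') Hw3.
have [P2 Hw2 ->] := weak_pad_inv Hw.
by right; exists P2 => //; exists P, P'; split=> //; exact: weak_refl.
Qed.

(** When the message is gone, it was received after [mu] or before [mu], or [mu] is its output, or
    [mu] is the internal step of its reception. *)
Lemma weak_step_par_msg_inv P x b mu Z : weak_step (PPar P (out_msg x b)) mu Z ->
  (exists2 P', weak_step P mu P' & Z = PPar P' (out_msg x b)) \/
  (exists2 P', (exists2 P1, weak_step P mu P1 & weak_step P1 (AIn x b) P') \/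
               ((exists2 P1, weak_step P (AIn x b) P1 & weak_step P1 mu P') \/
                (weak P P' \/ weak_step P (AIn x b) P'))
     & Z = PPar P' (PGuard GNil)).
Proof.
case=> Z0 [Z1 [/weak_par_msg_inv[[P0 Hw0 ->]|[P0 Hw0 ->]] Hs Hw1]]; last first.
  have [P1 Hs1 E] := step_pad_inv Hs; subst Z1; have [P2 Hw2 ->] := weak_pad_inv Hw1.
  right; exists P2 => //; right; left; exists P0 => //.
  by exists P0, P1; split=> //; exact: weak_refl.
case: (step_par_msg_inv Hs) => [[P1 Hs1 E]|[_ E]|[_ [P1 Hs1 E]]]; subst Z1.
- case: (weak_par_msg_inv Hw1) => [[P2 Hw2 ->]|[P2 Hw2 ->]].
    by left; exists P2 => //; exists P0, P1.
  right; exists P2 => //; left; exists P1 => //.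
  by exists P0, P1; split=> //; exact: weak_refl.
- have [P2 Hw2 ->] := weak_pad_inv Hw1; right; exists P2 => //.
  by do 2!right; left; exact: weak_trans Hw0 Hw2.
- have [P2 Hw2 ->] := weak_pad_inv Hw1; right; exists P2 => //.
  by do 3!right; exists P0, P1.
Qed.

(** A message is consumed at most once, so a weak transition combines at most two weak transitions
    of the process, and finite branching composes. *)
Lemma image_finite_msg P x b : image_finite P -> image_finite (PPar P (out_msg x b)).
Proof.
move=> HP.
exists (fun Z => exists P M, [/\ image_finite P, M = PGuard GNil \/ M = out_msg x b & Z = PPar P M]).
split; first by exists P, (out_msg x b); split=> //; right.
- move=> Z mu Z' [P1 [M [H1 [E|E] ->]]] Hs; subst M.
    have [P2 Hs2 ->] := step_pad_inv Hs; exists P2, (PGuard GNil); split=> //; last by left.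
    exact: image_finite_step H1 Hs2.
  case: (step_par_msg_inv Hs) => [[P2 Hs2 ->]|[_ ->]|[_ [P2 Hs2 ->]]].
  + by exists P2, (out_msg x b); split=> //; [exact: image_finite_step H1 Hs2|right].
  + by exists P1, (PGuard GNil); split=> //; left.
  + by exists P2, (PGuard GNil); split=> //; [exact: image_finite_step H1 Hs2|left].
- move=> Z mu [P1 [M [H1 [E|E] ->]]]; subst M.
    apply: fin_sub (fin_map (fun P' => PPar P' (PGuard GNil)) (fin_weak_step mu H1)) => Z'.
    exact: weak_step_pad_inv.
  apply: (fin_sub (@weak_step_par_msg_inv P1 x b mu)).
  apply: fin_or; first exact: (fin_map (fun P' => PPar P' (out_msg x b)) (fin_weak_step mu H1)).
  apply: (fin_map (fun P' => PPar P' (PGuard GNil))).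
  have Hb mu1 mu2 : fin (fun P' => exists2 P2, weak_step P1 mu1 P2 & weak_step P2 mu2 P').
    apply: fin_bind; first exact: fin_weak_step.
    by move=> P2 /(image_finite_weak_step H1); exact: fin_weak_step.
  by do 3!apply: fin_or => //; [exact: fin_weak|exact: fin_weak_step].
Qed.

End ImageFinite.

(** * Approximants, and tests from their failure *)

Section Approximants.
Variable S : sorting.
Implicit Types (P Q Z : proc S) (mu : action S) (b : seq (name S)) (x a : name S) (eta : bool).

Definition good eta P := [/\ seq_typed eta P, only_out P & image_finite P].

Lemma good_ok eta P : good eta P -> ok P.
Proof. by case=> -[H1 _] H2 _; split=> //; exact: (proj1 (only_out_fn S)). Qed.

Lemma good_step eta P mu P' : good eta P -> step P mu P' -> allowed eta mu ->
  good (next_eta eta mu) P'.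
Proof.
move=> [[H1 H2] H3 H4] Hs Ha; split; last exact: image_finite_step H4 Hs.
  split; first exact: ws_step Hs H1.
  have := typed_step Hs H2; case: mu {Hs} Ha => [|a b|C a b] //= Ha.
    case: ifP => // Ea Ht; case: Ha => [E|/=]; [exact: Ht|by rewrite Ea].
  by case: ifP => // _ [].
exact: (proj1 (only_out_step Hs H3)).
Qed.

Lemma good_weak eta P P' : good eta P -> weak P P' -> good eta P'.
Proof.
move=> HP Hw; apply: (weak_inv _ Hw HP) => P0 P1 H0 Hs.
by apply: (good_step H0 Hs); right.
Qed.

Lemma good_msg Q x b : good false Q -> out_ctl x -> map (@nsort S) b = obj (nsort x) ->
  all (@out_ctl S) b -> good true (PPar Q (out_msg x b)).
Proof.
move=> [[H1 H2] H3 H4] Hx Hb Hbo; split; last exact: image_finite_msg.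
  split; first by apply: ws_par => //; exact: sorted_msg.
  by apply: (@ty_par _ _ true false true) => //; exact: typed_msg.
by rewrite /= H3 Hx all_map.
Qed.

(** With the message beside [Q], the answer to an input is an internal run, which contexts can
    follow. *)
Definition response Q mu Q' :=
  if mu is AIn a b then weak (PPar Q (out_msg a b)) Q' else weak_hat Q mu Q'.

(** All subjects are output-controlled: an input there is not allowed at type 1, and an output there
    is not typable at type 0. *)
Lemma good_challenge eta P mu P' : good eta P -> step P mu P' -> allowed eta mu ->
  match mu with
  | ATau => True
  | AIn a b => [/\ eta = false, out_ctl a, map (@nsort S) b = obj (nsort a) & all (@out_ctl S) b]
  | AOut _ a b => [/\ eta = true, out_ctl a & all (@out_ctl S) b]
  end.
Proof.
move=> HP Hs Ha; have [_ HoP] := good_ok HP; case: HP => [[H1 H2] H3 H4].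
have := step_fn Hs; have := step_obj_sorts Hs H1.
have := proj2 (only_out_step Hs H3); have := typed_step Hs H2.
case: mu Ha {Hs} => [|a b|C a b] //= Ha Ht Hbo Hb [Hin].
  have Hoa := allP HoP _ Hin; move=> _; split=> //.
  by case: Ha => //; rewrite Hoa.
have Hoa := allP HoP _ Hin; move=> _ _ _; split=> //.
by move: Ht; rewrite Hoa => -[].
Qed.

Lemma good_response eta P Q mu P' Q' : good eta P -> good eta Q -> step P mu P' ->
  allowed eta mu -> response Q mu Q' -> good (next_eta eta mu) Q'.
Proof.
move=> HP HQ Hs Ha; have := good_challenge HP Hs Ha.
case: mu Ha {Hs} => [|a b|C a b] /= Ha.
- by move=> _; exact: good_weak.
- move=> [E Hoa Hb Hbo]; subst eta; rewrite Hoa; apply: good_weak; exact: good_msg.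
- move=> [E Hoa Hbo]; subst eta; rewrite Hoa => -[Q0 [Q1 [Hw0 Hs1 Hw1]]].
  apply: good_weak Hw1; have := good_step (good_weak HQ Hw0) Hs1; rewrite /= Hoa; apply.
  by right.
Qed.

Lemma fin_response eta Q mu : good eta Q -> fin (response Q mu).
Proof.
case=> _ _ HQ; case: mu => [|a b|C a b] /=.
- exact: fin_weak.
- by apply: fin_weak; exact: image_finite_msg.
- exact: fin_weak_step.
Qed.

Definition answers (R : bool -> proc S -> proc S -> Prop) eta P Q :=
  forall mu P', allowed_step eta P mu P' -> bn_fresh mu Q ->
    exists2 Q', response Q mu Q' & R (next_eta eta mu) P' Q'.

Fixpoint approx n eta P Q : Prop :=
  if n is n'.+1 then answers (approx n') eta P Q /\ answers (approx n') eta Q P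
  else True.

Lemma approx_sym n eta P Q : approx n eta P Q -> approx n eta Q P.
Proof. by case: n => //= n []. Qed.

Lemma answers_mono (R R' : bool -> proc S -> proc S -> Prop) eta P Q :
  (forall e P Q, R e P Q -> R' e P Q) -> answers R eta P Q -> answers R' eta P Q.
Proof. by move=> RR' H mu P' Ha Hf; have [Q' H1 /RR' H2] := H mu P' Ha Hf; exists Q'. Qed.

Lemma approx_mono n eta P Q : approx n.+1 eta P Q -> approx n eta P Q.
Proof.
elim: n eta P Q => [|n IH] eta P Q //= [H1 H2]; split; by apply: answers_mono IH _.
Qed.

(** At type 1 only internal steps and outputs are challenges. Silent processes have no outputs, and
    an internal step is answered by standing still. *)
Lemma approx_silent n P Q : good true P -> good true Q -> ~ active P -> ~ active Q ->
  approx n true P Q.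
Proof.
have silent P0 P1 : step P0 ATau P1 -> ~ active P0 -> ~ active P1.
  by move=> Hs Hn [x Hx]; apply: Hn; exists x; apply: ubarb_weak Hx; exact: weak_step1.
elim: n P Q => //= n IH P Q HP HQ HnP HnQ.
have half P0 Q0 : good true P0 -> good true Q0 -> ~ active P0 -> ~ active Q0 ->
    answers (approx n) true P0 Q0.
  move=> H1 H2 H3 H4 mu P' [_ Hs Ha] _; have := good_challenge H1 Hs Ha.
  case: mu Hs Ha => [|a b|C a b] Hs Ha /=; last 2 first.
  - by case.
  - by move=> _; case: H3; exists a, P0; [exact: weak_refl|exists C, b, P'].
  move=> _; exists Q0; first exact: weak_refl.
  by apply: IH => //; [exact: (good_step H1 Hs Ha)|exact: silent Hs H3].
by split; apply: half.
Qed.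

(** A visible challenge would have an output-controlled subject; internal steps are answered by
    standing still. *)
Lemma approx_no_out n eta P Q : (forall s : srt S, ~~ outc s) -> good eta P -> good eta Q ->
  approx n eta P Q.
Proof.
move=> Hno; elim: n eta P Q => //= n IH eta P Q HP HQ.
have half P0 Q0 : good eta P0 -> good eta Q0 -> answers (approx n) eta P0 Q0.
  move=> H1 H2 mu P' [_ Hs Ha] _; have := good_challenge H1 Hs Ha.
  case: mu Hs Ha => [|a b|C a b] Hs Ha /=; last 2 first.
  - by case=> _; rewrite /out_ctl (negPf (Hno _)).
  - by case=> _; rewrite /out_ctl (negPf (Hno _)).
  move=> _; exists Q0; first exact: weak_refl.
  by apply: IH => //; exact: (good_step H1 Hs Ha).
by split; apply: half.
Qed.

(** The direction is decided by the side whose challenge goes unanswered: this side is kept fixed,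
    and the test separates it from all derivatives of the other. *)
Lemma not_approx_distinguishable (s0 : srt S) n eta P Q : outc s0 -> good eta P -> good eta Q ->
  ~ approx n eta P Q -> distinguishable eta P Q \/ distinguishable eta Q P.
Proof.
move=> Hs0; elim: n eta P Q => [|n IH] eta P Q HP HQ Hna; first by case: Hna.
have half P0 Q0 : good eta P0 -> good eta Q0 -> ~ answers (approx n) eta P0 Q0 ->
    distinguishable eta P0 Q0.
  move=> H1 H2 Hn; apply: NNPP => Hnd; apply: Hn => mu P' [_ Hs Ha] Hf.
  apply: NNPP => Hno; apply: Hnd.
  have HP' := good_step H1 Hs Ha.
  have HD Q' : response Q0 mu Q' -> ~ approx n (next_eta eta mu) P' Q'.
    by move=> HR Happ; apply: Hno; exists Q'.
  have Hdist Q' : response Q0 mu Q' -> distinguishable (next_eta eta mu) P' Q' \/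
      distinguishable (next_eta eta mu) Q' P'.
    by move=> HR; apply: IH (HD _ HR) => //; exact: good_response Hs Ha HR.
  have [l Hl] := fin_response mu H2.
  have Hch := good_challenge H1 Hs Ha.
  (* Silent processes approximate each other at every stage, so an answer that fails against a
     silent [P'] must be active. *)
  have Hsil Q' : next_eta eta mu = true -> ~ active P' -> response Q0 mu Q' -> active Q'.
    move=> E HnP' HR; apply: NNPP => HnQ'; apply: (HD _ HR); move: HP'; rewrite E => HP'.
    apply: approx_silent => //; rewrite -E; exact: good_response Hs Ha HR.
  case: mu Hs Ha Hf HP' HD Hdist Hl Hch Hsil {Hno} => [|x b|C x b] Hs Ha Hf HP' HD Hdist Hl Hch Hsil.
  - apply: (distinguishable_tau Hs0 (good_ok H1) (good_ok H2) Hs Hl Hdist).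
    by move=> E HnP' Q' HR; apply: Hsil.
  (* Receiving the message is an internal step to [PPar P' (PGuard GNil)], so the internal case
     applies to the processes with the message beside them. *)
  - case: Hch => E Hx Hb Hbo; subst eta; rewrite /= Hx in HP' HD Hdist Hsil.
    have G1 := good_msg H1 Hx Hb Hbo; have G2 := good_msg H2 Hx Hb Hbo.
    apply: (distinguishable_input Hs0 (good_ok H1) (good_ok H2) Hb Hx).
    apply: (distinguishable_tau Hs0 (good_ok G1) (good_ok G2) (P' := PPar P' (PGuard GNil)) (l := l)) => //.
    + apply: (@step_comR _ _ _ [::] x b) Hs _ => //.
      rewrite [[fset c in _]](_ : _ = fset0); last by apply/fsetP => c; rewrite !inE.
      exact: step_out.
    + have HwsP' : well_sorted P' by exact: (proj1 (good_ok HP')).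
      by move=> Q' /Hdist[Hd|Hd]; [left; exact: distinguishable_padl|right; exact: distinguishable_padr].
    + move=> _ HnP' Q' HR; apply: Hsil => // -[y [Z Hw Hob]]; apply: HnP'; exists y.
      exists (PPar Z (PGuard GNil)); first exact: weak_parL.
      by case: Hob => C [b' [Z' HsZ]]; exists C, b', (PPar Z' (PGuard GNil)); exact: step_pad.
  - case: Hch => E Hx Hbo; subst eta; rewrite /= Hx in Hdist.
    exact: (distinguishable_output Hs0 (good_ok H1) (good_ok H2) Hs Hf Hbo Hl Hdist).
case: (classic (answers (approx n) eta P Q)) => [H1|/half H]; last by left; exact: H.
right; apply: half => // H2; by apply: Hna.
Qed.

(** The answer may a priori depend on the stage; as the answers to one challenge are finitely many
    and the approximants decrease, one answer serves all stages. *)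
Lemma approx_bisimulation :
  seq_bisimulation (fun eta P Q => [/\ good eta P, good eta Q & forall n, approx n eta P Q]).
Proof.
have half eta P Q : good eta P -> good eta Q -> (forall n, approx n eta P Q) ->
    forall mu P', allowed_step eta P mu P' -> bn_fresh mu Q ->
    exists2 Q', response Q mu Q' & [/\ good (next_eta eta mu) P', good (next_eta eta mu) Q'
      & forall n, approx n (next_eta eta mu) P' Q'].
  move=> HP HQ Happ mu P' Has Hf; have [_ Hs Ha] := Has.
  have [n|n Q' /approx_mono //|Q' HR HA] := fin_compact (fin_response mu HQ)
    (B := fun n Q' => approx n (next_eta eta mu) P' Q').
    by have [H _] := Happ n.+1; exact: H.
  exists Q' => //; split=> //; [exact: good_step HP Hs Ha|exact: good_response Hs Ha HR].
have step_match eta P Q (R : bool -> proc S -> proc S -> Prop) : good eta P -> good eta Q ->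
    (forall n, approx n eta P Q) ->
    (forall e P' Q', [/\ good e P', good e Q' & forall n, approx n e P' Q'] -> R e P' Q') ->
    matches R eta P Q.
  move=> HP HQ Happ HR mu eta' P' [Has ->] Hf.
  have [Q' Hresp /HR HQ'] := half eta P Q HP HQ Happ mu P' Has Hf.
  case: mu {Has Hf} Hresp HQ' => [|a b|C a b] Hresp HQ'; [left|right|left]; try by exists Q'.
  by exists a, b; split=> //; exists Q'.
move=> eta P Q [HP HQ Happ]; split; [by case: HP|by case: HQ| |].
  exact: step_match.
apply: step_match => //; first by move=> n; exact: approx_sym.
by move=> e P' Q' [H1 H2 H3]; split=> // n; exact: approx_sym.
Qed.

End Approximants.

Theorem mainTheorem2 (S : sorting) (eta : bool) (P Q : proc S) :
  image_finite P -> image_finite Q ->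
  only_out P -> only_out Q ->
  seq_barbed_equiv eta P Q ->
  seq_bisimilar eta P Q.
Proof.
move=> HfP HfQ HoP HoQ [HtP HtQ Heq].
have HP : good eta P by split.
have HQ : good eta Q by split.
(* The context restricts nothing, and its type [~~ eta] adds up with [eta] to 1. *)
have fillT (G : guard S) : seq_typed (~~ eta) (PGuard G) ->
    barbed_bisimilar true (PPar (PGuard G) P) (PPar (PGuard G) Q).
  move=> HG; apply: (Heq true (StaticCtx [::] (PGuard G))); exists (~~ eta) => //.
  by case: (eta).
exists (fun eta P Q => [/\ good eta P, good eta Q & forall n, approx n eta P Q]).
  exact: approx_bisimulation.
split=> // n; apply: NNPP => Hna.
(* Flags need an output-controlled sort; if there is none, there are no visible challenges and the
   approximants hold anyway. *)
have [[s0 Hs0]|Hno] := classic (exists s0 : srt S, outc s0); last first.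
  by apply/Hna/approx_no_out => // s; apply/negP => Hs; apply: Hno; exists s.
have nocs (G : guard S) : cs_ok [::] G [::] by move=> c.
case: (not_approx_distinguishable Hs0 HP HQ Hna) => /(_ [::])[w [w' [H [[HG _] Hsep]]]].
  exact: (Hsep Q (weak_refl Q) [::] [::] (nocs _) (nocs _) (fillT _ HG)).
exact: (Hsep P (weak_refl P) [::] [::] (nocs _) (nocs _) (bb_sym (fillT _ HG))).
Qed.
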